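(* Suppose that $U$ is a simply connected, bounded domain in $\mathbb{C}$, and that $K$ is a compact subset of $U$. Then there is a constant $C$ such that if $W$ is a simply connected domain with $H(\partial U,\partial W)\le\varepsilon$, then $$|\rho_U(z)-\rho_W(z)|\le C\,(\log(\log(1/\varepsilon)))^{-1}\qquad\text{for all } z\in K,$$ provided that $\varepsilon$ is sufficiently small. The constant $C$ depends on $d(K,\partial U)$ and the diameter of $U$.
   Context: All distances are Euclidean. For sets $A,B\subset\mathbb{C}$, $d(A,B)=\inf_{z\in A,\,w\in B}|z-w|$, and the Hausdorff distance is $H(A,B)=\inf\{r>0: A\subseteq N_r(B)\text{ and }B\subseteq N_r(A)\}$, where $N_r(A)$ is the set of all points whose distance from $A$ is less than $r$. $\partial U$ denotes the boundary of $U$. For a hyperbolic domain $A$ (one whose boundary in the Riemann sphere has at least 3 points) and $z\in A$, $\rho_A(z)$ denotes the hyperbolic density of $A$ at $z$, normalized to have curvature $-4$, i.e. $\rho_A(z)=1/|\pi'(0)|$, where $\pi$ is a holomorphic covering map from the unit disc $\mathbb{D}$ to $A$ with $\pi(0)=z$.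
   Formalization: The estimate is stated for those z in K that lie in W: as written, ρ_W(z) may be undefined on K, e.g. when U is the unit disc, K={0} and W is a thin slit annulus near the unit circle, which is simply connected with boundary close to ∂U. *)

(* Defs.v *)
From HB Require Import structures.
From mathcomp Require Import all_boot all_order all_algebra.
From mathcomp Require Import all_classical all_reals all_analysis.
From mathcomp Require Import complex.

Set Implicit Arguments.
Unset Strict Implicit.
Unset Printing Implicit Defensive.

Import Order.TTheory GRing.Theory Num.Theory.
Import numFieldNormedType.Exports.

Local Open Scope classical_set_scope.
Local Open Scope ring_scope.

(* R[i] as a normed space over itself, so that [derivable f z 1] and
   [derive1 f z] are complex differentiability and the complex derivative. *)
HB.instance Definition _ (R : realType) := GRing.ComAlgebra.copy R[i] R[i]^o.
HB.instance Definition _ (R : realType) := Vector.copy R[i] R[i]^o.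
HB.instance Definition _ (R : realType) := NormedModule.copy R[i] R[i]^o.

(* The norm `|z| of the library lives in R[i]; cabs is the same modulus in R. *)
Notation cabs := ComplexField.Normc.normc.

Section PlaneMetric.
Context {R : realType}.
Implicit Types (A B : set R[i]) (r : R).

Definition boundary A : set R[i] := closure A `\` interior A.

(* Distances are extended reals: the infimum over the empty set is +oo. *)
Definition set_dist A B : \bar R :=
  ereal_inf [set (cabs (z - w))%:E | z in A & w in B].

Definition thickening r A : set R[i] :=
  [set z | (set_dist [set z] A < r%:E)%E].

Definition hausdorff_dist A B : \bar R :=
  ereal_inf [set r%:E | r in
    [set r | [/\ 0 < r, A `<=` thickening r B & B `<=` thickening r A]]].

Definition diameter A : \bar R :=
  ereal_sup [set (cabs (z - w))%:E | z in A & w in A].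

End PlaneMetric.

Section Domains.
Context {R : realType}.
Implicit Types A : set R[i].

Definition domain A := [/\ A !=set0, open A & connected A].

Definition null_homotopic A (g : R -> R[i]) :=
  exists H : R * R -> R[i],
    [/\ {within `[0, 1] `*` `[0, 1], continuous H},
        forall s t, 0 <= s <= 1 -> 0 <= t <= 1 -> A (H (s, t)),
        forall t, 0 <= t <= 1 -> H (0, t) = g t /\ H (1, t) = g 0
      & forall s, 0 <= s <= 1 -> H (s, 0) = g 0 /\ H (s, 1) = g 0].

Definition simply_connected A :=
  connected A /\
  forall g : R -> R[i],
    {within `[0, 1], continuous g} ->
    (forall t, 0 <= t <= 1 -> A (g t)) ->
    g 0 = g 1 ->
    null_homotopic A g.

End Domains.

Section HyperbolicDensity.
Context {R : realType}.
Implicit Types (A B S V : set R[i]) (p : R[i] -> R[i]).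

Definition unit_disc : set R[i] := [set z | cabs z < 1].

(* Meant for open A. *)
Definition holomorphic_on A p := forall z, A z -> derivable p z 1.

Definition homeo_onto S V p :=
  [/\ {within S, continuous p}, set_bij S V p
    & exists q : R[i] -> R[i],
        {within V, continuous q} /\ forall z, S z -> q (p z) = z].

(* For open B and A, so that open subsets of B or A are open in the plane;
   F is the family of sheets over V. *)
Definition covering_map B A p :=
  [/\ {within B, continuous p}, p @` B = A
    & forall a, A a -> exists V, exists F : set (set R[i]),
        [/\ open V /\ V a, V `<=` A, trivIset F id,
            \bigcup_(S in F) S = B `&` p @^-1` V
          & forall S, F S -> open S /\ homeo_onto S V p]].

(* The set of values has exactly one element when A is a hyperbolic domain and
   z is in A (uniformization, Schwarz lemma); otherwise the value is
   meaningless. *)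
Definition hyperbolic_density A (z : R[i]) : R :=
  xget 0 [set r : R | exists p,
    [/\ holomorphic_on unit_disc p, covering_map unit_disc A p, p 0 = z
      & r = (cabs (derive1 p 0))^-1]].

End HyperbolicDensity.

(* Main.v *)
(** A covering p of a planar domain omits the boundary points a, so the
    logarithm of a bounded multiple of |p - a| is controlled by its value at the
    origin (Harnack; here, Schwarz-Pick for iterated square roots of p - a).
    Hence p keeps the disc |w| < 1 - t at distance at least exp(-O(t^-2)) from
    the boundary of U. If this exceeds the Hausdorff distance of the
    boundaries, then p maps that disc into W and lifts through a covering q of
    W, and the Schwarz lemma gives |p'(0)| (1 - t) <= |q'(0)|; the situation is
    symmetric in U and W. Taking t proportional to 1 / log log (1 / eps) is
    more than enough, so the constant C can even be 1.

    The density is only meaningful if a covering by the disc exists, so the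
    Riemann mapping theorem is needed; it is obtained from the Koebe iteration,
    where only square roots on simply connected domains are used. All function
    theory rests on the maximum principle for functions that are merely complex
    differentiable at each point. It comes from a discretised Goursat argument
    for f (c + r exp zeta) on a rectangle; integrals and power series are
    avoided, derivatives being handled through finite differences. *)

Require Import Defs.
From mathcomp Require Import all_boot all_order all_algebra.
From mathcomp Require Import all_classical all_reals all_analysis.
From mathcomp Require Import complex ring lra.
Import Order.TTheory GRing.Theory Num.Theory.
Import numFieldNormedType.Exports.
Import ComplexField.Normc.
Set Implicit Arguments.
Unset Strict Implicit.
Unset Printing Implicit Defensive.
Local Open Scope complex_scope.
Local Open Scope classical_set_scope.
Local Open Scope ring_scope.
Local Notation Re := complex.Re.
Local Notation Im := complex.Im.

(** * Complex differentiability *)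

Section Basics.
Context {R : realType}.
Local Notation C := R[i].
Implicit Types (z w a b : C) (f g : C -> C) (r M : R).

(** Schwarz-Pick for a zero-free function [v] bounds [|v w|] below only where [|w| < |v 0|]. The
    [2 ^ m]-th root has modulus close to 1 at the origin, so for it the estimate reaches
    [|w| = 1 - t] as soon as [2 ^ m] is of order [1 / t]; the root is then at least a multiple of
    [t], and the exponential loss comes from raising this back to the power [2 ^ m].

    The Koebe iteration is preferred to the usual extremal problem because it dispenses with normal
    families: the derivatives at 0 of the left inverses decrease and stay bounded below, and a
    self-map of the disc that fixes 0 with derivative close to 1 is close to the identity, so the
    whole sequence is Cauchy.

    Both arguments need bounded domains. For [W] boundedness is not given; it follows from simple
    connectivity and the boundedness of its boundary.

    The margin [d] of [K] in [U] and the size of [U] enter only through [eps0]: both derivatives are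
    at least [d / 2], so inverting them costs a factor [2 / d], and this is cancelled by the choice
    [t = (d / 4) / log log (1 / eps)]. *)

Lemma cabs_ge0 z : 0 <= cabs z.
Proof. by case: z => x y; exact: sqrtr_ge0. Qed.

Lemma cabs_gt0 z : (0 < cabs z) = (z != 0).
Proof.
rewrite lt_def cabs_ge0 andbT; congr negb; apply/eqP/eqP => [|->].
  exact: eq0_normc.
exact: normc0.
Qed.

Lemma addBK z w : z + (w - z) = w. Proof. ring. Qed.
Lemma addKB z w : z + w - z = w. Proof. ring. Qed.

Lemma cabs0 : cabs (0 : C) = 0. Proof. exact: normc0. Qed.
Lemma cabs1 : cabs (1 : C) = 1. Proof. exact: normc1. Qed.
Lemma cabsM z w : cabs (z * w) = cabs z * cabs w. Proof. exact: normcM. Qed.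
Lemma cabsV z : cabs z^-1 = (cabs z)^-1. Proof. exact: normcV. Qed.
Lemma cabsN z : cabs (- z) = cabs z.
Proof.
rewrite -mulN1r cabsM -[RHS]mul1r; congr (_ * _).
by rewrite /cabs /= oppr0 expr0n /= addr0 sqrrN expr1n sqrtr1.
Qed.
Lemma cabsD z w : cabs (z + w) <= cabs z + cabs w. Proof. exact: le_normcD. Qed.
Lemma cabsX z n : cabs (z ^+ n) = cabs z ^+ n.
Proof. by elim: n => [|n IH]; rewrite ?expr0 ?cabs1 // !exprS cabsM IH. Qed.
Lemma cabsC z w : cabs (z - w) = cabs (w - z).
Proof. by rewrite -cabsN opprB. Qed.
Lemma cabsB z w : cabs (z - w) <= cabs z + cabs w.
Proof. by rewrite -(cabsN w); exact: cabsD. Qed.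
Lemma cabs_tri y z w : cabs (z - w) <= cabs (z - y) + cabs (y - w).
Proof. by rewrite -[z - w](subrKA y) cabsD. Qed.
Lemma cabs_trile z w : cabs z <= cabs w + cabs (z - w).
Proof. by rewrite -{1}(subrK w z) addrC cabsD. Qed.
Lemma cabsR (x : R) : cabs x%:C = `|x|.
Proof. by rewrite /= expr0n /= addr0 sqrtr_sqr. Qed.
Lemma cabs_shrink (t : R) z : 0 <= t <= 1 -> cabs (t%:C * z) <= cabs z.
Proof. by move=> /andP[t0 t1]; rewrite cabsM cabsR ger0_norm// ler_piMl ?cabs_ge0. Qed.

Lemma cabs_Re z : `|Re z| <= cabs z.
Proof. 
case: z => x y /=; rewrite -sqrtr_sqr ler_wsqrtr// lerDl; exact: sqr_ge0.
Qed.
Lemma cabs_Im z : `|Im z| <= cabs z.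
Proof. 
case: z => x y /=; rewrite -sqrtr_sqr ler_wsqrtr// lerDr; exact: sqr_ge0.
Qed.
Lemma cabs_ReIm z : cabs z <= `|Re z| + `|Im z|.
Proof.
have {1}-> : z = (Re z)%:C + (Im z)%:C * 'i.
  by case: z => x y; simpc.
apply: le_trans (cabsD _ _) _; rewrite cabsM !cabsR.
by rewrite /= expr0n expr1n add0r sqrtr1 mulr1.
Qed.
Lemma cabs2 z : cabs z ^+ 2 = Re z ^+ 2 + Im z ^+2.
Proof. by case: z => x y /=; rewrite sqr_sqrtr// addr_ge0 ?sqr_ge0. Qed.
End Basics.

Section Cdiff.
Context {R : realType}.
Local Notation C := R[i].
Implicit Types (z w a b d : C) (f g : C -> C) (r M : R).

(** Differentiability without a quotient: the bound is linear in [cabs h] and covers [h = 0], so the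
    rules of calculus become plain inequalities. [derivable_cholP] links it to [derivable]. *)
Definition cdiff f z d := forall e : R, 0 < e -> exists2 dl : R, 0 < dl &
  forall h, cabs h < dl -> cabs (f (z + h) - f z - d * h) <= e * cabs h.

Definition ccont f z := forall e : R, 0 < e -> exists2 dl : R, 0 < dl &
  forall w, cabs (w - z) < dl -> cabs (f w - f z) < e.

Definition chol f z := exists d, cdiff f z d.

Definition der f z : C := xget 0 [set d | cdiff f z d].

Lemma derP f z : chol f z -> cdiff f z (der f z).
Proof. by move=> [d fd]; rewrite /der; case: xgetP => [//|/(_ d)/(_ fd)]. Qed.

Lemma cdiff_lip f z d : cdiff f z d -> exists2 dl : R, 0 < dl &
  forall h, cabs h < dl -> cabs (f (z + h) - f z) <= (cabs d + 1) * cabs h.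
Proof.
move=> /(_ 1 ltr01)[dl dl0 H]; exists dl => // h /H.
move=> h1; apply: le_trans (cabs_trile _ (d * h)) _.
by rewrite cabsM mulrDl lerD2l.
Qed.

Lemma cdiff_cont f z d : cdiff f z d -> ccont f z.
Proof.
move=> /cdiff_lip[dl dl0 H] e e0.
have d1 : 0 < cabs d + 1 by have := cabs_ge0 d; lra.
exists (Num.min dl (e / (cabs d + 1))); first by rewrite lt_min dl0 divr_gt0.
move=> w; rewrite lt_min => /andP[/H]; rewrite addBK => h1 h2.
by apply: le_lt_trans h1 _; rewrite mulrC -ltr_pdivlMr.
Qed.

Lemma chol_cont f z : chol f z -> ccont f z.
Proof. by move=> [d /cdiff_cont]. Qed.

Lemma cdiff_uniq f z d d' : cdiff f z d -> cdiff f z d' -> d = d'.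
Proof.
move=> H H'; apply/eqP; rewrite -subr_eq0; apply: contraT; rewrite -cabs_gt0 => k0.
have e0 : 0 < cabs (d - d') / 4 by lra.
have [d1 d10 H1] := H _ e0; have [d2 d20 H2] := H' _ e0.
set m := Num.min d1 d2; have m0 : 0 < m by rewrite lt_min d10.
have mE : cabs (m / 2)%:C = m / 2 by rewrite cabsR ger0_norm//; lra.
have := H1 (m / 2)%:C; have := H2 (m / 2)%:C; rewrite mE.
have md1 : m <= d1 by rewrite ge_min lexx.
have md2 : m <= d2 by rewrite ge_min lexx orbT.
move=> /(_ ltac:(lra)) A /(_ ltac:(lra)) B.
have : cabs ((d - d') * (m / 2)%:C) <= cabs (d - d') / 4 * (m / 2) + cabs (d - d') / 4 * (m / 2).
  apply: le_trans (lerD A B); rewrite addrC (cabsC (f _ - f z)).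
  apply: le_trans _ (cabsD _ _); rewrite le_eqVlt; apply/orP; left; apply/eqP.
  by rewrite -cabsN; congr cabs; ring.
rewrite cabsM mE; have : 0 < cabs (d - d') * (m / 2) by rewrite mulr_gt0//; lra.
nra.
Qed.

Lemma cdiff_cst (c : C) z : cdiff (fun=> c) z 0.
Proof.
move=> e e0; exists 1 => // h _; rewrite subrr mul0r subr0 cabs0.
by rewrite mulr_ge0 ?cabs_ge0// ltW.
Qed.

Lemma cdiff_id z : cdiff id z 1.
Proof.
move=> e e0; exists 1 => // h _ /=; rewrite mul1r addKB subrr cabs0.
by rewrite mulr_ge0 ?cabs_ge0// ltW.
Qed.

Lemma cdiffD f g z d d' : cdiff f z d -> cdiff g z d' ->
  cdiff (fun x => f x + g x) z (d + d').
Proof.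
move=> F G e e0; have e2 : 0 < e / 2 by lra.
have [d1 d10 H1] := F _ e2; have [d2 d20 H2] := G _ e2.
exists (Num.min d1 d2); first by rewrite lt_min d10.
move=> h; rewrite lt_min => /andP[/H1 A /H2 B].
have -> : f (z + h) + g (z + h) - (f z + g z) - (d + d') * h =
  (f (z + h) - f z - d * h) + (g (z + h) - g z - d' * h) by ring.
by apply: le_trans (cabsD _ _) _; lra.
Qed.

Lemma cdiffM f g z d d' : cdiff f z d -> cdiff g z d' ->
  cdiff (fun x => f x * g x) z (d * g z + f z * d').
Proof.
move=> F G e e0.
have [k0 k1 k2] : [/\ 0 < cabs (g z) + 1, 0 < cabs d + 1 & 0 < cabs (f z) + 1].
  by have := cabs_ge0 (g z); have := cabs_ge0 d; have := cabs_ge0 (f z); split; lra.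
have [e1 e2 e3] : [/\ 0 < e / 3 / (cabs (g z) + 1), 0 < e / 3 / (cabs d + 1) &
  0 < e / 3 / (cabs (f z) + 1)] by split; apply: divr_gt0 => //; lra.
have [d1 d10 H1] := F _ e1; have [d2 d20 H2] := G _ e3.
have [d3 d30 H3] := cdiff_cont G e2; have [d4 d40 H4] := cdiff_cont G ltr01.
exists (Num.min (Num.min d1 d2) (Num.min d3 d4)).
  by rewrite !lt_min d10 d20 d30.
move=> h; rewrite !lt_min => /andP[/andP[/H1 A /H2 B] /andP[h3 h4]].
have := H3 (z + h); have := H4 (z + h).
rewrite addKB.
move=> /(_ h4) D /(_ h3) E.
have gb : cabs (g (z + h)) <= cabs (g z) + 1.
  by apply: le_trans (cabs_trile _ (g z)) _; rewrite lerD2l ltW.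
have -> : f (z + h) * g (z + h) - f z * g z - (d * g z + f z * d') * h =
  (f (z + h) - f z - d * h) * g (z + h) + d * (g (z + h) - g z) * h
   + f z * (g (z + h) - g z - d' * h) by ring.
apply: le_trans (cabsD _ _) _; apply: le_trans (lerD (cabsD _ _) (lexx _)) _.
rewrite !cabsM.
have h0 := cabs_ge0 h.
have A' : cabs (f (z + h) - f z - d * h) * cabs (g (z + h)) <= e / 3 * cabs h.
  apply: le_trans (ler_pM (cabs_ge0 _) (cabs_ge0 _) A gb) _.
  by rewrite mulrAC divfK ?gt_eqF.
have B' : cabs d * cabs (g (z + h) - g z) * cabs h <= e / 3 * cabs h.
  apply: ler_wpM2r => //; rewrite -[leRHS](divfK (lt0r_neq0 k1)) mulrC.
  by apply: ler_pM; rewrite ?cabs_ge0// ?lerDl// ltW.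
have C' : cabs (f z) * cabs (g (z + h) - g z - d' * h) <= e / 3 * cabs h.
  apply: le_trans (ler_pM (cabs_ge0 _) (cabs_ge0 _) (_ : _ <= cabs (f z) + 1) B) _.
    by rewrite lerDl.
  by rewrite mulrA [X in X * _]mulrC divfK ?gt_eqF.
lra.
Qed.

Lemma cdiff_comp f g z d d' : cdiff f z d -> cdiff g (f z) d' ->
  cdiff (g \o f) z (d' * d).
Proof.
move=> F G e e0.
have k1 : 0 < cabs d + 1 by have := cabs_ge0 d; lra.
have k2 : 0 < cabs d' + 1 by have := cabs_ge0 d'; lra.
have e1 : 0 < e / 2 / (cabs d + 1) by apply: divr_gt0 => //; lra.
have e2 : 0 < e / 2 / (cabs d' + 1) by apply: divr_gt0 => //; lra.
have [d1 d10 H1] := G _ e1; have [d2 d20 H2] := F _ e2.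
have [d3 d30 H3] := cdiff_lip F; have [d4 d40 H4] := cdiff_cont F d10.
exists (Num.min d4 (Num.min d2 d3)); first by rewrite !lt_min d20 d30 d40.
move=> h; rewrite !lt_min => /andP[h4 /andP[/H2 A /H3 B]].
have := H4 (z + h); rewrite addKB.
move=> /(_ h4) /H1; rewrite addBK => E /=.
have -> : g (f (z + h)) - g (f z) - d' * d * h =
 (g (f (z + h)) - g (f z) - d' * (f (z + h) - f z)) + d' * (f (z + h) - f z - d * h) by ring.
apply: le_trans (cabsD _ _) _; rewrite cabsM.
have h0 := cabs_ge0 h.
have A' : e / 2 / (cabs d + 1) * cabs (f (z + h) - f z) <= e / 2 * cabs h.
  apply: le_trans (ler_wpM2l (ltW e1) B) _.
  by rewrite mulrA divfK ?gt_eqF.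
have C' : cabs d' * cabs (f (z + h) - f z - d * h) <= e / 2 * cabs h.
  apply: le_trans (ler_pM (cabs_ge0 _) (cabs_ge0 _) (_ : _ <= cabs d' + 1) A) _.
    by rewrite lerDl.
  by rewrite mulrA [X in X * _]mulrC divfK ?gt_eqF.
lra.
Qed.

Lemma cdiff_inv z : z != 0 -> cdiff (fun x => x^-1) z (- z ^- 2).
Proof.
move=> z0 e e0; have az : 0 < cabs z by rewrite cabs_gt0.
have k0 : 0 < 2 / cabs z ^+ 3 by rewrite divr_gt0 ?exprn_gt0.
exists (Num.min (cabs z / 2) (e / (2 / cabs z ^+ 3))).
  by rewrite lt_min; apply/andP; split; rewrite divr_gt0 ?exprn_gt0.
move=> h; rewrite lt_min (ltr_pdivlMr _ _ k0) => /andP[h1 h2].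
have zh : cabs z / 2 <= cabs (z + h).
  have := cabs_trile z (z + h); rewrite (_ : z - (z + h) = - h) ?cabsN; last by ring.
  lra.
have zh0 : z + h != 0 by rewrite -cabs_gt0; lra.
have -> : (z + h)^-1 - z^-1 - - z ^- 2 * h = h * h * (z ^- 2 * (z + h)^-1).
  by field; rewrite z0 zh0.
rewrite !cabsM !cabsV cabsX mulrAC.
apply: ler_wpM2r; first exact: cabs_ge0.
apply: le_trans _ (ltW h2); rewrite ler_wpM2l ?cabs_ge0//.
rewrite (_ : 2 / cabs z ^+ 3 = cabs z ^- 2 * (cabs z / 2)^-1); last first.
  by field; rewrite lt0r_neq0.
rewrite ler_wpM2l ?invr_ge0 ?exprn_ge0 ?cabs_ge0//.
by rewrite lef_pV2 ?posrE//; lra.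
Qed.

Lemma cdiffV f z d : f z != 0 -> cdiff f z d ->
  cdiff (fun x => (f x)^-1) z (- d / f z ^+ 2).
Proof.
move=> f0 H; rewrite mulNr mulrC -mulNr.
exact: (cdiff_comp H (cdiff_inv f0)).
Qed.

Lemma cdiff_eq f g z d : (exists2 r : R, 0 < r & forall w, cabs (w - z) < r -> f w = g w) ->
  cdiff f z d -> cdiff g z d.
Proof.
move=> [r r0 E] F e e0; have [d1 d10 H1] := F _ e0.
exists (Num.min d1 r); first by rewrite lt_min d10.
move=> h; rewrite lt_min => /andP[/H1 A B].
rewrite -!E ?subrr ?cabs0//.
by rewrite addKB.
Qed.

Lemma cholD f g z : chol f z -> chol g z -> chol (fun x => f x + g x) z.
Proof. by move=> [d F] [d' G]; exists (d + d'); exact: cdiffD. Qed.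
Lemma cholM f g z : chol f z -> chol g z -> chol (fun x => f x * g x) z.
Proof. by move=> [d F] [d' G]; eexists; exact: cdiffM F G. Qed.
Lemma chol_cst (c : C) z : chol (fun=> c) z.
Proof. by exists 0; exact: cdiff_cst. Qed.
Lemma chol_id z : chol id z.
Proof. by exists 1; exact: cdiff_id. Qed.
Lemma cholN f z : chol f z -> chol (fun x => - f x) z.
Proof.
move=> F; rewrite (_ : (fun _ => _) = (fun x => -1 * f x)).
  by apply: cholM => //; exact: chol_cst.
by apply/funext => x; rewrite mulN1r.
Qed.
Lemma cholB f g z : chol f z -> chol g z -> chol (fun x => f x - g x) z.
Proof. by move=> F G; apply: cholD => //; exact: cholN. Qed.
Lemma cholV f z : f z != 0 -> chol f z -> chol (fun x => (f x)^-1) z.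
Proof. by move=> f0 [d F]; eexists; exact: cdiffV f0 F. Qed.
Lemma chol_div f g z : g z != 0 -> chol f z -> chol g z -> chol (fun x => f x / g x) z.
Proof. by move=> f0 F G; apply: cholM => //; exact: cholV. Qed.
Lemma cholX f z n : chol f z -> chol (fun x => f x ^+ n) z.
Proof.
move=> F; elim: n => [|n IH].
  by rewrite (_ : (fun _ => _) = fun=> 1); [exact: chol_cst|apply/funext => x; rewrite expr0].
rewrite (_ : (fun _ => _) = fun x => f x * f x ^+ n); first exact: cholM.
by apply/funext => x; rewrite exprS.
Qed.
Lemma chol_comp f g z : chol f z -> chol g (f z) -> chol (g \o f) z.
Proof. by move=> [d F] [d' G]; eexists; exact: cdiff_comp F G. Qed.
End Cdiff.

(** * The maximum principle *)

Section Bisection.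
Context {R : realType}.
Implicit Types (x y s : R).

Lemma nested_intervals (u v : nat -> R) : (forall n m, u n <= v m) ->
  exists c, forall n, u n <= c <= v n.
Proof.
move=> uv; have E : range u !=set0 by exists (u 0); exists 0%N.
exists (sup (range u)) => n; apply/andP; split.
  apply: ub_le_sup; last by exists n.
  by exists (v 0) => _ [m _ <-].
by apply: ge_sup => // _ [m _ <-].
Qed.

Lemma exp2_small (x e : R) : 0 < e -> exists n, x / 2 ^+ n < e.
Proof.
move=> e0; have [n hn] : exists n : nat, Num.max 0 (x / e) < n%:R.
  by eexists; apply: archi_boundP; rewrite le_max lexx.
exists n; rewrite ltr_pdivrMr ?exprn_gt0// mulrC -ltr_pdivrMr//.
apply: le_lt_trans (_ : _ <= Num.max 0 (x / e)) _; first by rewrite le_max lexx orbT.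
apply: lt_trans hn _.
by rewrite -natrX ltr_nat ltn_expl.
Qed.

(** If [P] failed on the large square, it would fail on one quarter, then on a quarter of that, and
    so on; the nested bad squares shrink to a point [(x0, y0)], where the local hypothesis
    contradicts them. This serves both Goursat's theorem and compactness. *)
Lemma square_bisection (P : R -> R -> R -> Prop) (X Y S : R) : 0 < S ->
  (forall x y s, 0 < s -> P x y (s / 2) -> P (x + s / 2) y (s / 2) ->
     P x (y + s / 2) (s / 2) -> P (x + s / 2) (y + s / 2) (s / 2) -> P x y s) ->
  (forall x0 y0, X <= x0 <= X + S -> Y <= y0 <= Y + S ->
    exists2 dl : R, 0 < dl & forall x y s, 0 < s < dl ->
      x <= x0 <= x + s -> y <= y0 <= y + s ->
      X <= x -> x + s <= X + S -> Y <= y -> y + s <= Y + S -> P x y s) ->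
  P X Y S.
Proof.
move=> S0 Padd Ploc; apply: contrapT => nP.
pose bad (t : R * R * R) := ~ P t.1.1 t.1.2 t.2.
pose quarter (t t' : R * R * R) := t'.2 = t.2 / 2 /\
  (t'.1.1 = t.1.1 \/ t'.1.1 = t.1.1 + t.2 / 2) /\
  (t'.1.2 = t.1.2 \/ t'.1.2 = t.1.2 + t.2 / 2).
(* The premises stand under the existential so that [choice] yields a function on all triples. The
   same device recurs below. *)
have next t : exists t', 0 < t.2 -> bad t -> quarter t t' /\ bad t'.
  case: t => -[x y] s.
  have [s0|] := pselect (0 < s); last by move=> h; exists (x, y, s).
  have [bt|] := pselect (bad (x, y, s)); last by move=> h; exists (x, y, s).
  apply: contrapT => /forallNP nx; apply: bt => /=.
  apply: Padd => //; apply: contrapT => b.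
  - apply: (nx (x, y, s / 2)) => _ _; split => //.
    by rewrite /quarter /=; split => //; split; left.
  - apply: (nx (x + s / 2, y, s / 2)) => _ _; split => //.
    by rewrite /quarter /=; split => //; split; [right|left].
  - apply: (nx (x, y + s / 2, s / 2)) => _ _; split => //.
    by rewrite /quarter /=; split => //; split; [left|right].
  - apply: (nx (x + s / 2, y + s / 2, s / 2)) => _ _; split => //.
    by rewrite /quarter /=; split => //; split; right.
have [nxt nxtP] := choice next.
pose u n := iter n nxt (X, Y, S).
have u2 n : bad (u n) /\ (u n).2 = S / 2 ^+ n.
  elim: n => [|n [bn sn]]; first by split; rewrite //= expr0 divr1.
  have sp : 0 < (u n).2 by rewrite sn divr_gt0// exprn_gt0.
  have [[q1 _] b] := nxtP (u n) sp bn; split => //=.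
  by rewrite q1 -/(u n) sn exprSr invfM mulrA.
have sp n : 0 < (u n).2 by rewrite (u2 n).2 divr_gt0// exprn_gt0.
have qu n : quarter (u n) (u n.+1) by have [] := nxtP _ (sp n) (u2 n).1.
have mono n k : [/\ (u n).1.1 <= (u (n + k)%N).1.1,
   (u (n + k)%N).1.1 + (u (n + k)%N).2 <= (u n).1.1 + (u n).2,
   (u n).1.2 <= (u (n + k)%N).1.2 &
   (u (n + k)%N).1.2 + (u (n + k)%N).2 <= (u n).1.2 + (u n).2].
  elim: k => [|k [IH1 IH2 IH3 IH4]]; first by rewrite addn0.
  rewrite addnS; have [q1 [q2 q3]] := qu (n + k)%N; have sk := sp (n + k)%N.
  clear -IH1 IH2 IH3 IH4 q1 q2 q3 sk.
  by case: q2 => q2; case: q3 => q3; split; lra.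
have [x0 hx] : exists c, forall n, (u n).1.1 <= c <= (u n).1.1 + (u n).2.
  apply: (@nested_intervals (fun n => (u n).1.1) (fun n => (u n).1.1 + (u n).2)) => n m.
  have [/subnKC <-|/ltnW/subnKC <-] := leqP n m.
    by have [A B _ _] := mono n (m - n)%N; have := sp (n + (m - n))%N; lra.
  by have [A B _ _] := mono m (n - m)%N; have := sp (m + (n - m))%N; lra.
have [y0 hy] : exists c, forall n, (u n).1.2 <= c <= (u n).1.2 + (u n).2.
  apply: (@nested_intervals (fun n => (u n).1.2) (fun n => (u n).1.2 + (u n).2)) => n m.
  have [/subnKC <-|/ltnW/subnKC <-] := leqP n m.
    by have [_ _ A B] := mono n (m - n)%N; have := sp (n + (m - n))%N; lra.
  by have [_ _ A B] := mono m (n - m)%N; have := sp (m + (n - m))%N; lra.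
have [dl dl0 H] := Ploc x0 y0 (hx 0%N) (hy 0%N).
have [n hn] := exp2_small S dl0.
apply: (u2 n).1; have [m1 m2 m3 m4] := mono 0%N n; apply: H => //.
by rewrite sp (u2 n).2 hn.
Qed.

End Bisection.

Section DyadicMean.
Context {R : realType}.
Local Notation C := R[i].
Implicit Types (x s : R) (G : R -> C).

(* The mean of G over the left end points of the 2^n equal parts of
   [x, x + s]; the recursion makes it additive under halving. *)
Fixpoint dymean n x s G : C :=
  if n is m.+1 then (dymean m x (s / 2) G + dymean m (x + s / 2) (s / 2) G) / 2
  else G x.

Lemma cabs2V : cabs (2 : C) = 2.
Proof. by rewrite (_ : (2 : C) = (2 : R)%:C) ?cabsR ?ger0_norm// rmorphMn. Qed.

Lemma dymean_near n x s G (c : C) (B : R) : 0 <= s ->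
  (forall t, x <= t <= x + s -> cabs (G t - c) <= B) ->
  cabs (dymean n x s G - c) <= B.
Proof.
elim: n x s => [|n IH] x s s0 H /=; first by apply: H; lra.
have A := IH x (s / 2) ltac:(lra); have D := IH (x + s / 2) (s / 2) ltac:(lra).
set a := dymean n x _ _ in A *; set b := dymean n (x + _) _ _ in D *.
have -> : (a + b) / 2 - c = ((a - c) + (b - c)) / 2 by field.
rewrite cabsM cabsV cabs2V ler_pdivrMr// mulr_natr mulr2n.
apply: le_trans (cabsD _ _) _; apply: lerD.
  by apply: A => t ht; apply: H; lra.
by apply: D => t ht; apply: H; lra.
Qed.

Lemma dymeanB n x s G G' :
  dymean n x s (fun t => G t - G' t) = dymean n x s G - dymean n x s G'.
Proof. by elim: n x s => [//|n IH] x s /=; rewrite !IH; field. Qed.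

End DyadicMean.

(** * Goursat's theorem for discretised contours *)

Section Goursat.
Context {R : realType}.
Local Notation C := R[i].
Implicit Types (x y s : R) (g : C -> C).

Section Square.
Variables (al be : C) (g : C -> C).
Let F x y := g (al * x%:C + be * y%:C).

(* Discretised contour integral of g along the image of the boundary of the
   square [x, x + s] x [y, y + s]. *)
Definition contour n x y s : C :=
  al * s%:C * dymean n x s (fun t => F t y - F t (y + s)) +
  be * s%:C * dymean n y s (fun t => F (x + s) t - F x t).

(** The inner sides of the four quarters are traversed twice in opposite directions and cancel. The
    dyadic form of the mean makes this exact at every finite level. *)
Lemma contourS n x y s : contour n.+1 x y s =
  contour n x y (s / 2) + contour n (x + s / 2) y (s / 2) +
  contour n x (y + s / 2) (s / 2) + contour n (x + s / 2) (y + s / 2) (s / 2).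
Proof.
rewrite /contour /= !dymeanB.
have -> : x + s / 2 + s / 2 = x + s by field.
have -> : y + s / 2 + s / 2 = y + s by field.
have -> : (s / 2)%:C = s%:C / 2 :> C.
  by rewrite rmorphM fmorphV rmorphMn.
by field.
Qed.

(** The affine part of [g] contributes [- D * be * s] to one mean and [D * al * s] to the other;
    weighted by [al * s] and [be * s] these cancel. What remains is the error of the affine
    approximation, bounded independently of the level [n]. *)
Lemma contour_small x0 y0 e : chol g (al * x0%:C + be * y0%:C) -> 0 < e ->
  exists2 dl : R, 0 < dl & forall n x y s, 0 < s < dl ->
      x <= x0 <= x + s -> y <= y0 <= y + s -> cabs (contour n x y s) <= e * s ^+ 2.
Proof.
move=> [D gD] e0; pose k := cabs al + cabs be + 1.
have k0 : 0 < k by rewrite /k; have := cabs_ge0 al; have := cabs_ge0 be; lra.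
have e1 : 0 < e / (2 * k ^+ 2) by rewrite divr_gt0// mulr_gt0// exprn_gt0.
have [d1 d10 H1] := gD _ e1.
exists (d1 / k) => [|n x y s /andP[s0 sd] hx hy]; first by rewrite divr_gt0.
set p := al * x0%:C + be * y0%:C in H1.
have Fe u v : x <= u <= x + s -> y <= v <= y + s ->
    cabs (F u v - g p - D * (al * (u - x0)%:C + be * (v - y0)%:C)) <=
      e / (2 * k ^+ 2) * (k * s).
  move=> hu hv; set h := al * (u - x0)%:C + be * (v - y0)%:C.
  have hs : cabs h <= k * s.
    apply: le_trans (cabsD _ _) _; rewrite !cabsM !cabsR.
    have A : `|u - x0| <= s by rewrite ler_norml; lra.
    have B : `|v - y0| <= s by rewrite ler_norml; lra.
    have := ler_wpM2l (cabs_ge0 al) A; have := ler_wpM2l (cabs_ge0 be) B.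
    by rewrite /k; lra.
  have hd : cabs h < d1.
    by apply: le_lt_trans hs _; rewrite mulrC -ltr_pdivlMr.
  have := H1 _ hd; have -> : p + h = al * u%:C + be * v%:C.
    by rewrite /p /h !rmorphB /=; ring.
  by move=> A; apply: le_trans A _; rewrite ler_wpM2l// ltW.
have T1 : cabs (dymean n x s (fun t => F t y - F t (y + s)) - (- D * be * s%:C))
    <= e / (2 * k ^+ 2) * (k * s) + e / (2 * k ^+ 2) * (k * s).
  apply: dymean_near => [|t ht]; first lra.
  have A := Fe t y ht ltac:(lra); have B := Fe t (y + s) ht ltac:(lra).
  apply: le_trans (lerD A B); apply: le_trans (cabsB _ _).
  rewrite le_eqVlt; apply/orP; left; apply/eqP; congr cabs.
  by rewrite !rmorphB rmorphD /=; ring.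
have T2 : cabs (dymean n y s (fun t => F (x + s) t - F x t) - D * al * s%:C)
    <= e / (2 * k ^+ 2) * (k * s) + e / (2 * k ^+ 2) * (k * s).
  apply: dymean_near => [|t ht]; first lra.
  have A := Fe (x + s) t ltac:(lra) ht; have B := Fe x t ltac:(lra) ht.
  apply: le_trans (lerD A B); apply: le_trans (cabsB _ _).
  rewrite le_eqVlt; apply/orP; left; apply/eqP; congr cabs.
  by rewrite !rmorphB rmorphD /=; ring.
rewrite /contour; set m1 := dymean _ _ _ _ in T1 *; set m2 := dymean _ _ _ _ in T2 *.
have -> : al * s%:C * m1 + be * s%:C * m2 =
   al * s%:C * (m1 - (- D * be * s%:C)) + be * s%:C * (m2 - D * al * s%:C) by ring.
apply: le_trans (cabsD _ _) _; rewrite !cabsM !cabsR ger0_norm; last lra.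
have E : e / (2 * k ^+ 2) * (k * s) + e / (2 * k ^+ 2) * (k * s) = e * s / k.
  by field; rewrite lt0r_neq0.
rewrite E in T1 T2.
have ak : cabs al * s + cabs be * s <= k * s by rewrite /k; lra.
have A := ler_wpM2l (mulr_ge0 (cabs_ge0 al) (ltW s0)) T1.
have B := ler_wpM2l (mulr_ge0 (cabs_ge0 be) (ltW s0)) T2.
apply: le_trans (lerD A B) _; rewrite -mulrDl.
apply: le_trans (ler_wpM2r _ ak) _; first by rewrite divr_ge0 ?mulr_ge0// ltW.
by rewrite le_eqVlt; apply/orP; left; apply/eqP; field; rewrite lt0r_neq0.
Qed.

(** A halving consumes one level of [contour], so the property submitted to the bisection is that
    the bound holds from some level on. *)
Lemma goursat X Y S e : 0 < S -> 0 < e ->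
  (forall x y, X <= x <= X + S -> Y <= y <= Y + S -> chol g (al * x%:C + be * y%:C)) ->
  exists N, forall n, (N <= n)%N -> cabs (contour n X Y S) <= e * S ^+ 2.
Proof.
move=> S0 e0 Hg.
apply: (@square_bisection R (fun x y s => exists N, forall n, (N <= n)%N ->
   cabs (contour n x y s) <= e * s ^+ 2)) => //.
- move=> x y s s0 [N1 H1] [N2 H2] [N3 H3] [N4 H4].
  exists (maxn (maxn N1 N2) (maxn N3 N4)).+1 => -[//|n].
  rewrite ltnS !geq_max => /andP[/andP[/H1 A1 /H2 A2] /andP[/H3 A3 /H4 A4]].
  rewrite contourS; apply: le_trans (cabsD _ _) _.
  apply: le_trans (lerD (cabsD _ _) (lexx _)) _.
  apply: le_trans (lerD (lerD (cabsD _ _) (lexx _)) (lexx _)) _.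
  have -> : e * s ^+ 2 = e * (s / 2) ^+ 2 + e * (s / 2) ^+ 2 + e * (s / 2) ^+ 2
     + e * (s / 2) ^+ 2 by field.
  lra.
- move=> x0 y0 hx hy; have [dl dl0 H] := contour_small (Hg _ _ hx hy) e0.
  by exists dl => // x y s hs h1 h2 _ _ _ _; exists 0%N => n _; exact: H.
Qed.

End Square.

End Goursat.

(** * The complex exponential and the value at the centre of a disc *)

Section ComplexExp.
Context {R : realType}.
Local Notation C := R[i].
Implicit Types (x y s : R).

Definition cexp (z : C) : C := (expR (Re z))%:C * (cos (Im z) +i* sin (Im z)).

Lemma cexpD z w : cexp (z + w) = cexp z * cexp w.
Proof.
case: z => a b; case: w => c d; rewrite /cexp /= expRD cosD sinD.
rewrite rmorphM /= -!mulrA; congr (_ * _); rewrite [RHS]mulrCA; congr (_ * _).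
by apply/eqP; rewrite eq_complex /=; apply/andP; split; apply/eqP; ring.
Qed.

Lemma cexp0 : cexp 0 = 1.
Proof. by rewrite /cexp /= expR0 cos0 sin0; simpc. Qed.

Lemma cabs_cexp z : cabs (cexp z) = expR (Re z).
Proof.
by rewrite /cexp cabsM cabsR /= cos2Dsin2 sqrtr1 mulr1 ger0_norm ?expR_ge0.
Qed.

Lemma cexp_2pi : cexp (0 +i* (pi *+ 2)) = 1.
Proof. by rewrite /cexp /= expR0 cos2pi sin2pi; simpc. Qed.

Lemma is_derive_eps (f : R -> R) x d : is_derive x 1 f d ->
  forall e, 0 < e -> exists2 dl : R, 0 < dl &
   forall h, `|h| < dl -> `|f (x + h) - f x - d * h| <= e * `|h|.
Proof.
move=> [dr <-] e e0; have /cvgrPdist_le/(_ e e0) := dr.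
rewrite -/(derive f x 1) => /nbhs_ballP[dl /= dl0 H]; exists dl => // h hd.
have [->|h0] := eqVneq h 0; first by rewrite addr0 subrr mulr0 subr0 normr0 mulr0.
have := H h; rewrite /ball /= sub0r normrN => /(_ hd h0).
rewrite /GRing.scale /= mulr1 (addrC h x) => A.
have -> : f (x + h) - f x - 'D_1 f x * h = - h * ('D_1 f x - h^-1 * (f (x + h) - f x)).
  by field.
by rewrite normrM normrN mulrC ler_wpM2r.
Qed.

Lemma cdiff_cexp0 : cdiff cexp 0 1.
Proof.
move=> e e0.
have [d [d0 d1 de]] : exists d : R, [/\ 0 < d, d <= 1 & d <= e / 8].
  exists (Num.min 1 (e / 8)).
  by rewrite lt_min ltr01 divr_gt0// !ge_min !lexx orbT.
have [a a0 A] := is_derive_eps (is_derive_expR (0 : R)) d0.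
have [b b0 B] := is_derive_eps (is_derive_cos (0 : R)) d0.
have [c c0 D] := is_derive_eps (is_derive_sin (0 : R)) d0.
exists (Num.min (Num.min a b) (Num.min c d)); first by rewrite !lt_min a0 b0 c0 d0.
case=> u v; rewrite !lt_min => /andP[/andP[ha hb] /andP[hc hd]].
have := cabs_Re (u +i* v); have := cabs_Im (u +i* v).
set n := cabs _ in ha hb hc hd *; rewrite [Re _]/= [Im _]/= => hv hu.
have {}A := A u (le_lt_trans hu ha); have {}B := B v (le_lt_trans hv hb).
have {}D := D v (le_lt_trans hv hc).
rewrite !add0r cexp0 !mul1r.
rewrite add0r expR0 mul1r in A; rewrite add0r cos0 sin0 oppr0 mul0r subr0 in B.
rewrite add0r sin0 cos0 subr0 mul1r in D.
have -> : cexp (u +i* v) - 1 - u +i* v =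
  (expR u - 1 - u)%:C * (cos v +i* sin v) +
  (1 + u)%:C * ((cos v - 1) +i* (sin v - v)) + (0 +i* (u * v)).
  rewrite /cexp /=; simpc; apply/eqP; rewrite eq_complex /=.
  by apply/andP; split; apply/eqP; ring.
apply: le_trans (cabsD _ _) _; apply: le_trans (lerD (cabsD _ _) (lexx _)) _.
rewrite !cabsM !cabsR.
have n0 : 0 <= n := le_trans (normr_ge0 _) hu.
have T1 : cabs (cos v +i* sin v) = 1 by rewrite /= cos2Dsin2 sqrtr1.
have T2 : cabs ((cos v - 1) +i* (sin v - v)) <= d * n + d * n.
  apply: le_trans (cabs_ReIm _) _; rewrite /=; apply: lerD.
    by apply: le_trans B _; rewrite ler_pM2l.
  by apply: le_trans D _; rewrite ler_pM2l.
have T3 : cabs (0 +i* (u * v) : C) <= d * n.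
  apply: le_trans (cabs_ReIm _) _; rewrite /= normr0 add0r normrM.
  by apply: ler_pM => //; apply: le_trans hu (ltW hd).
have T4 : `|1 + u| <= 2.
  apply: le_trans (ler_normD _ _) _; rewrite normr1; lra.
have T5 : `|1 + u| * cabs ((cos v - 1) +i* (sin v - v)) <= 2 * (d * n + d * n).
  by apply: ler_pM => //; exact: cabs_ge0.
have T6 : d * `|u| <= d * n by rewrite ler_pM2l.
have T7 : d * n <= e / 8 * n by rewrite ler_wpM2r.
have T8 : 0 <= e * n by rewrite mulr_ge0// ltW.
rewrite T1 mulr1; lra.
Qed.

Lemma cdiff_cexp z : cdiff cexp z (cexp z).
Proof.
move=> e e0; have k0 : 0 < cabs (cexp z) by rewrite cabs_cexp expR_gt0.
have e1 : 0 < e / cabs (cexp z) by rewrite divr_gt0.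
have [d d0 H] := cdiff_cexp0 e1; exists d => // h /H.
rewrite add0r cexp0 mul1r cexpD => A.
have -> : cexp z * cexp h - cexp z - cexp z * h = cexp z * (cexp h - 1 - h) by ring.
rewrite cabsM; apply: le_trans (ler_wpM2l (ltW k0) A) _.
by rewrite mulrA [_ * (e / _)]mulrC divfK// lt0r_neq0.
Qed.

(* Goursat for f (c + r exp zeta) on the rectangle [ -L, 0] x [0, 2 pi]: the
   two sides parallel to the real axis cancel by periodicity, so the means of f
   over |z - c| = r and |z - c| = r exp(-L) agree. *)
Lemma cabs_center_le (f : C -> C) (c : C) (r M : R) : 0 < r ->
  (forall z, cabs (z - c) <= r -> chol f z) ->
  (forall z, cabs (z - c) = r -> cabs (f z) <= M) -> cabs (f c) <= M.
Proof.
move=> r0 fh fM; apply/ler_addgt0Pr => e e0.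
have e2 : 0 < e / 2 by lra.
have [d d0 Hd] := (chol_cont (fh c ltac:(by rewrite subrr cabs0 ltW))) _ e2.
(* The inner circle must lie where [f] is within [e / 2] of [f c]. The witness works because
   [exp L >= 1 + L > r / d]. *)
have [L [L0 hL]] : exists L : R, 0 < L /\ r * expR (- L) < d.
  exists (r / d); split; first by rewrite divr_gt0.
  rewrite expRN ltr_pdivrMr ?expR_gt0// mulrC -ltr_pdivrMr//.
  by apply: lt_le_trans (expR_ge1Dx _); rewrite ltrDr.
(* These sides map the unit square to the rectangle; [x = 0] corresponds to the outer circle and
   [x = 1] to the inner one. *)
pose al : C := (- L)%:C; pose be : C := 0 +i* (pi *+ 2).
pose g z := f (c + r%:C * cexp z).
have abE x y : al * x%:C + be * y%:C = (- L * x) +i* (pi *+ 2 * y).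
  by apply/eqP; rewrite eq_complex /=; apply/andP; split; apply/eqP; ring.
have dist x y : cabs (c + r%:C * cexp (al * x%:C + be * y%:C) - c) = r * expR (- L * x).
  by rewrite addKB cabsM cabsR gtr0_norm// cabs_cexp abE.
have gh x y : 0 <= x <= 0 + 1 -> 0 <= y <= 0 + 1 -> chol g (al * x%:C + be * y%:C).
  move=> hx _; apply: (@chol_comp _ (fun z => c + r%:C * cexp z) f).
    apply: cholD; first exact: chol_cst.
    apply: cholM; first exact: chol_cst.
    by eexists; exact: cdiff_cexp.
  apply: fh; rewrite dist ger_pMr// -(expR0) ler_expR mulNr oppr_le0 mulr_ge0//; lra.
have p2 : 0 < (pi : R) *+ 2 by rewrite mulrn_wgt0// pi_gt0.
have e3 : 0 < pi *+ 2 * (e / 2) by rewrite mulr_gt0.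
have [N HN] := goursat ltr01 e3 gh.
have := HN N (leqnn N); rewrite /contour expr1n !mulr1 !add0r.
set m1 := dymean _ _ _ _; have -> : m1 = 0.
  apply/eqP; rewrite -[_ == _]negbK -cabs_gt0 -leNgt -(subr0 m1); apply: dymean_near => // t _.
  rewrite subr0 /g (_ : al * t%:C + be * 1%:C = al * t%:C + be * 0%:C + be).
    by rewrite (cexpD _ be) [cexp be]cexp_2pi mulr1 subrr cabs0.
  by rewrite rmorph0 rmorph1 mulr0 addr0 mulr1.
rewrite mulr0 add0r cabsM dymeanB.
set m2 := dymean _ _ _ _; set m3 := dymean _ _ _ _.
have -> : cabs be = pi *+ 2.
  by rewrite /be /= expr0n add0r sqrtr_sqr gtr0_norm.
rewrite ler_pM2l// => A.
have B : cabs (m3 - 0) <= M.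
  apply: dymean_near => // t _; rewrite subr0; apply: fM.
  by have := dist 0 t; rewrite (mulr0 (- L)) expR0 mulr1 (mulr0 al).
have D : cabs (m2 - f c) <= e / 2.
  apply: dymean_near => // t _; apply/ltW/Hd.
  by have := dist 1 t; rewrite (mulr1 (- L)) => ->.
rewrite subr0 in B.
have -> : f c = (f c - m2) + (m2 - m3) + m3 by ring.
apply: le_trans (cabsD _ _) _; apply: le_trans (lerD (cabsD _ _) (lexx _)) _.
rewrite (cabsC (f c)); lra.
Qed.

End ComplexExp.

(** * The Schwarz lemma *)

Section Moebius.
Context {R : realType}.
Local Notation C := R[i].
Implicit Types (z w a b d : C) (f g : C -> C) (r M : R).

(** For [|b| < 1], the automorphism of the disc that exchanges [0] and [b]. With this sign it is an
    involution, so it serves as its own inverse. *)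
Definition mob b w : C := (b - w) / (1 - conjc b * w).

Lemma mob_id b w : cabs (1 - conjc b * w) ^+ 2 - cabs (b - w) ^+ 2 =
  (1 - cabs b ^+ 2) * (1 - cabs w ^+ 2).
Proof. by rewrite !cabs2; case: b => b1 b2; case: w => w1 w2 /=; ring. Qed.

Lemma cabsJ z : cabs (conjc z) = cabs z.
Proof. by case: z => x y /=; rewrite sqrrN. Qed.

Lemma mob_den b w : cabs b * cabs w < 1 -> 1 - conjc b * w != 0.
Proof.
move=> bw; rewrite -cabs_gt0.
have := cabs_trile 1 (conjc b * w); rewrite cabs1 cabsM cabsJ; lra.
Qed.

Lemma mob_den1 b w : cabs b < 1 -> cabs w <= 1 -> 1 - conjc b * w != 0.
Proof.
move=> b1 w1; apply: mob_den; apply: le_lt_trans b1.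
by rewrite ler_piMr// cabs_ge0.
Qed.

Lemma cabs_mob_le b w : cabs b < 1 -> cabs w <= 1 -> cabs (mob b w) <= 1.
Proof.
move=> b1 w1; have := mob_den1 b1 w1; rewrite -cabs_gt0 => k0.
rewrite /mob cabsM cabsV ler_pdivrMr// mul1r -(@ler_pXn2r _ 2)// ?nnegrE ?cabs_ge0//.
rewrite -subr_ge0 mob_id mulr_ge0// subr_ge0 expr_le1// ?cabs_ge0//; lra.
Qed.

Lemma cabs_mob_lt b w : cabs b < 1 -> cabs w < 1 -> cabs (mob b w) < 1.
Proof.
move=> b1 w1; have := mob_den1 b1 (ltW w1); rewrite -cabs_gt0 => k0.
rewrite /mob cabsM cabsV ltr_pdivrMr// mul1r -(@ltr_pXn2r _ 2)// ?nnegrE ?cabs_ge0//.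
by rewrite -subr_gt0 mob_id mulr_gt0// subr_gt0 expr_lt1// cabs_ge0.
Qed.

Lemma mob_b0 b : mob b 0 = b.
Proof. by rewrite /mob mulr0 !subr0 divr1. Qed.

Lemma mob_bb b : mob b b = 0.
Proof. by rewrite /mob subrr mul0r. Qed.

Lemma mobK b w : cabs b < 1 -> cabs w <= 1 -> mob b (mob b w) = w.
Proof.
move=> b1 w1; have k0 := mob_den1 b1 w1.
have k1 : 1 - conjc b * b != 0 by rewrite mob_den1// ltW.
rewrite /mob; apply/eqP; rewrite eq_sym -subr_eq0; apply/eqP.
field; rewrite k0 /= (_ : _ + _ = 1 - conjc b * b)//; ring.
Qed.

Lemma cdiff_affine (c k : C) z : cdiff (fun z => c + k * z) z k.
Proof.
move=> e e0; exists 1 => // h _.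
rewrite (_ : _ - k * h = 0); last by ring.
by rewrite cabs0 mulr_ge0 ?cabs_ge0// ltW.
Qed.

Lemma chol_affine (c k : C) z : chol (fun z => c + k * z) z.
Proof. by exists k; exact: cdiff_affine. Qed.

Lemma cdiff_mob b w : 1 - conjc b * w != 0 ->
  cdiff (mob b) w ((conjc b * b - 1) / (1 - conjc b * w) ^+ 2).
Proof.
move=> k0.
have D1 : cdiff (fun w => b - w) w (- 1).
  by apply: cdiff_eq (cdiff_affine b (-1) w); exists 1 => // x _; ring.
have D2 : cdiff (fun w => 1 - conjc b * w) w (- conjc b).
  by apply: cdiff_eq (cdiff_affine 1 (- conjc b) w); exists 1 => // x _; ring.
rewrite (_ : (_ - 1) / _ = -1 * (1 - conjc b * w)^-1 +
  (b - w) * (- - conjc b / (1 - conjc b * w) ^+ 2)); last by field.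
by apply: cdiff_eq (cdiffM D1 (@cdiffV _ (fun w => 1 - conjc b * w) w _ k0 D2)); exists 1.
Qed.

Lemma chol_mob b w : 1 - conjc b * w != 0 -> chol (mob b) w.
Proof. by move=> k; eexists; exact: cdiff_mob. Qed.

End Moebius.

(** * Maximum principle with an exceptional point, Schwarz and Schwarz-Pick *)

Section MaxPrinciple.
Context {R : realType}.
Local Notation C := R[i].
Implicit Types (z w a b c d : C) (f g : C -> C) (r M : R).

(** Precomposing with [mob a], which preserves the unit circle and sends 0 to [a], carries the bound
    at the centre to every point; no attained maximum and no connectedness argument is involved. *)
Lemma max_unit f M :
  (forall z, cabs z <= 1 -> chol f z) ->
  (forall z, cabs z = 1 -> cabs (f z) <= M) ->
  forall a, cabs a <= 1 -> cabs (f a) <= M.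
Proof.
move=> fh fM a; rewrite le_eqVlt => /orP[/eqP/fM //|a1].
rewrite -(mob_b0 a); apply: (@cabs_center_le _ (f \o mob a) 0 1) => // z; rewrite subr0 => z1.
  apply: chol_comp; last by apply: fh; exact: cabs_mob_le.
  by apply: chol_mob; exact: mob_den1.
apply: fM; have := mob_id a z; rewrite z1 expr1n subrr mulr0 => /eqP.
rewrite subr_eq0 eqrXn2 ?cabs_ge0// => /eqP h.
have := mob_den1 a1 (_ : cabs z <= 1); rewrite z1 lexx -cabs_gt0 => /(_ isT) k0.
by rewrite /mob cabsM cabsV -h divff// lt0r_neq0.
Qed.

(** Otherwise [x / M > 1], and by Bernoulli's inequality its powers exceed [K / k]. This is how
    constant factors are shed from estimates that hold for all powers of a function. *)
Lemma le_of_powers (k K x M : R) : 0 < k -> 0 <= x -> 0 <= M ->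
  (forall n, k * x ^+ n <= K * M ^+ n) -> x <= M.
Proof.
move=> k0 x0 M0 H; rewrite leNgt; apply/negP => Mx.
have x1 : 0 < x by lra.
have K0 : 0 < K by have := H 0%N; rewrite !expr0 !mulr1; lra.
have M1 : 0 < M.
  rewrite lt_def M0 andbT; apply: contraPneq (H 1%N) => ->.
  by rewrite !expr1 mulr0 leNgt mulr_gt0.
pose t := x / M - 1.
have t0 : 0 < t by rewrite subr_gt0 ltr_pdivlMr// mul1r.
have B n : 1 + n%:R * t <= (x / M) ^+ n.
  elim: n => [|n IH]; first by rewrite mul0r addr0 expr0.
  have xM : 0 <= x / M by rewrite divr_ge0.
  rewrite exprS; apply: le_trans (ler_wpM2l xM IH).
  have -> : x / M = 1 + t by rewrite /t; ring.
  have : 0 <= t * (n%:R * t) by rewrite !mulr_ge0// ltW.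
  by rewrite -natr1; lra.
have A n : k * (1 + n%:R * t) <= K.
  apply: le_trans (ler_wpM2l (ltW k0) (B n)) _.
  by rewrite expr_div_n mulrA ler_pdivrMr ?exprn_gt0.
have := archi_boundP (_ : 0 <= K / (k * t)); rewrite divr_ge0 ?mulr_ge0 ?ltW//.
move=> /(_ isT); rewrite ltr_pdivrMr ?mulr_gt0// => h.
by have := A (Num.bound (K / (k * t))); lra.
Qed.

(* Applying the maximum principle to (z - c)^2 g^n removes the singularity. *)
Lemma max_unit_except g c M :
  (forall z, cabs z <= 1 -> z != c -> chol g z) ->
  (exists2 dl : R, 0 < dl & exists B, forall z, z != c -> cabs (z - c) < dl -> cabs (g z) <= B) ->
  (forall z, cabs z = 1 -> cabs (g z) <= M) ->
  cabs c < 1 ->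
  forall a, cabs a <= 1 -> a != c -> cabs (g a) <= M.
Proof.
move=> gh [dl dl0 [B gB]] gM c1 a a1 ac.
have M0 : 0 <= M by apply: le_trans (gM 1 _); rewrite ?cabs_ge0 ?cabs1.
have k0 : 0 < cabs (a - c) ^+ 2 by rewrite exprn_gt0// cabs_gt0 subr_eq0.
(* The 4 bounds [|z - c| ^ 2] on the unit circle. *)
apply: (@le_of_powers (cabs (a - c) ^+ 2) 4) => // [|n]; first exact: cabs_ge0.
rewrite -!cabsX -cabsM; pose F z := (z - c) ^+ 2 * g z ^+ n.
apply: (@max_unit F) => // z z1; last first.
  rewrite /F cabsM !cabsX; apply: ler_pM; rewrite ?exprn_ge0 ?cabs_ge0//.
    rewrite (_ : 4 = 2 ^+ 2); last by rewrite -natrX.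
    rewrite lerXn2r ?nnegrE ?cabs_ge0//; have := cabsB z c; lra.
  by apply: lerXn2r; rewrite ?nnegrE ?cabs_ge0//; exact: gM.
have [->|zc] := eqVneq z c; last first.
  apply: cholM; last by apply: cholX; exact: gh.
  by apply: cholX; apply: cholB (chol_id _) (chol_cst _ _).
(* Near [c] the function [F] is at most [|B| ^ n] times the square of the distance to [c], so its
   derivative there is 0 whatever the value of [g c]. *)
exists 0 => e e0; pose B1 := `|B| ^+ n + 1.
have B10 : 0 < B1 by rewrite ltr_wpDl ?exprn_ge0.
exists (Num.min dl (e / B1)); first by rewrite lt_min dl0 divr_gt0.
move=> h; rewrite lt_min ltr_pdivlMr// => /andP[hd he].
rewrite {2}/F subrr expr0n mul0r subr0 mul0r subr0 /F addKB.
have [->|h0] := eqVneq h 0; first by rewrite expr0n mul0r cabs0 mulr0.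
rewrite cabsM !cabsX expr2 -mulrA mulrC; apply: ler_wpM2r; first exact: cabs_ge0.
apply: le_trans (ltW he); apply: ler_wpM2l; first exact: cabs_ge0.
rewrite /B1 ler_wpDr//; apply: lerXn2r; rewrite ?nnegrE ?cabs_ge0//.
apply: le_trans (ler_norm _); apply: gB; rewrite ?addKB//.
by rewrite -subr_eq0 addKB.
Qed.

Lemma max_disc_except g c x (r M : R) : 0 < r ->
  (forall z, cabs (z - x) <= r -> z != c -> chol g z) ->
  (exists2 dl : R, 0 < dl & exists B, forall z, z != c -> cabs (z - c) < dl -> cabs (g z) <= B) ->
  (forall z, cabs (z - x) = r -> cabs (g z) <= M) ->
  cabs (c - x) < r ->
  forall a, cabs (a - x) <= r -> a != c -> cabs (g a) <= M.
Proof.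
move=> r0 gh [dl dl0 [B gB]] gM cr a ar ac.
have rC : r%:C != 0 :> C by rewrite -cabs_gt0 cabsR gtr0_norm.
have rn : cabs (r%:C : C) = r by rewrite cabsR gtr0_norm.
pose T z := x + r%:C * z.
have TK z : T ((z - x) / r%:C) = z by rewrite /T; field.
have Tn z : cabs (T z - x) = r * cabs z by rewrite /T addKB cabsM rn.
have Ti z w : T z - T w = r%:C * (z - w) by rewrite /T; ring.
have Tneq z : z != (c - x) / r%:C -> T z != c.
  by move=> zc; rewrite -(TK c) -subr_eq0 Ti mulf_neq0// subr_eq0.
rewrite -(TK a).
apply: (@max_unit_except (g \o T) ((c - x) / r%:C)) => [z z1 zc| |z z1| | |] /=.
- apply: chol_comp; first exact: chol_affine.
  by apply: gh; rewrite ?Tneq// Tn ger_pMr.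
- exists (dl / r); first by rewrite divr_gt0.
  exists B => z zc zd; apply: gB; first exact: Tneq.
  by rewrite -(TK c) Ti cabsM rn mulrC -ltr_pdivlMr.
- by apply: gM; rewrite Tn z1 mulr1.
- by rewrite cabsM cabsV rn ltr_pdivrMr// mul1r.
- by rewrite cabsM cabsV rn ler_pdivrMr// mul1r.
- by apply: contra ac => /eqP h; rewrite -(TK a) h TK.
Qed.

(** Allows a function given on an open disc to be treated on smaller closed discs, with [t] tending
    to 1 at the end. *)
Lemma le_of_scale (x y : R) (t0 : R) : t0 < 1 -> (forall t, t0 < t < 1 -> t * x <= y) -> x <= y.
Proof.
move=> t01 H; rewrite leNgt; apply/negP => yx.
have [x0|x0] := leP x 0.
  by have := H ((1 + t0) / 2) ltac:(lra); nra.
pose s := Num.max ((1 + t0) / 2) ((1 + y / x) / 2).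
have yx1 : y / x < 1 by rewrite ltr_pdivrMr// mul1r.
have s1 : s < 1 by rewrite gt_max; apply/andP; split; lra.
have s0 : (1 + t0) / 2 <= s by rewrite le_max lexx.
have s2 : (1 + y / x) / 2 <= s by rewrite le_max lexx orbT.
have := H s ltac:(lra); rewrite -ler_pdivlMr//; lra.
Qed.

(** The maximum principle is applied to [f (t * w) / w] with [t < 1], which stays bounded near 0.
    The origin is excepted because [f] will be built from quotients whose formal value at 0 comes
    from a division by zero. *)
Lemma schwarz_except f (M B : R) :
  (forall z, cabs z < 1 -> z != 0 -> chol f z /\ cabs (f z) <= M) ->
  (exists2 dl : R, 0 < dl & forall z, z != 0 -> cabs z < dl -> cabs (f z) <= B * cabs z) ->
  forall z, cabs z < 1 -> z != 0 -> cabs (f z) <= M * cabs z.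
Proof.
move=> fh [dl dl0 fB] z z1 z0.
have M0 : 0 <= M by apply: le_trans (fh z z1 z0).2; exact: cabs_ge0.
apply: (@le_of_scale _ _ (cabs z)) => // t /andP[zt t1].
have t0 : 0 < t by apply: le_lt_trans zt; exact: cabs_ge0.
have tC : t%:C != 0 :> C by rewrite -cabs_gt0 cabsR gtr0_norm.
have tn : cabs (t%:C : C) = t by rewrite cabsR gtr0_norm.
pose g w := f (t%:C * w) / w.
have gz : cabs (g (z / t%:C)) <= M.
  apply: (@max_unit_except g 0) => [w w1 w0| |w w1| | |].
  - apply: chol_div => //; last exact: chol_id.
    apply: (@chol_comp _ (fun w => t%:C * w)).
      by apply: cholM (chol_cst _ _) (chol_id _).
    apply: (fh _ _ _).1; last by rewrite mulf_neq0.
    by rewrite cabsM tn; apply: le_lt_trans t1; rewrite ger_pMr.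
  - exists (dl / t); first by rewrite divr_gt0.
    exists (B * t) => w w0; rewrite subr0 => wd.
    rewrite /g cabsM cabsV ler_pdivrMr ?cabs_gt0// -mulrA -[X in B * (X * _)]tn -cabsM.
    apply: fB; first by rewrite mulf_neq0.
    by rewrite cabsM tn mulrC -ltr_pdivlMr.
  - rewrite /g cabsM cabsV w1 invr1 mulr1; apply: (fh _ _ _).2.
      by rewrite cabsM tn w1 mulr1.
    by rewrite mulf_neq0// -cabs_gt0 w1.
  - by rewrite cabs0.
  - by rewrite cabsM cabsV tn ler_pdivrMr// mul1r ltW.
  - by rewrite mulf_neq0// invr_eq0.
move: gz; rewrite /g (_ : t%:C * (z / t%:C) = z); last by field.
rewrite cabsM invf_div cabsM cabsV tn mulrA ler_pdivrMr ?cabs_gt0//; lra.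
Qed.

Lemma schwarz f (M : R) :
  (forall z, cabs z < 1 -> chol f z /\ cabs (f z) <= M) -> f 0 = 0 ->
  forall z, cabs z < 1 -> cabs (f z) <= M * cabs z.
Proof.
move=> fh f0 z z1; have [->|z0] := eqVneq z 0; first by rewrite f0 cabs0 mulr0.
have [d /cdiff_lip[dl dl0 H]] : chol f 0 by apply: (fh 0 _).1; rewrite cabs0.
apply: (@schwarz_except f M (cabs d + 1)) => // [w w1 _|]; first exact: fh.
by exists dl => // w _ /H; rewrite add0r f0 subr0.
Qed.

Lemma schwarz_disc f c (r M : R) : 0 < r ->
  (forall z, cabs (z - c) < r -> chol f z /\ cabs (f z - f c) <= M) ->
  forall z, cabs (z - c) < r -> cabs (f z - f c) <= M * (cabs (z - c) / r).
Proof.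
move=> r0 fh z zr.
have rC : r%:C != 0 :> C by rewrite -cabs_gt0 cabsR gtr0_norm.
have rn : cabs (r%:C : C) = r by rewrite cabsR gtr0_norm.
pose g w := f (c + r%:C * w) - f c.
have := @schwarz g M _ _ ((z - c) / r%:C); rewrite /g mulr0 addr0 subrr.
rewrite (_ : c + r%:C * ((z - c) / r%:C) = z); last by field.
rewrite cabsM cabsV rn; apply => //; last by rewrite ltr_pdivrMr// mul1r.
move=> w w1; have wr : cabs (c + r%:C * w - c) < r.
  by rewrite addKB cabsM rn gtr_pMr.
split; last exact: (fh _ wr).2.
apply: cholB; last exact: chol_cst.
apply: chol_comp; last exact: (fh _ wr).1.
exact: chol_affine.
Qed.

(** Cauchy's estimate for the first derivative, read off from [schwarz_disc] at a small real
    increment. *)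
Lemma cdiff_bound f c d (r M : R) : 0 < r ->
  (forall z, cabs (z - c) < r -> chol f z /\ cabs (f z - f c) <= M) ->
  cdiff f c d -> cabs d <= M / r.
Proof.
move=> r0 fh fd; apply/ler_addgt0Pr => e e0.
have [dl dl0 H] := fd _ e0.
pose m := Num.min dl r / 2.
have m0 : 0 < m by rewrite divr_gt0// lt_min dl0.
have [md mr] : m < dl /\ m < r.
  have : Num.min dl r <= dl by rewrite ge_min lexx.
  have : Num.min dl r <= r by rewrite ge_min lexx orbT.
  by rewrite /m; move: (Num.min dl r) m0 => q; rewrite /m; lra.
have mn : cabs (m%:C : C) = m by rewrite cabsR gtr0_norm.
have := H m%:C; rewrite mn => /(_ md) A.
have := schwarz_disc r0 fh (_ : cabs (c + m%:C - c) < r); rewrite addKB mn => /(_ mr) B.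
have : cabs (d * m%:C) <= M * (m / r) + e * m.
  apply: le_trans (lerD B A); rewrite (cabsC _ (d * _)) addrC.
  apply: le_trans (cabsD _ _); rewrite (_ : _ + _ = d * m%:C)//; ring.
by rewrite cabsM mn (_ : M * (m / r) + e * m = (M / r + e) * m) ?ler_pM2r//; ring.
Qed.

(* Schwarz-Pick at the origin, with the origin as removable singularity. *)
Lemma schwarz_pick_except f (k : C) (B : R) : cabs k <= 1 ->
  (forall z, cabs z < 1 -> z != 0 -> chol f z /\ cabs (f z) <= 1) ->
  (exists2 dl : R, 0 < dl & forall z, z != 0 -> cabs z < dl -> cabs (f z - k) <= B * cabs z) ->
  forall z, cabs z < 1 -> z != 0 ->
   cabs (f z - k) <= cabs z * cabs (1 - conjc k * f z).
Proof.
move=> k1 fh [dl dl0 fB] z z1 z0; apply/ler_addgt0Pr => e e0.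
have B0 : 0 <= B.
  pose m := Num.min dl 1 / 2.
  have m0 : 0 < m by rewrite divr_gt0// lt_min dl0 ltr01.
  have md : m < dl.
    have : Num.min dl 1 <= dl by rewrite ge_min lexx.
    by rewrite /m; move: (Num.min dl 1) m0 => q; rewrite /m; lra.
  have mn : cabs (m%:C : C) = m by rewrite cabsR gtr0_norm.
  have := fB m%:C; rewrite -cabs_gt0 mn => /(_ m0 md) A.
  by have := le_trans (cabs_ge0 _) A; rewrite pmulr_lge0.
(* Both [k] and the values of [f] may have modulus 1, where [mob] degenerates; scaling them by [t]
   avoids this at a cost of [1 - t ^ 2 <= 2 * (1 - t)]. *)
have H t : 0 < t < 1 -> t * cabs (f z - k) <= cabs z * cabs (1 - conjc k * f z) + 2 * (1 - t).
  move=> /andP[t0 t1]; have tn : cabs (t%:C : C) = t by rewrite cabsR gtr0_norm.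
  have tk : cabs (t%:C * k) < 1.
    by rewrite cabsM tn; apply: le_lt_trans t1; rewrite ger_pMr.
  pose g w := mob (t%:C * k) (t%:C * f w).
  have tf w : cabs w < 1 -> w != 0 -> cabs (t%:C * f w) <= 1.
    move=> w1 w0; rewrite cabsM tn; apply: le_trans (ltW t1).
    by rewrite ger_pMr//; exact: (fh w w1 w0).2.
  have A : cabs (g z) <= 1 * cabs z.
    apply: (@schwarz_except g 1 (B / (1 - t))) => // [w w1 w0|].
      split; last by apply: cabs_mob_le => //; exact: tf.
      apply: (@chol_comp _ (fun w => t%:C * f w)).
        by apply: cholM (chol_cst _ _) (fh w w1 w0).1.
      by apply: chol_mob; apply: mob_den1 => //; exact: tf.
    exists (Num.min dl 1); first by rewrite lt_min dl0 ltr01.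
    move=> w w0; rewrite lt_min => /andP[wd w1].
    have D := fB w w0 wd; have E : 1 - t <= cabs (1 - conjc (t%:C * k) * (t%:C * f w)).
      have := cabs_trile 1 (conjc (t%:C * k) * (t%:C * f w)).
      rewrite cabs1 cabsM cabsJ; have := tf w w1 w0; have := tk.
      have : cabs (t%:C * k) <= t by rewrite cabsM tn ger_pMr.
      move: (cabs_ge0 (t%:C * k)) (cabs_ge0 (t%:C * f w)); nra.
    have E0 : 0 < cabs (1 - conjc (t%:C * k) * (t%:C * f w)) by lra.
    rewrite /g /mob cabsM cabsV ler_pdivrMr// -mulrBr cabsM tn.
    have : t * cabs (k - f w) <= B * cabs w.
      rewrite cabsC; apply: le_trans D; rewrite ler_piMl ?cabs_ge0//; exact: ltW.
    move=> F; apply: le_trans F _.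
    rewrite -{1}[B * cabs w](divfK (_ : 1 - t != 0)); last by rewrite subr_eq0 eq_sym lt_eqF.
    rewrite [B / _ * _]mulrAC; apply: ler_wpM2l => //.
    by rewrite divr_ge0 ?mulr_ge0 ?cabs_ge0//; lra.
  have D0 := mob_den1 tk (tf z z1 z0); move: (D0); rewrite -cabs_gt0 => D0'.
  move: A; rewrite /g /mob cabsM cabsV ler_pdivrMr// mul1r -mulrBr cabsM tn cabsC.
  move=> A; apply: le_trans A _.
  have -> : 1 - conjc (t%:C * k) * (t%:C * f z) =
      (1 - conjc k * f z) + (1 - t ^+ 2)%:C * (conjc k * f z).
    rewrite (_ : conjc (t%:C * k) = t%:C * conjc k); last first.
      by case: (k) => k3 k2; simpc.
    by rewrite rmorphB rmorph1 rmorphXn /=; ring.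
  have t2 : 0 <= 1 - t ^+ 2 by nra.
  apply: le_trans (ler_wpM2l (cabs_ge0 _) (cabsD _ _)) _.
  rewrite mulrDr lerD2l !cabsM cabsR ger0_norm// cabsJ.
  have : cabs z * (1 - t ^+ 2) * (cabs k * cabs (f z)) <= 1 * (1 - t ^+ 2) * (1 * 1).
    apply: ler_pM; rewrite ?mulr_ge0 ?cabs_ge0//.
      by apply: ler_pM; rewrite ?cabs_ge0// ltW.
    by apply: ler_pM; rewrite ?cabs_ge0//; exact: (fh z z1 z0).2.
  by rewrite -mulrA; nra.
set A := cabs (f z - k) in H *; set D := _ * _ in H *.
have A0 : 0 <= A := cabs_ge0 _.
pose s := Num.min (1 / 2) (e / (2 + A)).
have s0 : 0 < s by rewrite lt_min !divr_gt0//; lra.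
have s1 : s <= 1 / 2 by rewrite ge_min lexx.
have : s * (2 + A) <= e by rewrite -ler_pdivlMr; [rewrite ge_min lexx orbT|lra].
have := H (1 - s) ltac:(lra); lra.
Qed.

End MaxPrinciple.

(** * Taylor estimates and limits *)

Section Taylor.
Context {R : realType}.
Local Notation C := R[i].
Implicit Types (z w a b c d h k : C) (f g : C -> C) (r M : R).

Lemma schwarz_lip f c (r M : R) h : 0 < r ->
  (forall z, cabs (z - c) < r -> chol f z /\ cabs (f z) <= M) ->
  cabs h < r -> cabs (f (c + h) - f c) <= 2 * M * (cabs h / r).
Proof.
move=> r0 fh hr.
have := @schwarz_disc _ f c r (2 * M) r0 _ (c + h); rewrite addKB; apply => // z zr.
split; first exact: (fh z zr).1.
apply: le_trans (cabsB _ _) _; have := (fh z zr).2; have := (fh c _).2.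
by rewrite subrr cabs0 => /(_ r0); lra.
Qed.

(** The increment [f (z + h) - f z] is itself differentiable in [z] and is [O(|h|)] by
    [schwarz_lip]; a second use of [schwarz_lip], now in [z], gives the factor [|k|]. This replaces
    a bound on the second derivative. *)
Lemma second_difference f a (r M : R) h k : 0 < r ->
  (forall z, cabs (z - a) < r -> chol f z /\ cabs (f z) <= M) ->
  cabs h < r / 2 -> cabs k < r / 2 ->
  cabs (f (a + k + h) - f (a + k) - (f (a + h) - f a)) <= 16 * M / r ^+ 2 * cabs h * cabs k.
Proof.
move=> r0 fh hr kr; pose g z := f (z + h) - f z; have r2 : 0 < r / 2 by lra.
have gM z : cabs (z - a) < r / 2 -> cabs (g z) <= 4 * M / r * cabs h.
  move=> zr; have := @schwarz_lip f z (r / 2) M h r2 _ hr.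
  rewrite (_ : 2 * M * (cabs h / (r / 2)) = 4 * M / r * cabs h); last first.
    by field; rewrite lt0r_neq0.
  apply => w wz; apply: fh; apply: le_lt_trans (cabs_tri z _ _) _; lra.
have := @schwarz_lip g a (r / 2) (4 * M / r * cabs h) k r2 _ kr.
rewrite (_ : 2 * _ * _ = 16 * M / r ^+ 2 * cabs h * cabs k); last first.
  by field; rewrite lt0r_neq0.
rewrite /g; apply => z zr; split; last exact: gM.
apply: cholB; last by apply: (fh _ _).1; lra.
apply: (@chol_comp _ (fun z => z + h)); first exact: cholD (chol_id _) (chol_cst _ _).
apply: (fh _ _).1; rewrite (_ : z + h - a = (z - a) + h); last by ring.
by apply: le_lt_trans (cabsD _ _) _; lra.
Qed.

(** By [second_difference] the remainder satisfies [|E h| <= 2 |E (h / 2)| + K / 2 |h| ^ 2].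
    Iterated from [k], the quadratic terms form a geometric series with sum at most [K |k| ^ 2],
    while [2 ^ m * E (k / 2 ^ m)] tends to 0 by differentiability at [a]. *)
Lemma taylor2 f a d (r M : R) k : 0 < r ->
  (forall z, cabs (z - a) < r -> chol f z /\ cabs (f z) <= M) ->
  cdiff f a d -> cabs k < r ->
  cabs (f (a + k) - f a - d * k) <= 8 * M / r ^+ 2 * cabs k ^+ 2.
Proof.
move=> r0 fh fd kr.
have M0 : 0 <= M.
  by apply: le_trans (fh a _).2; rewrite ?cabs_ge0// subrr cabs0.
set K := 8 * M / r ^+ 2; pose E k := f (a + k) - f a - d * k.
have K0 : 0 <= K by rewrite /K mulr_ge0 ?invr_ge0 ?exprn_ge0 ?(ltW r0)// mulr_ge0.
have half h : cabs h < r -> cabs (E h) <= 2 * cabs (E (h / 2)) + K / 2 * cabs h ^+ 2.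
  move=> hr; have h2 : cabs (h / 2) = cabs h / 2 by rewrite cabsM cabsV cabs2V.
  have := @second_difference f a r M (h / 2) (h / 2) r0 fh; rewrite h2.
  move=> /(_ ltac:(lra) ltac:(lra)).
  have -> : a + h / 2 + h / 2 = a + h by field.
  have -> : 16 * M / r ^+ 2 * (cabs h / 2) * (cabs h / 2) = K / 2 * cabs h ^+ 2.
    by rewrite /K; field; rewrite lt0r_neq0.
  have -> : E h = (f (a + h) - f (a + h / 2) - (f (a + h / 2) - f a)) + 2 * E (h / 2).
    by rewrite /E; field.
  move=> A; apply: le_trans (cabsD _ _) _; rewrite cabsM cabs2V; lra.
have iter m : cabs (E k) <= 2 ^+ m * cabs (E (k / 2 ^+ m)) + K * (1 - 2 ^- m) * cabs k ^+ 2.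
  elim: m => [|m IH]; first by rewrite !expr0 mul1r !invr1 mulr1 subrr mulr0 mul0r addr0.
  apply: le_trans IH _.
  have p0 : 0 < (2 : R) ^+ m by rewrite exprn_gt0.
  have p1 : 1 <= (2 : R) ^+ m by rewrite exprn_ege1// ler1n.
  have pm : cabs (2 ^+ m : C) = 2 ^+ m by rewrite cabsX cabs2V.
  have km : cabs (k / 2 ^+ m) = cabs k / 2 ^+ m by rewrite cabsM cabsV pm.
  have := half (k / 2 ^+ m); rewrite km ltr_pdivrMr// => /(_ ltac:(nra)).
  rewrite (_ : k / 2 ^+ m / 2 = k / 2 ^+ m.+1); last by rewrite exprSr invfM mulrA.
  move=> A; have := ler_wpM2l (ltW p0) A.
  rewrite mulrDr mulrA -exprSr => B.
  apply: le_trans (lerD B (lexx _)) _; rewrite -addrA lerD2l le_eqVlt; apply/orP; left.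
  by apply/eqP; rewrite (exprSr 2 m); field; rewrite lt0r_neq0.
apply/ler_addgt0Pr => e e0.
have ck : 0 < cabs k + 1 by have := cabs_ge0 k; lra.
have e1 : 0 < e / (cabs k + 1) by rewrite divr_gt0.
have [dl dl0 H] := fd _ e1.
have [m hm] := exp2_small (cabs k) dl0.
have p0 : 0 < (2 : R) ^+ m by rewrite exprn_gt0.
have km : cabs (k / 2 ^+ m) = cabs k / 2 ^+ m by rewrite cabsM cabsV cabsX cabs2V.
have := H (k / 2 ^+ m); rewrite -/(E _) km => /(_ hm) A.
apply: le_trans (iter m) _.
have : 2 ^+ m * cabs (E (k / 2 ^+ m)) <= e.
  apply: le_trans (ler_wpM2l (ltW p0) A) _.
  rewrite (_ : 2 ^+ m * _ = e * (cabs k / (cabs k + 1))); last first.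
    by field; rewrite !lt0r_neq0.
  by rewrite ger_pMr// ler_pdivrMr// mul1r lerDl.
have : K * (1 - 2 ^- m) * cabs k ^+ 2 <= K * cabs k ^+ 2.
  apply: ler_wpM2r; first by rewrite exprn_ge0 ?cabs_ge0.
  have : 0 <= K / 2 ^+ m by rewrite divr_ge0// ltW.
  lra.
lra.
Qed.

End Taylor.

(** * Limits of sequences of holomorphic functions *)

Section Limits.
Context {R : realType}.
Local Notation C := R[i].
Implicit Types (z w a b c d h k : C) (f g : C -> C) (r M : R).

Lemma real_cauchy (u : nat -> R) :
  (forall e, 0 < e -> exists N, forall n m, (N <= n)%N -> (N <= m)%N -> `|u n - u m| <= e) ->
  exists l, forall e, 0 < e -> exists N, forall n, (N <= n)%N -> `|u n - l| <= e.
Proof.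
move=> H; pose S := [set x : R | exists N, forall n, (N <= n)%N -> x <= u n].
have bnd e N : (forall n m, (N <= n)%N -> (N <= m)%N -> `|u n - u m| <= e) ->
    S (u N - e) /\ ubound S (u N + e).
  move=> HN; split.
    by exists N => n Nn; have := HN n N Nn (leqnn N); rewrite ler_norml; lra.
  move=> x [m xm]; have := xm (maxn m N) (leq_maxl _ _).
  by have := HN (maxn m N) N (leq_maxr _ _) (leqnn N); rewrite ler_norml; lra.
exists (sup S) => e e0; have e2 : 0 < e / 2 by lra.
have [N HN] := H _ e2; exists N => n Nn.
have [A B] := bnd _ _ HN.
have U : u N - e / 2 <= sup S by apply: ub_le_sup => //; exists (u N + e / 2).
have L : sup S <= u N + e / 2 by apply: ge_sup => //; exists (u N - e / 2).
by have := HN n N Nn (leqnn N); rewrite !ler_norml; lra.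
Qed.

Lemma complex_cauchy (u : nat -> C) :
  (forall e, 0 < e -> exists N, forall n m, (N <= n)%N -> (N <= m)%N -> cabs (u n - u m) <= e) ->
  exists l, forall e, 0 < e -> exists N, forall n, (N <= n)%N -> cabs (u n - l) <= e.
Proof.
move=> H.
have ReB (z w : C) : Re (z - w) = Re z - Re w by case: z w => a b [].
have ImB (z w : C) : Im (z - w) = Im z - Im w by case: z w => a b [].
have [|x hx] := @real_cauchy (fun n => Re (u n)).
  move=> e /H[N HN]; exists N => n m nN mN; rewrite -ReB.
  exact: le_trans (cabs_Re _) (HN _ _ nN mN).
have [|y hy] := @real_cauchy (fun n => Im (u n)).
  move=> e /H[N HN]; exists N => n m nN mN; rewrite -ImB.
  exact: le_trans (cabs_Im _) (HN _ _ nN mN).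
exists (x +i* y) => e e0; have e2 : 0 < e / 2 by lra.
have [N1 H1] := hx _ e2; have [N2 H2] := hy _ e2.
exists (maxn N1 N2) => n; rewrite geq_max => /andP[/H1 A /H2 B].
by apply: le_trans (cabs_ReIm _) _; rewrite ReB ImB /=; lra.
Qed.

(** The derivatives are Cauchy by [cdiff_bound] applied to differences, and the remainder of
    [taylor2] is quadratic uniformly in [n], so it survives in the limit. *)
Lemma weierstrass (f : nat -> C -> C) g a (r M : R) : 0 < r ->
  (forall n z, cabs (z - a) < r -> chol (f n) z /\ cabs (f n z) <= M) ->
  (forall e, 0 < e -> exists N, forall n, (N <= n)%N ->
     forall z, cabs (z - a) < r -> cabs (f n z - g z) <= e) ->
  exists2 d, cdiff g a d &
   forall e, 0 < e -> exists N, forall n, (N <= n)%N -> cabs (der (f n) a - d) <= e.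
Proof.
move=> r0 fh fg.
have a_in : cabs (a - a) < r by rewrite subrr cabs0.
have fd n : cdiff (f n) a (der (f n) a) by apply: derP; exact: (fh n a a_in).1.
have [|d hd] := @complex_cauchy (fun n => der (f n) a).
  move=> e e0; have e4 : 0 < e * r / 4 by rewrite divr_gt0 ?mulr_gt0.
  have [N HN] := fg _ e4; exists N => n m nN mN.
  have := @cdiff_bound _ (fun z => f n z - f m z) a (der (f n) a - der (f m) a) r (e * r) r0.
  rewrite mulfK ?lt0r_neq0//; apply; last first.
    apply: cdiff_eq (cdiffD (fd n) (_ : cdiff (fun x => - f m x) a (- der (f m) a))).
      by exists 1.
    have := cdiffM (cdiff_cst (-1) a) (fd m); rewrite mul0r add0r mulN1r.
    by apply: cdiff_eq; exists 1 => // w _; rewrite mulN1r.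
  move=> z zr; split; first exact: cholB (fh n z zr).1 (fh m z zr).1.
  have A := HN n nN z zr; have B := HN m mN z zr.
  have A' := HN n nN a a_in; have B' := HN m mN a a_in.
  have -> : f n z - f m z - (f n a - f m a) =
    (f n z - g z - (f m z - g z)) - (f n a - g a - (f m a - g a)) by ring.
  apply: le_trans (cabsB _ _) _.
  apply: le_trans (lerD (cabsB _ _) (cabsB _ _)) _; lra.
exists d => // e e0.
have M0 : 0 <= M by apply: le_trans (fh 0%N a a_in).2; exact: cabs_ge0.
pose K := 8 * M / r ^+ 2.
have K0 : 0 <= K by rewrite /K mulr_ge0 ?invr_ge0 ?exprn_ge0 ?(ltW r0)// mulr_ge0.
have gT k : cabs k < r -> cabs (g (a + k) - g a - d * k) <= K * cabs k ^+ 2.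
  move=> kr; apply/ler_addgt0Pr => e1 e10.
  have e2 : 0 < e1 / 4 by lra.
  have k1 : 0 < cabs k + 1 by have := cabs_ge0 k; lra.
  have e3 : 0 < e1 / 4 / (cabs k + 1) by rewrite divr_gt0.
  have [N1 H1] := fg _ e2; have [N2 H2] := hd _ e3.
  have {}H2 := H2 (maxn N1 N2) (leq_maxr _ _).
  have {}H1 := H1 (maxn N1 N2) (leq_maxl _ _); set n := maxn N1 N2 in H1 H2.
  have A := H1 a a_in; have B := H1 (a + k) ltac:(by rewrite addKB).
  have D := taylor2 r0 (fh n) (fd n) kr.
  have -> : g (a + k) - g a - d * k = (f n (a + k) - f n a - der (f n) a * k) +
     (f n a - g a) + (der (f n) a - d) * k - (f n (a + k) - g (a + k)) by ring.
  apply: le_trans (cabsB _ _) _.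
  apply: le_trans (lerD (cabsD _ _) (lexx _)) _.
  apply: le_trans (lerD (lerD (cabsD _ _) (lexx _)) (lexx _)) _.
  rewrite cabsM.
  have E : cabs (der (f n) a - d) * cabs k <= e1 / 4.
    apply: le_trans (ler_wpM2r (cabs_ge0 _) H2) _.
    by rewrite mulrAC ler_pdivrMr// ler_pM2l// lerDl.
  rewrite -/K in D; lra.
have K1 : 0 < K + 1 by lra.
exists (Num.min r (e / (K + 1))); first by rewrite lt_min r0 divr_gt0.
move=> h; rewrite lt_min ltr_pdivlMr// => /andP[hr he].
apply: le_trans (gT h hr) _; rewrite expr2 mulrA; apply: ler_wpM2r; first exact: cabs_ge0.
by have := cabs_ge0 h; nra.
Qed.

End Limits.

(** * Compactness and injective functions *)

Section Compactness.
Context {R : realType}.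
Local Notation C := R[i].
Implicit Types (z w a b c d h k : C) (f g : C -> C) (r M x y s : R).

(** A Lebesgue number: goodness passes to smaller radii, so the minimum of the radii found on four
    quarters works on their union. *)
Lemma square_uniform (good : R -> R -> R -> Prop) X Y S : 0 < S ->
  (forall x y e e', 0 < e' -> e' <= e -> good x y e -> good x y e') ->
  (forall x0 y0, X <= x0 <= X + S -> Y <= y0 <= Y + S -> exists2 dl : R, 0 < dl &
    forall x y, X <= x <= X + S -> Y <= y <= Y + S ->
      `|x - x0| < dl -> `|y - y0| < dl -> good x y dl) ->
  exists2 om : R, 0 < om & forall x y, X <= x <= X + S -> Y <= y <= Y + S -> good x y om.
Proof.
move=> S0 mono loc.
apply: (@square_bisection R (fun x y s => exists2 om : R, 0 < om &
  forall x' y', x <= x' <= x + s -> y <= y' <= y + s -> good x' y' om)) => //.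
- move=> x y s s0 [t1 p1 H1] [t2 p2 H2] [t3 p3 H3] [t4 p4 H4].
  pose o := Num.min (Num.min t1 t2) (Num.min t3 t4).
  have o0 : 0 < o by rewrite !lt_min p1 p2 p3 p4.
  exists o => // x' y' hx hy.
  have [lx|lx] := leP x' (x + s / 2); have [ly|ly] := leP y' (y + s / 2).
  - apply: (mono _ _ t1) => //; first by rewrite /o !ge_min lexx.
    by apply: H1; lra.
  - apply: (mono _ _ t3) => //; first by rewrite /o !ge_min lexx !orbT.
    by apply: H3; lra.
  - apply: (mono _ _ t2) => //; first by rewrite /o !ge_min lexx !orbT.
    by apply: H2; lra.
  - apply: (mono _ _ t4) => //; first by rewrite /o !ge_min lexx !orbT.
    by apply: H4; lra.
- move=> x0 y0 hx hy; have [dl dl0 H] := loc _ _ hx hy.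
  exists dl => // x y s /andP[s0 sd] h1 h2 a1 a2 a3 a4.
  exists dl => // x' y' hx' hy'.
  by apply: H; rewrite ?ltr_norml; lra.
Qed.

(** The disc is placed in a square whose points outside the disc are vacuously good; as the disc is
    closed, such points have neighbourhoods of the same kind. *)
Lemma disc_uniform (good : C -> R -> Prop) c r : 0 < r ->
  (forall z e e', 0 < e' -> e' <= e -> good z e -> good z e') ->
  (forall z0, cabs (z0 - c) <= r -> exists2 dl : R, 0 < dl &
    forall z, cabs (z - c) <= r -> cabs (z - z0) < dl -> good z dl) ->
  exists2 om : R, 0 < om & forall z, cabs (z - c) <= r -> good z om.
Proof.
move=> r0 mono loc.
pose G x y e := cabs (c + (x +i* y) - c) <= r -> good (c + (x +i* y)) e.
have close x y x0 y0 dl : `|x - x0| < dl / 2 -> `|y - y0| < dl / 2 ->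
    cabs (c + (x +i* y) - (c + (x0 +i* y0))) < dl.
  move=> hx hy; rewrite (_ : _ - _ = (x - x0) +i* (y - y0)).
    by apply: le_lt_trans (cabs_ReIm _) _; rewrite /=; lra.
  by rewrite opprD addrACA subrr add0r; apply/eqP; rewrite eq_complex /= !eqxx.
have [||om om0 H] := @square_uniform G (- r) (- r) (2 * r) ltac:(lra).
- by move=> x y e e' e0 ee g zr; apply: (mono _ e) => //; exact: g.
- move=> x0 y0 hx hy.
  have [zr|zr] := leP (cabs (c + (x0 +i* y0) - c)) r.
    have [dl dl0 H] := loc _ zr.
    exists (dl / 2) => [|x y _ _ dx dy zr1]; first by lra.
    apply: (mono _ dl); [lra|lra|]; apply: H => //.
    exact: close.
  set z0 := c + _ in zr.
  exists ((cabs (z0 - c) - r) / 2) => [|x y _ _ dx dy zr1]; first by lra.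
  exfalso; have := close _ _ _ _ _ dx dy; rewrite -/z0.
  by have := cabs_tri (c + (x +i* y)) z0 c; rewrite (cabsC z0 (c + _)); lra.
exists om => // z zr.
have E : z = c + (Re (z - c) +i* Im (z - c)).
  by case: z c {zr om0 H G close loc} => z1 z2 [c1 c2]; apply/eqP; rewrite eq_complex /=; apply/andP; split; apply/eqP; ring.
have := cabs_Re (z - c); have := cabs_Im (z - c); rewrite !ler_norml => A B.
rewrite E; apply: H; [lra|lra|by rewrite -E].
Qed.

Lemma circle_lower_bound f c r v : 0 < r ->
  (forall z, cabs (z - c) = r -> ccont f z) ->
  (forall z, cabs (z - c) = r -> f z != v) ->
  exists2 e : R, 0 < e & forall z, cabs (z - c) = r -> e <= cabs (f z - v).
Proof.
move=> r0 fc fv.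
pose good z e := cabs (z - c) = r -> e <= cabs (f z - v).
have [||om om0 H] := @disc_uniform good c r r0.
- by move=> z e e' e0 ee g zr; apply: le_trans ee (g zr).
- move=> z0 z0r; have [z0E|z0E] := eqVneq (cabs (z0 - c)) r.
    have v0 : 0 < cabs (f z0 - v) / 2.
      by rewrite divr_gt0// cabs_gt0 subr_eq0 fv.
    have [dl dl0 H] := fc _ z0E _ v0.
    exists (Num.min dl (cabs (f z0 - v) / 2)); first by rewrite lt_min dl0.
    move=> z _; rewrite lt_min => /andP[/H h _] _.
    rewrite ge_min; apply/orP; right.
    by have := cabs_tri (f z) (f z0) v; rewrite (cabsC (f z0) (f z)); lra.
  have lt : cabs (z0 - c) < r by rewrite lt_neqAle z0E.
  exists (r - cabs (z0 - c)) => [|z _ zd zr]; first by lra.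
  by exfalso; have := cabs_tri z0 z c; lra.
by exists om => // z zr; apply: H => //; rewrite zr.
Qed.

End Compactness.

(** * Derivatives of injective functions *)

Section Injective.
Context {R : realType}.
Local Notation C := R[i].
Implicit Types (z w a b c d h k : C) (f g : C -> C) (r M x y s : R).

Lemma locally_bounded f c : ccont f c ->
  exists2 dl : R, 0 < dl & forall z, cabs (z - c) < dl -> cabs (f z) <= cabs (f c) + 1.
Proof.
move=> /(_ _ ltr01)[dl dl0 H]; exists dl => // z /H h.
by apply: le_trans (cabs_trile _ (f c)) _; rewrite lerD2l ltW.
Qed.

(** With derivative 0, [taylor2] bounds each of [n] steps of length [|h| / n] by [K (|h| / n) ^ 2];
    the sum is [K |h| ^ 2 / n], which tends to 0. *)
Lemma der0_cst f c r : 0 < r ->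
  (forall z, cabs (z - c) < r -> cdiff f z 0) ->
  exists2 dl : R, 0 < dl & forall h, cabs h < dl -> f (c + h) = f c.
Proof.
move=> r0 fd.
have [dl dl0 fM] : exists2 dl : R, 0 < dl & forall z, cabs (z - c) < dl -> cabs (f z) <= cabs (f c) + 1.
  by apply/locally_bounded/(cdiff_cont (fd c _)); rewrite subrr cabs0.
set M := cabs (f c) + 1 in fM; have M0 : 0 <= M by have := cabs_ge0 (f c); rewrite /M; lra.
pose m := Num.min dl r / 2.
have [m0 md mr] : [/\ 0 < m, m + m <= dl & m + m <= r].
  have E : m + m = Num.min dl r by rewrite /m; field.
  by rewrite E !ge_min !lexx orbT divr_gt0// lt_min dl0.
exists m => // h hm.
pose K := 8 * M / m ^+ 2.
have K0 : 0 <= K by rewrite /K mulr_ge0 ?invr_ge0 ?exprn_ge0 ?(ltW m0)// mulr_ge0.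
have step z k : cabs (z - c) < m -> cabs k < m -> cabs (f (z + k) - f z) <= K * cabs k ^+ 2.
  move=> zm km; have := @taylor2 _ f z 0 m M k m0.
  rewrite mul0r subr0; apply => //; last by apply: fd; lra.
  move=> w wz; have wc : cabs (w - c) < m + m by apply: le_lt_trans (cabs_tri z _ _) _; lra.
  by split; [exists 0; apply: fd; lra|apply: fM; lra].
have chain n j : (j <= n.+1)%N ->
    cabs (f (c + h * (j%:R / n.+1%:R)) - f c) <= j%:R * (K * (cabs h / n.+1%:R) ^+ 2).
  have n0 : (0 : R) < n.+1%:R by rewrite ltr0n.
  have nn : cabs (n.+1%:R : C) = n.+1%:R.
    by rewrite (_ : n.+1%:R = (n.+1%:R : R)%:C) ?cabsR ?ger0_norm// rmorph_nat.
  have nc : (n.+1%:R : C) != 0 by rewrite pnatr_eq0.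
  elim: j => [|j IH] jn; first by rewrite mul0r mulr0 addr0 subrr cabs0 mul0r.
  have {}IH := IH (ltnW jn).
  have jm : cabs (j%:R : C) = j%:R.
    by rewrite (_ : j%:R = (j%:R : R)%:C) ?cabsR ?ger0_norm// rmorph_nat.
  have hj : cabs (h * (j%:R / n.+1%:R)) < m.
    rewrite !cabsM cabsV nn jm; apply: le_lt_trans hm.
    rewrite ler_piMr ?cabs_ge0// ler_pdivrMr// mul1r ler_nat.
    exact: ltnW.
  have hn : cabs (h / n.+1%:R) < m.
    rewrite cabsM cabsV nn; apply: le_lt_trans hm.
    by rewrite ler_pdivrMr// ler_peMr ?cabs_ge0// ler1n.
  have := step (c + h * (j%:R / n.+1%:R)) (h / n.+1%:R); rewrite addKB => /(_ hj hn).
  rewrite (_ : _ + _ + h / n.+1%:R = c + h * (j.+1%:R / n.+1%:R)); last first.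
    by rewrite -(natr1 j); field.
  rewrite cabsM cabsV nn => A.
  apply: le_trans (cabs_tri (f (c + h * (j%:R / n.+1%:R))) _ _) _.
  rewrite (_ : j.+1%:R * _ = K * (cabs h / n.+1%:R) ^+ 2 +
    j%:R * (K * (cabs h / n.+1%:R) ^+ 2)); last by rewrite -natr1; ring.
  exact: lerD.
apply/eqP; rewrite -subr_eq0 -[_ == _]negbK -cabs_gt0 -leNgt.
apply/ler_addgt0Pr => e e0; rewrite add0r.
have Kh : 0 <= K * cabs h ^+ 2 by rewrite mulr_ge0// exprn_ge0 ?cabs_ge0.
have := archi_boundP (_ : 0 <= K * cabs h ^+ 2 / e); rewrite divr_ge0 ?(ltW e0)//.
move=> /(_ isT); set n := Num.bound _; rewrite ltr_pdivrMr// => hn.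
have n0 : (0 : R) < n.+1%:R by rewrite ltr0n.
have := chain n n.+1 (leqnn _); rewrite divff ?pnatr_eq0// mulr1.
move=> A; apply: le_trans A _.
rewrite (_ : _ * _ = K * cabs h ^+ 2 / n.+1%:R); last by field; rewrite lt0r_neq0.
rewrite ler_pdivrMr// -natr1; nra.
Qed.

(* If f z1 = w is a simple value near x, injectivity makes (f - w) / (z - z1)
   zero-free, so the minimum principle bounds |f x - w| / |x - z1| below. *)
Lemma injective_der_neq0 f c r d : 0 < r ->
  (forall z, cabs (z - c) < r -> chol f z) ->
  (forall z w, cabs (z - c) < r -> cabs (w - c) < r -> f z = f w -> z = w) ->
  cdiff f c d -> d != 0.
Proof.
move=> r0 fh finj fd; apply/eqP => d0; rewrite {}d0 in fd.
have cr : cabs (c - c) < r by rewrite subrr cabs0.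
pose p := r / 2; have p0 : 0 < p by rewrite /p; lra.
have [et et0 fet] : exists2 e : R, 0 < e & forall z, cabs (z - c) = p -> e <= cabs (f z - f c).
  apply: circle_lower_bound => // z zp.
    by apply/chol_cont/fh; rewrite zp /p; lra.
  apply/eqP => /finj; rewrite zp => /(_ ltac:(rewrite /p; lra) cr) zc.
  by move: zp; rewrite zc subrr cabs0 => p00; rewrite -p00 ltxx in p0.
have e1 : 0 < et / 2 / (4 * p) by rewrite !divr_gt0// mulr_gt0.
have e2 : 0 < et / 2 by lra.
have [d1 d10 H1] := fd _ e1; have [d2 d20 H2] := cdiff_cont fd e2.
pose m := Num.min (Num.min d1 d2) p.
have [m0 [md1 md2 mp]] : 0 < m /\ [/\ m <= d1, m <= d2 & m <= p].
  by rewrite /m !lt_min d10 d20 p0 !ge_min !lexx !orbT.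
(* The derivative vanishes on a whole disc, which then makes [f] constant against injectivity. *)
have alld0 z : cabs (z - c) < m -> cdiff f z 0.
  move=> zm; have [->//|zc] := eqVneq z c.
  have [d' fd'] := fh z ltac:(by rewrite /p in mp; lra).
  have [<-//|d'0] := eqVneq d' 0; exfalso.
  have fzw : cabs (f z - f c) < et / 2 by apply: H2; lra.
  have zc0 : 0 < cabs (z - c) by rewrite cabs_gt0 subr_eq0.
  have finj0 w : cabs (w - c) <= p -> w != z -> f w - f z != 0.
    move=> wp wz; rewrite subr_eq0; apply: contra wz => /eqP /finj h.
    by apply/eqP/h; rewrite /p in wp mp *; lra.
  have : cabs ((c - z) / (f c - f z)) <= 2 * p / (et / 2).
    apply: (@max_disc_except _ (fun w => (w - z) / (f w - f z)) z c p) => //.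
    - move=> w wp wz; apply: chol_div; first exact: finj0.
        exact: cholB (chol_id _) (chol_cst _ _).
      by apply: cholB (chol_cst _ _); apply: fh; rewrite /p in wp; lra.
    - have d'1 : 0 < cabs d' / 2 by rewrite divr_gt0// cabs_gt0.
      have [dl dl0 H] := fd' _ d'1.
      exists dl => //; exists (2 / cabs d') => w wz wd.
      have := H (w - z) wd; rewrite addBK => A.
      have wz0 : 0 < cabs (w - z) by rewrite cabs_gt0 subr_eq0.
      have B : cabs d' / 2 * cabs (w - z) <= cabs (f w - f z).
        have := cabs_trile (d' * (w - z)) (f w - f z).
        rewrite (cabsC (d' * _)) cabsM; lra.
      have F0 : 0 < cabs (f w - f z) by apply: lt_le_trans B; rewrite mulr_gt0.
      rewrite cabsM cabsV ler_pdivrMr//.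
      have D0 : 0 < 2 / cabs d' by rewrite divr_gt0// cabs_gt0.
      apply: le_trans (ler_wpM2l (ltW D0) B).
      rewrite mulrA (_ : _ * (_ / _) = 1) ?mul1r//; field.
      by rewrite lt0r_neq0// cabs_gt0.
    - move=> w wp; rewrite cabsM cabsV.
      have A := fet w wp; have B : et / 2 <= cabs (f w - f z).
        by have := cabs_tri (f z) (f w) (f c); lra.
      have Fp : 0 < cabs (f w - f z) by lra.
      rewrite ler_pdivrMr// mulrAC ler_pdivlMr//.
      have wz : cabs (w - z) <= 2 * p.
        by apply: le_trans (cabs_tri c _ _) _; rewrite wp (cabsC c); lra.
      by apply: ler_pM; rewrite ?cabs_ge0//; lra.
    - lra.
    - by rewrite subrr cabs0 ltW.
    - by rewrite eq_sym.
  have fzc : 0 < cabs (f c - f z).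
    by rewrite cabs_gt0 finj0// ?subrr ?cabs0 ?ltW// eq_sym.
  rewrite cabsM cabsV ler_pdivrMr// (cabsC c).
  have := H1 (z - c) ltac:(lra); rewrite addBK mul0r subr0 (cabsC (f z)) => A B.
  have : cabs (z - c) <= 2 * p / (et / 2) * (et / 2 / (4 * p) * cabs (z - c)).
    apply: le_trans B _; rewrite ler_wpM2l// divr_ge0 ?mulr_ge0// ltW//.
  rewrite (_ : _ * (_ * _) = cabs (z - c) / 2); first by lra.
  by field; rewrite !lt0r_neq0.
(* The derivative vanishes near [c], so [f] is constant there, against injectivity. *)
have [dl dl0 H] := @der0_cst f c m m0 alld0.
pose q := Num.min dl r / 2.
have q0 : 0 < q by rewrite divr_gt0// lt_min dl0.
have [qd qr] : q < dl /\ q < r.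
  have E : q + q = Num.min dl r by rewrite /q; field.
  have A : q + q <= dl by rewrite E ge_min lexx.
  have B : q + q <= r by rewrite E ge_min lexx orbT.
  by split; lra.
have qn : cabs (q%:C : C) = q by rewrite cabsR gtr0_norm.
have := H q%:C; rewrite qn => /(_ qd) /finj; rewrite addKB qn => /(_ qr cr).
move=> /(congr1 (fun z => z - c)); rewrite addKB subrr => h.
by move: q0; rewrite -qn h cabs0 ltxx.
Qed.

End Injective.

(** * Square roots on simply connected domains *)

Section Bridge.
Context {R : realType}.
Local Notation C := R[i].
Implicit Types (z w a b c d h k : C) (f g : C -> C) (r M x y s : R) (A : set C).

Lemma nbhs_cabsP z A : nbhs z A <->
  exists2 r : R, 0 < r & forall w, cabs (w - z) < r -> A w.
Proof.
split=> [/nbhs_ballP[e /= e0 eA]|[r r0 rA]].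
  have eE : e = (Re e)%:C by move: e0; rewrite ltcE /= => /andP[/eqP]; case: (e) => a b /= ->.
  exists (Re e); first by rewrite -ltcR -eE.
  move=> w wr; apply: eA; rewrite /ball /= eE -normrN opprB.
  by rewrite normc_def ltcR; move: wr; case: (w - z).
apply/nbhs_ballP; exists r%:C => /=; first by rewrite ltcR.
move=> w; rewrite /ball /= -normrN opprB normc_def ltcR => h.
by apply: rA; move: h; case: (w - z).
Qed.

Lemma open_cabsP A : open A <->
  forall z, A z -> exists2 r : R, 0 < r & forall w, cabs (w - z) < r -> A w.
Proof.
rewrite openE; split=> H z /H; last by move=> h; apply/nbhs_cabsP.
by move=> /nbhs_cabsP.
Qed.

Lemma within_continuousP (T : pseudoMetricType R) (D : set T) (f : T -> C) :
  {within D, continuous f} <->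
  forall p, D p -> forall e : R, 0 < e -> exists2 dl : R, 0 < dl &
    forall q, D q -> ball p dl q -> cabs (f q - f p) < e.
Proof.
split=> [/subspace_continuousP H p Dp e e0|H].
  have : nbhs (f p) [set y | cabs (y - f p) < e] by apply/nbhs_cabsP; exists e.
  move=> /(H p Dp) /nbhs_ballP[dl /= dl0 E]; exists dl => // y Ay /E; exact.
apply/subspace_continuousP => p Dp B /nbhs_cabsP[e e0 eB].
have [dl dl0 E] := H p Dp e e0.
apply/nbhs_ballP; exists dl => //= y xy Ay; exact/eB/E.
Qed.

Lemma within_continuousC A f : open A -> {within A, continuous f} <->
  forall z, A z -> ccont f z.
Proof.
move=> oA; split=> [/subspace_continuousP H p Ap e e0|H].
  have : nbhs (f p) [set y | cabs (y - f p) < e] by apply/nbhs_cabsP; exists e.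
  move=> /(H p Ap) /nbhs_cabsP[dl dl0 D].
  have [r r0 rA] := (open_cabsP A).1 oA p Ap.
  exists (Num.min dl r); first by rewrite lt_min dl0.
  by move=> w; rewrite lt_min => /andP[/D h /rA /h].
apply/subspace_continuousP => p Ap B /nbhs_cabsP[e e0 eB].
have [dl dl0 D] := H p Ap e e0.
by apply/nbhs_cabsP; exists dl => // w /D /eB.
Qed.

Lemma connected_clopen A (T : set C) : connected A -> T `<=` A -> T !=set0 ->
  (forall z, T z -> exists2 r : R, 0 < r & forall w, cabs (w - z) < r -> A w -> T w) ->
  (forall z, A z -> ~ T z -> exists2 r : R, 0 < r & forall w, cabs (w - z) < r -> ~ T w) ->
  A `<=` T.
Proof.
move=> cA TA T0 To Tc.
suff -> : T = A by [].
apply: cA => //.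
  exists (interior (T `|` ~` A)); first exact: open_interior.
  rewrite eqEsubset; split=> [z Tz|z [Az /interior_subset[//|//]]].
  split; first exact: TA.
  have [r r0 H] := To z Tz; apply/nbhs_cabsP; exists r => // w /H h.
  by have [/h|] := pselect (A w); [left|right].
exists (~` interior (~` T)).
  by rewrite closedC; exact: open_interior.
rewrite eqEsubset; split=> [z Tz|z [Az]].
  by split; [exact: TA|move=> /interior_subset].
apply: contra_notP => nT; have [r r0 H] := Tc z Az nT.
by apply/nbhs_cabsP; exists r.
Qed.

Lemma difference_quotientP f z d :
  (fun h => h^-1 *: (f (h *: 1 + z) - f z)) @ 0^' --> d <-> cdiff f z d.
Proof.
have E h : h != 0 -> cabs (h^-1 *: (f (h *: 1 + z) - f z) - d) * cabs h =
    cabs (f (z + h) - f z - d * h).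
  move=> h0; rewrite -cabsM /GRing.scale /= mulr1 (addrC h z); congr cabs.
  by field.
split=> [H e e0|H B /nbhs_cabsP[e e0 eB]].
  have : nbhs d [set y | cabs (y - d) < e] by apply/nbhs_cabsP; exists e.
  move=> /H /nbhs_cabsP[dl dl0 D]; exists dl => // h hd.
  have [->|h0] := eqVneq h 0; first by rewrite addr0 subrr mulr0 subr0 cabs0 mulr0.
  rewrite -E//; apply: ler_wpM2r; first exact: cabs_ge0.
  by apply: ltW; apply: D => //; rewrite subr0.
have e2 : 0 < e / 2 by lra.
have [dl dl0 D] := H _ e2.
apply/nbhs_cabsP; exists dl => // h; rewrite subr0 => hd h0; apply: eB.
have hp : 0 < cabs h by rewrite cabs_gt0.
have := D h hd; rewrite -E// ler_pM2r// => A; lra.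
Qed.

Lemma derivable_cholP f z : derivable f z 1 <-> chol f z.
Proof.
split=> [/cvg_ex[d /difference_quotientP]|[d]]; first by exists d.
by move=> /difference_quotientP h; apply/cvg_ex; exists d.
Qed.

Lemma derive1_eq f z d : cdiff f z d -> derive1 f z = d.
Proof.
move=> /difference_quotientP h; rewrite derive1E; exact: cvg_lim.
Qed.

End Bridge.

Section SquareRoots.
Context {R : realType}.
Local Notation C := R[i].
Implicit Types (u v z w a b c d h k : C) (f g : C -> C) (r M x y s t : R) (A Q : set C).

(** The principal branch on the right half-plane, where [psqrt_close] makes it continuous; ratios of
    nearby nonzero values always fall there. *)
Definition psqrt z : C := if 0 < Re (sqrtc z) then sqrtc z else - sqrtc z.

Lemma psqrt_sqr z : psqrt z ^+ 2 = z.
Proof. by rewrite /psqrt; case: ifP => _; rewrite ?sqrrN sqr_sqrtc. Qed.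

Lemma psqrt_Re z : 0 < Re z -> 0 < Re (psqrt z).
Proof.
move=> z0; rewrite /psqrt; case: ifPn => // ; rewrite -leNgt => h.
have : Re (sqrtc z) != 0.
  apply: contraTneq z0 => E; rewrite -leNgt -(sqr_sqrtc z).
  move: E; case: (sqrtc z) => a b /= ->; rewrite mul0r sub0r oppr_le0.
  by rewrite -expr2 sqr_ge0.
by move: h; rewrite le_eqVlt => /orP[-> //|]; case: (sqrtc z) => a b /=; rewrite oppr_gt0.
Qed.

Lemma psqrt_close u v : 0 < Re u -> 0 < Re v ->
  cabs (psqrt u - psqrt v) * Re (psqrt v) <= cabs (u - v).
Proof.
move=> u0 v0; rewrite -{2}(psqrt_sqr u) -{3}(psqrt_sqr v) subr_sqr cabsM.
apply: ler_wpM2l; first exact: cabs_ge0.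
have := psqrt_Re u0; have := psqrt_Re v0; move: (psqrt u) (psqrt v) => p q q0 p0.
apply: le_trans (cabs_Re _); apply: le_trans (ler_norm _).
by case: p q p0 q0 => p1 p2 [q1 q2] /= h1 h2; lra.
Qed.

Lemma Re1_gt0 : 0 < Re (1 : C).
Proof. exact: ltr01. Qed.

Lemma psqrt1 : psqrt (1 : C) = 1.
Proof.
have /eqP := psqrt_sqr (1 : C); rewrite sqrf_eq1 => /orP[/eqP //|/eqP E].
by have := psqrt_Re (Re1_gt0 : 0 < Re (1 : C)); rewrite E /= ltr0N1.
Qed.

Lemma Re_gt0_near1 u : cabs (u - 1) < 1 -> 0 < Re u.
Proof.
move=> h; have := le_lt_trans (cabs_Re _) h.
by case: u {h} => a b /=; rewrite ltr_norml; lra.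
Qed.

Lemma psqrt_near1 u : cabs (u - 1) < 1 -> cabs (psqrt u - 1) <= cabs (u - 1).
Proof.
move=> h; have := psqrt_close (Re_gt0_near1 h) Re1_gt0.
by rewrite psqrt1 mulr1.
Qed.

Lemma ratio_near1 (p q : C) : cabs (p - q) < cabs q ->
  q != 0 /\ cabs (p / q - 1) < 1.
Proof.
move=> h; have q0 : 0 < cabs q by apply: le_lt_trans h; exact: cabs_ge0.
have qn : q != 0 by rewrite -cabs_gt0.
split=> //; rewrite (_ : p / q - 1 = (p - q) / q); last by field.
by rewrite cabsM cabsV ltr_pdivrMr// mul1r.
Qed.

Definition wcont A f z := forall e : R, 0 < e -> exists2 dl : R, 0 < dl &
  forall w, A w -> cabs (w - z) < dl -> cabs (f w - f z) < e.

Lemma wcontM A f g z : wcont A f z -> wcont A g z -> wcont A (fun w => f w * g w) z.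
Proof.
move=> F G e e0.
have k1 : 0 < cabs (g z) + 1 by have := cabs_ge0 (g z); lra.
have k2 : 0 < cabs (f z) + 1 by have := cabs_ge0 (f z); lra.
have e1 : 0 < e / 2 / (cabs (g z) + 1) by rewrite !divr_gt0.
have e2 : 0 < e / 2 / (cabs (f z) + 1) by rewrite !divr_gt0.
have [d1 d10 H1] := F _ e1; have [d2 d20 H2] := G _ e2; have [d3 d30 H3] := G _ ltr01.
exists (Num.min (Num.min d1 d2) d3); first by rewrite !lt_min d10 d20.
move=> w Aw; rewrite !lt_min => /andP[/andP[/(H1 w Aw) A1 /(H2 w Aw) A2] /(H3 w Aw) A3].
have -> : f w * g w - f z * g z = (f w - f z) * g w + f z * (g w - g z) by ring.
apply: le_lt_trans (cabsD _ _) _; rewrite !cabsM.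
have gw : cabs (g w) <= cabs (g z) + 1.
  by apply: le_trans (cabs_trile _ (g z)) _; rewrite lerD2l ltW.
rewrite ltr_pdivlMr// in A1; rewrite ltr_pdivlMr// in A2.
have B1 : cabs (f w - f z) * cabs (g w) <= cabs (f w - f z) * (cabs (g z) + 1).
  by apply: ler_wpM2l => //; exact: cabs_ge0.
have B2 : cabs (f z) * cabs (g w - g z) <= (cabs (f z) + 1) * cabs (g w - g z).
  by apply: ler_wpM2r; [exact: cabs_ge0|rewrite lerDl].
lra.
Qed.

Lemma wcontV A f z : f z != 0 -> wcont A f z -> wcont A (fun w => (f w)^-1) z.
Proof.
move=> fz F e e0; have [dl dl0 H] := cdiff_cont (cdiff_inv fz) e0.
have [d2 d20 H2] := F _ dl0; exists d2 => // w Aw /(H2 w Aw) /H; exact.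
Qed.

Lemma wcont_comp A (B : set C) f g z : (forall w, A w -> B (g w)) -> wcont A g z ->
  wcont B f (g z) -> wcont A (f \o g) z.
Proof.
move=> gB G F e /F[dl dl0 H]; have [d2 d20 H2] := G _ dl0.
by exists d2 => // w Aw /(H2 w Aw) /H; apply; exact: gB.
Qed.

Lemma wcont_psqrt A f z : (forall w, A w -> 0 < Re (f w)) -> A z -> wcont A f z ->
  wcont A (fun w => psqrt (f w)) z.
Proof.
move=> fp Az F e e0; have p0 := psqrt_Re (fp z Az).
have [dl dl0 H] := F _ (mulr_gt0 e0 p0); exists dl => // w Aw /(H w Aw) h.
have := psqrt_close (fp w Aw) (fp z Az) => A1.
by have := le_lt_trans A1 h; rewrite ltr_pM2r.
Qed.

Lemma wcont_scale A (k : C) z : wcont A (fun w => k * w) z.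
Proof.
move=> e e0; have k0 : 0 < cabs k + 1 by have := cabs_ge0 k; lra.
exists (e / (cabs k + 1)); first by rewrite divr_gt0.
move=> w _; rewrite ltr_pdivlMr// => h; rewrite -mulrBr cabsM.
by have := cabs_ge0 (w - z); lra.
Qed.

(* The root along each ray is the telescoping product of principal roots of
   ratios of consecutive values, which are close to 1. *)
Lemma sqrt_star Q F r w0 : 0 < r ->
  (forall z, Q z -> cabs z <= r) ->
  (forall z, ~ Q z -> exists2 dl : R, 0 < dl & forall w, cabs (w - z) < dl -> ~ Q w) ->
  (forall z t, Q z -> 0 <= t <= 1 -> Q (t%:C * z)) ->
  Q 0 -> (forall z, Q z -> wcont Q F z) -> (forall z, Q z -> F z != 0) ->
  w0 ^+ 2 = F 0 ->
  exists S, [/\ forall z, Q z -> wcont Q S z, forall z, Q z -> S z ^+ 2 = F z & S 0 = w0].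
Proof.
move=> r0 Qr Qc Qs Q0 Fc F0 w0F.
pose good z e := Q z -> forall w, Q w -> cabs (w - z) < e -> cabs (F w - F z) < cabs (F z).
have [||om om0 H] := @disc_uniform _ good 0 r r0.
- by move=> z e e' e0 ee g Qz w Qw wz; apply: g => //; lra.
- move=> z0 _; have [Qz|/Qc[dl dl0 H]] := pselect (Q z0); last first.
    by exists dl => // z _ /H nQ /nQ.
  have e0 : 0 < cabs (F z0) / 4 by rewrite divr_gt0// cabs_gt0 F0.
  have [dl dl0 H] := Fc _ Qz _ e0; exists (dl / 2); first by lra.
  move=> z _ zz Qz1 w Qw wz.
  have A1 := H z Qz1 ltac:(lra).
  have A2 := H w Qw ltac:(have := cabs_tri z w z0; lra).
  have A3 := cabs_tri (F z0) (F w) (F z); have A4 := cabs_trile (F z0) (F z).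
  by rewrite (cabsC (F z0) (F z)) in A3 A4; lra.
have [n hn] : exists n : nat, r / om < n%:R.
  by eexists; apply: archi_boundP; rewrite divr_ge0 ?ltW.
have n0 : 0 < n%:R :> R by apply: le_lt_trans hn; rewrite divr_ge0 ?ltW.
have nC : n%:R != 0 :> C by rewrite pnatr_eq0 -(@pnatr_eq0 R) lt0r_neq0.
pose p (k : nat) : C := (k%:R / n%:R : R)%:C.
have pQ (k : nat) z : (k <= n)%N -> Q z -> Q (p k * z).
  move=> kn Qz; apply: Qs => //; apply/andP; split; first by rewrite divr_ge0.
  by rewrite ler_pdivrMr// mul1r ler_nat.
suff /(_ n (leqnn n))[S [S1 S2 S3]] : forall k : nat, (k <= n)%N ->
    exists S, [/\ forall z, Q z -> wcont Q S z,
      forall z, Q z -> S z ^+ 2 = F (p k * z) & S 0 = w0].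
  exists S; split => // z Qz; rewrite S2// /p divff ?lt0r_neq0//.
  by rewrite rmorph1 mul1r.
elim=> [|k IH] kn.
  exists (fun=> w0); split=> // [z _ e e0|z _].
    by exists 1 => // w _ _; rewrite subrr cabs0.
  by rewrite /p mul0r rmorph0 mul0r.
have [S [S1 S2 S3]] := IH (ltnW kn).
have near z : Q z -> cabs (F (p k.+1 * z) - F (p k * z)) < cabs (F (p k * z)).
  move=> Qz; have Q1 := pQ k z (ltnW kn) Qz; have Q2 := pQ k.+1 z kn Qz.
  apply: (H (p k * z)) => //; first by rewrite subr0; exact: Qr.
  rewrite (_ : p k.+1 * z - p k * z = (n%:R^-1 : R)%:C * z); last first.
    by rewrite /p -(natr1 k) mulrDl mul1r rmorphD /=; ring.
  rewrite cabsM cabsR ger0_norm.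
    apply: le_lt_trans (_ : _ <= n%:R^-1 * r) _.
      by apply: ler_wpM2l; [rewrite invr_ge0 ltW|exact: Qr].
    by rewrite mulrC ltr_pdivrMr// mulrC -ltr_pdivrMr.
  by rewrite invr_ge0 ltW.
pose u z := F (p k.+1 * z) / F (p k * z).
have up z : Q z -> 0 < Re (u z).
  by move=> Qz; have [_ h] := ratio_near1 (near z Qz); exact: Re_gt0_near1.
exists (fun z => S z * psqrt (u z)); split=> [z Qz|z Qz|].
- apply: wcontM; first exact: S1.
  apply: wcont_psqrt => //; apply: wcontM.
    apply: (@wcont_comp Q Q F (fun w => p k.+1 * w)) => [w| |]; first exact: pQ.
      exact: wcont_scale.
    by apply/Fc/pQ.
  apply: wcontV; first by apply/F0/pQ => //; exact: ltnW.
  apply: (@wcont_comp Q Q F (fun w => p k * w)) => [w| |]; first exact/pQ/ltnW.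
    exact: wcont_scale.
  by apply/Fc/pQ => //; exact: ltnW.
- rewrite exprMn S2// psqrt_sqr /u mulrC divfK//.
  by apply/F0/pQ => //; exact: ltnW.
- by rewrite S3 /u !mulr0 divff ?F0// psqrt1 mulr1.
Qed.

Lemma interval_clopen (P : R -> Prop) : P 0 ->
  (forall t, 0 <= t <= 1 -> exists2 dl : R, 0 < dl &
     forall t', 0 <= t' <= 1 -> `|t' - t| < dl -> P t' <-> P t) ->
  forall t, 0 <= t <= 1 -> P t.
Proof.
move=> P0 loc; pose S := [set t : R | 0 <= t <= 1 /\ forall t', 0 <= t' <= t -> P t'].
have S0 : S 0.
  by split=> [|t' ht]; [lra|rewrite (_ : t' = 0)//; lra].
have Sb : has_ubound S by exists 1 => t [/andP[]].
have s0 : 0 <= sup S by exact: ub_le_sup.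
have s1 : sup S <= 1 by apply: ge_sup; [exists 0|move=> t [/andP[]]].
have [dl dl0 H] := loc (sup S) ltac:(lra).
have [t0 St0 t0s] : exists2 t0, S t0 & sup S - dl < t0.
  by apply: sup_adherent => //; split; [exists 0|].
have t0S : t0 <= sup S by exact: ub_le_sup.
have [/andP[t00 t01] Pt0] := St0.
have Ps : P (sup S).
  by apply/(H t0); [lra|rewrite ltr_norml; lra|apply: Pt0; lra].
have Sm : S (Num.min 1 (sup S + dl / 2)).
  split; first by rewrite le_min ge_min lexx /=; apply/andP; split => //; lra.
  move=> t' /andP[t'0]; rewrite le_min => /andP[t'1 t's].
  have [h|h] := leP t' t0; first by apply: Pt0; lra.
  by apply/(H t'); [lra|rewrite ltr_norml; lra|].
have sE : sup S = 1.
  have := ub_le_sup Sb Sm; rewrite ge_min => /orP[]; lra.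
have E : Num.min 1 (sup S + dl / 2) = 1 by apply/min_idPl; rewrite sE; lra.
by rewrite E in Sm; move=> t ht; apply: Sm.2.
Qed.

Definition pcont (g : R -> C) := forall t, 0 <= t <= 1 -> forall e, 0 < e ->
  exists2 dl : R, 0 < dl & forall t', 0 <= t' <= 1 -> `|t' - t| < dl -> cabs (g t' - g t) < e.

Lemma pcontP (g : R -> C) : {within `[0, 1], continuous g} <-> pcont g.
Proof.
split=> [/within_continuousP H t ht e e0|H].
  have [|dl dl0 D] := H t _ e e0; first by rewrite /= in_itv.
  exists dl => // t' ht' tt; apply: D; first by rewrite /= in_itv.
  by rewrite /ball /= distrC.
apply/within_continuousP => t; rewrite /= in_itv /= => ht e e0.
have [dl dl0 D] := H t ht e e0; exists dl => // t'; rewrite /= in_itv /= => ht'.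
by rewrite /ball /= distrC; exact: D.
Qed.

(** Two roots of the same number agree or differ by [2 * T t], which is bounded away from 0 locally,
    so agreement is locally constant in [t]. *)
Lemma path_sqrt_uniq (S T : R -> C) : pcont S -> pcont T ->
  (forall t, 0 <= t <= 1 -> S t ^+ 2 = T t ^+ 2) ->
  (forall t, 0 <= t <= 1 -> T t != 0) -> S 0 = T 0 ->
  forall t, 0 <= t <= 1 -> S t = T t.
Proof.
move=> Sc Tc ST T0 ST0; apply: interval_clopen => // t ht.
have e0 : 0 < cabs (T t) / 2 by rewrite divr_gt0// cabs_gt0 T0.
have [d1 d10 H1] := Sc t ht _ e0; have [d2 d20 H2] := Tc t ht _ e0.
exists (Num.min d1 d2); first by rewrite lt_min d10.
move=> t' ht'; rewrite lt_min => /andP[/(H1 _ ht') A1 /(H2 _ ht') A2].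
have contra (k : C) : 2 * T t = k -> cabs k < cabs (T t) / 2 + cabs (T t) / 2 -> False.
  by move=> <-; rewrite cabsM cabs2V; have := cabs_ge0 (T t); lra.
have sq x : 0 <= x <= 1 -> S x = T x \/ S x = - T x.
  by move=> /ST /eqP; rewrite eqf_sqr => /orP[]/eqP; [left|right].
split=> E.
  have [//|E'] := sq t ht; exfalso.
  apply: (@contra ((S t' - S t) - (T t' - T t))).
    by rewrite E E'; ring.
  by apply: le_lt_trans (cabsB _ _) _; rewrite ltrD.
have [//|E'] := sq t' ht'; exfalso.
apply: (@contra (- ((S t' - S t) + (T t' - T t)))).
  by rewrite E E'; ring.
by rewrite cabsN; apply: le_lt_trans (cabsD _ _) _; rewrite ltrD.
Qed.

End SquareRoots.

(** * Continuation of square roots along paths *)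

Section Paths.
Context {R : realType}.
Local Notation C := R[i].
Implicit Types (u v z w a b c d h k : C) (f F : C -> C) (g : R -> C) (r M s t : R) (A Q : set C).

Lemma pcont_cst c : pcont (fun=> c).
Proof. by move=> t _ e e0; exists 1 => // t' _ _; rewrite subrr cabs0. Qed.

Lemma pcont_seg a b : pcont (fun t => a + t%:C * b).
Proof.
move=> t _ e e0; have k0 : 0 < cabs b + 1 by have := cabs_ge0 b; lra.
exists (e / (cabs b + 1)); first by rewrite divr_gt0.
move=> t' _; rewrite ltr_pdivlMr// => h.
rewrite (_ : _ - _ = (t' - t)%:C * b); last by rewrite rmorphB /=; ring.
by rewrite cabsM cabsR; have := normr_ge0 (t' - t); lra.
Qed.

Lemma pcont_comp A f g : (forall t, 0 <= t <= 1 -> A (g t)) -> pcont g ->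
  (forall z, A z -> wcont A f z) -> pcont (f \o g).
Proof.
move=> gA gc fc t ht e e0; have [d1 d10 H1] := fc _ (gA t ht) _ e0.
have [d2 d20 H2] := gc t ht _ d10; exists d2 => // t' ht' /(H2 t' ht') /H1; apply.
exact: gA.
Qed.

Lemma pcont_rev g : pcont g -> pcont (fun t => g (1 - t)).
Proof.
move=> gc t ht e e0; have [d1 d10 H1] := gc (1 - t) ltac:(lra) _ e0.
exists d1 => // t' ht' tt; apply: H1; first lra.
by rewrite (_ : 1 - t' - (1 - t) = - (t' - t)) ?normrN//; ring.
Qed.

Definition pconcat (g1 g2 : R -> C) t := if t <= 1 / 2 then g1 (2 * t) else g2 (2 * t - 1).

Lemma pcont_concat (g1 g2 : R -> C) : pcont g1 -> pcont g2 -> g1 1 = g2 0 ->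
  pcont (pconcat g1 g2).
Proof.
move=> c1 c2 g12 t ht e e0; rewrite /pconcat.
have [t2|t2|t2] := ltgtP t (1 / 2).
- have [d1 d10 H1] := c1 (2 * t) ltac:(lra) _ e0.
  exists (Num.min (d1 / 2) (1 / 2 - t)); first by rewrite lt_min; apply/andP; split; lra.
  move=> t' ht'; rewrite lt_min !ltr_norml => /andP[a1 a2].
  by rewrite ifT; [apply: H1; rewrite ?ltr_norml; lra|lra].
- have [d1 d10 H1] := c2 (2 * t - 1) ltac:(lra) _ e0.
  exists (Num.min (d1 / 2) (t - 1 / 2)); first by rewrite lt_min; apply/andP; split; lra.
  move=> t' ht'; rewrite lt_min !ltr_norml => /andP[a1 a2].
  by rewrite ifF; [apply: H1; rewrite ?ltr_norml; lra|apply/negbTE; rewrite -ltNge; lra].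
- have [d1 d10 H1] := c1 1 ltac:(lra) _ e0; have [d2 d20 H2] := c2 0 ltac:(lra) _ e0.
  exists (Num.min (d1 / 2) (d2 / 2)); first by rewrite lt_min; apply/andP; split; lra.
  rewrite t2 (_ : 2 * (1 / 2) = 1); last by field.
  move=> t' ht'; rewrite lt_min !ltr_norml => /andP[a1 a2].
  case: ifPn => [h|]; first by apply: H1; rewrite ?ltr_norml; lra.
  by rewrite -ltNge g12 => h; apply: H2; rewrite ?ltr_norml; lra.
Qed.

Lemma pconcat0 (g1 g2 : R -> C) : pconcat g1 g2 0 = g1 0.
Proof. by rewrite /pconcat ifT ?mulr0//; lra. Qed.

Lemma pconcat1 (g1 g2 : R -> C) : pconcat g1 g2 1 = g2 1.
Proof.
rewrite /pconcat ifF; last by apply/negbTE; rewrite -ltNge; lra.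
by congr g2; ring.
Qed.

Lemma ccont_wcont A f z : ccont f z -> wcont A f z.
Proof. by move=> H e /H[dl dl0 D]; exists dl => // w _ /D. Qed.

Section Reach.
Variables (A : set C) (f : C -> C) (z0 w0 : C).
Hypothesis f_cont : forall z, A z -> ccont f z.
Hypothesis f_neq0 : forall z, A z -> f z != 0.
Hypothesis w0_sqr : w0 ^+ 2 = f z0.

(* (z, w) is the end point of a path in the Riemann surface of the square root
   of f, starting from (z0, w0). *)
Definition reach z w := exists g, exists sg : R -> C,
  [/\ pcont g, pcont sg, g 0 = z0 /\ sg 0 = w0, g 1 = z /\ sg 1 = w &
    forall t, 0 <= t <= 1 -> A (g t) /\ sg t ^+ 2 = f (g t)].

Lemma reach_sqr z w : reach z w -> A z /\ w ^+ 2 = f z.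
Proof. by move=> [g [sg [_ _ _ [<- <-]]]]; apply; lra. Qed.

Lemma reach0 : A z0 -> reach z0 w0.
Proof.
by move=> A0; exists (fun=> z0), (fun=> w0); split => //; exact: pcont_cst.
Qed.

Lemma reach_seg z w z' : reach z w ->
  (forall t, 0 <= t <= 1 -> A (z + t%:C * (z' - z)) /\
     cabs (f (z + t%:C * (z' - z)) - f z) < cabs (f z)) ->
  reach z' (w * psqrt (f z' / f z)).
Proof.
move=> rzw seg; have [Az wz] := reach_sqr rzw.
have fz : f z != 0 := f_neq0 Az.
pose B := [set x : C | A x /\ cabs (f x - f z) < cabs (f z)].
pose S x := w * psqrt (f x / f z).
have Sc x : B x -> wcont B S x.
  move=> Bx; apply: wcontM; first by apply: ccont_wcont; exact: cdiff_cont (cdiff_cst _ _).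
  apply: wcont_psqrt => // [y [_ /ratio_near1[_ h]]|]; first exact: Re_gt0_near1.
  apply: wcontM; first by apply/ccont_wcont/f_cont; case: Bx.
  by apply: ccont_wcont; exact: cdiff_cont (cdiff_cst _ _).
have [g [sg [gc sgc [g0 sg0] [g1 sg1] H]]] := rzw.
pose l t := z + t%:C * (z' - z).
have l0 : l 0 = z by rewrite /l rmorph0 mul0r addr0.
have l1 : l 1 = z' by rewrite /l rmorph1 mul1r addBK.
have S0 : S (l 0) = w by rewrite l0 /S divff// psqrt1 mulr1.
exists (pconcat g l), (pconcat sg (S \o l)); split.
- by apply: pcont_concat => //; [exact: pcont_seg|rewrite g1].
- apply: pcont_concat => //; last by rewrite sg1 /= S0.
  by apply: (@pcont_comp B) => //; exact: pcont_seg.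
- by rewrite !pconcat0.
- by rewrite !pconcat1 /= l1.
- move=> t ht; rewrite /pconcat; case: ifPn => [h|]; first by apply: H; lra.
  rewrite -ltNge => h; have [A1 _] := seg (2 * t - 1) ltac:(lra).
  split; first exact: A1.
  by rewrite /= /S exprMn psqrt_sqr wz mulrC divfK.
Qed.

(** Monodromy. If [w = - w'], one path followed by the reverse of the other is a loop [L], and the
    roots along it, negated on the second half so as to fit together, form a path [T] from [w0] to
    [- w0]. Along a null homotopy of [L] the function [f] has a continuous root on the unit square
    by [sqrt_star]. That root follows [T] on the side carrying [L] and is constant on the other
    three, where the homotopy rests at the base point; going round the square gives [w0 = - w0]. *)
Lemma reach_uniq z w w' : simply_connected A -> reach z w -> reach z w' -> w = w'.
Proof.
move=> [_ sc] rw rw'.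
have [Az wz] := reach_sqr rw; have [_ wz'] := reach_sqr rw'.
have [//|/eqP wE] : w = w' \/ w == - w'.
  by move/eqP: wz; rewrite -wz' eqf_sqr => /orP[/eqP|]; [left|right].
exfalso.
have [g [sg [gc sgc [g0 sg0] [g1 sg1] H]]] := rw.
have [g' [sg' [gc' sgc' [g0' sg0'] [g1' sg1'] H']]] := rw'.
pose L := pconcat g (fun t => g' (1 - t)).
pose T := pconcat sg (fun t => - sg' (1 - t)).
have Lc : pcont L.
  by apply: pcont_concat => //; [exact: pcont_rev|rewrite subr0 g1 g1'].
have Tc : pcont T.
  apply: pcont_concat => //; last by rewrite subr0 sg1 sg1'.
  move=> t ht e e0; have [dl dl0 D] := pcont_rev sgc' ht e0.
  by exists dl => // t' ht' /(D t' ht'); rewrite -opprD cabsN.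
have LT t : 0 <= t <= 1 -> A (L t) /\ T t ^+ 2 = f (L t).
  move=> ht; rewrite /L /T /pconcat; case: ifPn => [h|].
    by apply: H; lra.
  by rewrite -ltNge sqrrN => h; apply: H'; lra.
have L0 : L 0 = z0 by rewrite /L pconcat0.
have L1 : L 1 = z0 by rewrite /L pconcat1 subrr.
have T0 : T 0 = w0 by rewrite /T pconcat0.
have T1 : T 1 = - w0 by rewrite /T pconcat1 subrr sg0'.
have A0 : A z0 by rewrite -L0; apply: (LT 0 _).1; lra.
have w00 : w0 != 0 by have := f_neq0 A0; rewrite -w0_sqr sqrf_eq0.
have [Hm [Hc HA Hs He]] := sc L ((pcontP L).2 Lc) (fun t ht => (LT t ht).1) (etrans L0 (esym L1)).
pose Q := [set x : C | 0 <= Re x <= 1 /\ 0 <= Im x <= 1].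
pose F x := f (Hm (Re x, Im x)).
have ReB (x y : C) : Re (x - y) = Re x - Re y by case: x y => a b [].
have ImB (x y : C) : Im (x - y) = Im x - Im y by case: x y => a b [].
have Fc x : Q x -> wcont Q F x.
  move=> [rx ix] e e0; have [d1 d10 H1] := f_cont (HA _ _ rx ix) e0.
  move/within_continuousP: Hc => /(_ (Re x, Im x)).
  rewrite /= !in_itv /= => /(_ (conj rx ix) _ d10)[d2 d20 H2].
  exists d2 => // y [ry iy] xy; apply/H1/H2.
    by rewrite /= !in_itv.
  split; rewrite /ball /= distrC -?ReB -?ImB.
    exact: le_lt_trans (cabs_Re _) xy.
  exact: le_lt_trans (cabs_Im _) xy.
have F0 x : Q x -> F x != 0 by move=> [rx ix]; apply/f_neq0/HA.
have F00 : F 0 = f z0 by rewrite /F /= (Hs 0 _).1 ?L0//; lra.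
have [|||||S [S1 S2 S3]] := @sqrt_star _ Q F 2 w0 _ _ _ _ _ Fc F0 (etrans w0_sqr (esym F00)).
- by [].
- move=> x [rx ix]; apply: le_trans (cabs_ReIm _) _.
  by rewrite !ger0_norm; lra.
- move=> x nQ.
  have far (p : C -> R) : (forall y, `|p y - p x| <= cabs (y - x)) ->
     ~ (0 <= p x <= 1) -> exists2 dl : R, 0 < dl & forall y, cabs (y - x) < dl -> ~ (0 <= p y <= 1).
    move=> hp /negP; rewrite negb_and -!ltNge => /orP[] h.
      exists (- p x) => [|y yx]; first lra.
      by have := le_lt_trans (hp y) yx; rewrite ltr_norml; lra.
    exists (p x - 1) => [|y yx]; first lra.
    by have := le_lt_trans (hp y) yx; rewrite ltr_norml; lra.
  have [rx|rx] := pselect (0 <= Re x <= 1); last first.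
    have [y|dl dl0 D] := far (fun y => Re y) _ rx; first by rewrite -ReB; exact: cabs_Re.
    by exists dl => // y /D h [].
  have ix : ~ (0 <= Im x <= 1) by move=> ix; apply: nQ.
  have [y|dl dl0 D] := far (fun y => Im y) _ ix; first by rewrite -ImB; exact: cabs_Im.
  by exists dl => // y /D h [].
- move=> x t [rx ix] ht; split; case: x rx ix => a b /= rx ix; rewrite mul0r ?subr0 ?addr0; nra.
- by split => /=; lra.
have side (a b : C) (T' : R -> C) : pcont T' -> (forall t, 0 <= t <= 1 -> Q (a + t%:C * b)) ->
    (forall t, 0 <= t <= 1 -> T' t ^+ 2 = F (a + t%:C * b)) -> S a = T' 0 ->
    S (a + b) = T' 1.
  move=> T'c Qab T'F Sa.
  have := @path_sqrt_uniq _ (fun t => S (a + t%:C * b)) T' _ T'c _ _ _ 1 ltac:(lra).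
  rewrite rmorph1 mul1r; apply.
  - by apply: (@pcont_comp Q S) => //; exact: pcont_seg.
  - by move=> t ht; rewrite T'F// S2//; exact: Qab.
  - by move=> t ht; rewrite -sqrf_eq0 T'F// F0//; exact: Qab.
  - by rewrite rmorph0 mul0r addr0.
have w0c : pcont (fun=> w0) := pcont_cst w0.
have w0c' : pcont (fun=> - w0) := pcont_cst (- w0).
have unit01 : 0 <= (0 : R) <= 1 /\ 0 <= (1 : R) <= 1 by lra.
pose i : C := 0 +i* 1.
have E1 t : 0 + t%:C * i = 0 +i* t.
  by rewrite /i; apply/eqP; rewrite eq_complex /=; apply/andP; split; apply/eqP; ring.
have E2 t : i + t%:C * 1 = t +i* 1.
  by rewrite /i; apply/eqP; rewrite eq_complex /=; apply/andP; split; apply/eqP; ring.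
have E3 t : 0 + t%:C * 1 = t +i* 0.
  by apply/eqP; rewrite eq_complex /=; apply/andP; split; apply/eqP; ring.
have E4 t : 1 + t%:C * i = 1 +i* t.
  by rewrite /i; apply/eqP; rewrite eq_complex /=; apply/andP; split; apply/eqP; ring.
have Si : S (0 + i) = - w0.
  rewrite -T1; apply: side => // [t ht|t ht|]; last by rewrite T0.
    by rewrite E1; split => /=; lra.
  by rewrite E1 /F /= (Hs t ht).1; apply: (LT t ht).2.
rewrite add0r in Si.
have S1i : S (i + 1) = - w0.
  apply: (side _ _ (fun=> - w0)) => // t ht; first by rewrite E2; split => /=; lra.
  by rewrite E2 /F /= (He t ht).2 L0 sqrrN.
have S10 : S (0 + 1) = w0.
  apply: (side _ _ (fun=> w0)) => // t ht; first by rewrite E3; split => /=; lra.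
  by rewrite E3 /F /= (He t ht).1 L0.
rewrite add0r in S10.
have S1i' : S (1 + i) = w0.
  apply: (side _ _ (fun=> w0)) => // t ht; first by rewrite E4; split => /=; lra.
  by rewrite E4 /F /= (Hs t ht).2 L0.
have wN : - w0 = w0 by rewrite -S1i addrC.
have : 2 * w0 = 0 by rewrite (_ : 2 * w0 = w0 - - w0); [rewrite wN subrr|ring].
by move/eqP; rewrite mulf_eq0 (negbTE w00) orbF pnatr_eq0.
Qed.

End Reach.

(** The points to which the root can be continued form a relatively open and closed set.
    [reach_uniq] makes the continued value a function, and locally it coincides with continuation
    along segments, hence is continuous. *)
Lemma sqrt_simply_connected A f : domain A -> simply_connected A ->
  (forall z, A z -> ccont f z) -> (forall z, A z -> f z != 0) ->
  exists S, forall z, A z -> ccont S z /\ S z ^+ 2 = f z.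
Proof.
move=> [[z0 A0] oA cA] scA fc f0; pose w0 := sqrtc (f z0).
have w0E : w0 ^+ 2 = f z0 by exact: sqr_sqrtc.
(* With a third, any two values on the disc differ by less than [2 / 3 * |f z|], which is less than
   the modulus of either, so [reach_seg] can start from any point of the disc. *)
have nb z : A z -> exists2 r : R, 0 < r & forall w, cabs (w - z) < r ->
    A w /\ cabs (f w - f z) < cabs (f z) / 3.
  move=> Az; have [r1 r10 H1] := (open_cabsP A).1 oA z Az.
  have e0 : 0 < cabs (f z) / 3 by rewrite divr_gt0// cabs_gt0 f0.
  have [r2 r20 H2] := fc z Az _ e0.
  exists (Num.min r1 r2); first by rewrite lt_min r10.
  by move=> w; rewrite lt_min => /andP[/H1 ? /H2 ?].
have segr z a b r t : cabs (a - z) < r -> cabs (b - z) < r -> 0 <= t <= 1 ->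
    cabs (a + t%:C * (b - a) - z) < r.
  move=> az bz ht; rewrite (_ : _ - z = (1 - t)%:C * (a - z) + t%:C * (b - z)).
    apply: le_lt_trans (cabsD _ _) _; rewrite !cabsM !cabsR !ger0_norm; try lra.
    have [m [ma mb mr]] : exists m, [/\ cabs (a - z) <= m, cabs (b - z) <= m & m < r].
      by exists (Num.max (cabs (a - z)) (cabs (b - z))); rewrite !le_max !lexx orbT gt_max az bz.
    by have := cabs_ge0 (a - z); nra.
  by rewrite rmorphB rmorph1 /=; ring.
have ext z r w a b : (forall w, cabs (w - z) < r -> A w /\ cabs (f w - f z) < cabs (f z) / 3) ->
   cabs (a - z) < r -> cabs (b - z) < r -> reach A f z0 w0 a w ->
   reach A f z0 w0 b (w * psqrt (f b / f a)).
  move=> H az bz ra; apply: reach_seg => // t ht.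
  have [A1 h1] := H _ (segr z a b r t az bz ht).
  split=> //; have [_ h2] := H a az.
  have := cabs_tri (f z) (f (a + t%:C * (b - a))) (f a).
  by have := cabs_trile (f z) (f a); rewrite (cabsC (f z) (f a)); lra.
have all z : A z -> exists w, reach A f z0 w0 z w.
  apply: (@connected_clopen _ A [set z | exists w, reach A f z0 w0 z w]) => //.
  - by move=> {}z [w /reach_sqr[]].
  - by exists z0, w0; exact: reach0.
  - move=> {}z [w rw]; have [Az _] := reach_sqr rw; have [r r0 H] := nb z Az.
    exists r => // b bz _; exists (w * psqrt (f b / f z)).
    by apply: (ext z r) => //; rewrite subrr cabs0.
  - move=> {}z Az nr; have [r r0 H] := nb z Az; exists r => // a az [w rw].
    apply: nr; exists (w * psqrt (f z / f a)).
    by apply: (ext z r) => //; rewrite subrr cabs0.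
pose S z := xget 0 [set w | reach A f z0 w0 z w].
have Sr z : A z -> reach A f z0 w0 z (S z).
  by move=> /all[w rw]; rewrite /S; case: xgetP => [//|/(_ w)/(_ rw)].
exists S => z Az; have [_ Sz] := reach_sqr (Sr z Az); split=> // e e0.
have fz0 : 0 < cabs (f z) by rewrite cabs_gt0 f0.
have fzn : f z != 0 by exact: f0.
have [r r0 H] := nb z Az.
have k0 : 0 < cabs (S z) + 1 by have := cabs_ge0 (S z); lra.
have e1 : 0 < e / (cabs (S z) + 1) * cabs (f z) by rewrite mulr_gt0// divr_gt0.
have [d1 d10 H1] := fc z Az _ e1.
exists (Num.min r d1); first by rewrite lt_min r0.
move=> w; rewrite lt_min => /andP[wr /H1 wd].
have [Aw fw] := H w wr.
have -> : S w = S z * psqrt (f w / f z).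
  apply: (reach_uniq fc f0 w0E scA (Sr w Aw)).
  by apply: (ext z r) => //; [rewrite subrr cabs0|exact: Sr].
have [_ u1] : f z != 0 /\ cabs (f w / f z - 1) < 1 by apply: ratio_near1; lra.
rewrite (_ : _ - S z = S z * (psqrt (f w / f z) - 1)); last by ring.
rewrite cabsM; have A1 := psqrt_near1 u1.
have A2 : cabs (f w / f z - 1) < e / (cabs (S z) + 1).
  rewrite (_ : f w / f z - 1 = (f w - f z) / f z); last by field.
  by rewrite cabsM cabsV ltr_pdivrMr.
rewrite ltr_pdivlMr// in A2.
have := cabs_ge0 (S z); have := cabs_ge0 (psqrt (f w / f z) - 1); nra.
Qed.

Lemma chol_sqrt f (S : C -> C) z r : 0 < r -> f z != 0 -> chol f z -> ccont S z ->
  (forall w, cabs (w - z) < r -> S w ^+ 2 = f w) -> chol S z.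
Proof.
move=> r0 fz0 [d fd] Sc SE.
have Sz : S z ^+ 2 = f z by apply: SE; rewrite subrr cabs0.
have Sz0 : S z != 0 by rewrite -sqrf_eq0 Sz.
have s0 : 0 < cabs (S z) by rewrite cabs_gt0.
set m := cabs (S z) in s0.
exists (d / (2 * S z)) => e e0.
have e1 : 0 < e / 2 * m by rewrite mulr_gt0// divr_gt0.
have [d1 d10 H1] := fd _ e1.
have k0 : 0 < cabs d + 1 by have := cabs_ge0 d; lra.
pose e2 := Num.min m (e * m ^+ 2 / (cabs d + 1)).
have e20 : 0 < e2 by rewrite lt_min s0 divr_gt0// mulr_gt0// exprn_gt0.
have [d2 d20 H2] := Sc _ e20.
exists (Num.min r (Num.min d1 d2)); first by rewrite !lt_min r0 d10.
move=> h; rewrite !lt_min => /andP[hr /andP[/H1 A1 h2]].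
have := H2 (z + h); rewrite addKB lt_min => /(_ h2)/andP[a1 a2].
have E := SE (z + h); rewrite addKB in E; have {}E := E hr.
set T := S (z + h) in a1 a2 E *.
have Tm : m <= cabs (T + S z).
  have := cabs_trile (2 * S z) (T + S z).
  rewrite (_ : 2 * S z - (T + S z) = - (T - S z)); last by ring.
  rewrite cabsN cabsM cabs2V -/m; lra.
have TS0 : T + S z != 0 by rewrite -cabs_gt0; lra.
have -> : T - S z - d / (2 * S z) * h =
  (f (z + h) - f z - d * h) / (T + S z) - d * h * ((T - S z) / (2 * S z * (T + S z))).
  rewrite -E -Sz; field; rewrite ?mulf_neq0 ?TS0 ?Sz0//.
apply: le_trans (cabsB _ _) _; rewrite !cabsM !cabsV !cabsM cabs2V -/m.
have B1 : cabs (f (z + h) - f z - d * h) / cabs (T + S z) <= e / 2 * cabs h.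
  rewrite ler_pdivrMr; last lra.
  apply: le_trans A1 _; rewrite mulrAC; apply: ler_wpM2l => //.
  by rewrite mulr_ge0 ?cabs_ge0//; lra.
have B2 : cabs d * cabs h * (cabs (T - S z) / (2 * m * cabs (T + S z))) <= e / 2 * cabs h.
  rewrite mulrAC; apply: ler_wpM2r; first exact: cabs_ge0.
  rewrite mulrA ler_pdivrMr; last by rewrite !mulr_gt0//; lra.
  rewrite ltr_pdivlMr// in a2.
  apply: (@le_trans _ _ (e * m ^+ 2)).
    by have := cabs_ge0 (T - S z); lra.
  rewrite (_ : e / 2 * _ = e * m * cabs (T + S z)); last by field.
  by rewrite expr2 mulrA; apply: ler_wpM2l => //; rewrite mulr_ge0 ?ltW.
lra.
Qed.

End Paths.

(** * The Riemann mapping theorem *)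

Section LowerBound.
Context {R : realType}.
Local Notation C := R[i].
Implicit Types (u v z w a b c d h k : C) (f K : C -> C) (r M s t ta : R) (A Q : set C).

Lemma schwarz_pick f : (forall z, cabs z < 1 -> chol f z /\ cabs (f z) <= 1) ->
  forall z, cabs z < 1 -> cabs (f z - f 0) <= cabs z * cabs (1 - conjc (f 0) * f z).
Proof.
move=> fh z z1; have [->|z0] := eqVneq z 0; first by rewrite subrr cabs0 mul0r.
have f01 : cabs (f 0) <= 1 by apply: (fh 0 _).2; rewrite cabs0.
have [d /cdiff_lip[dl dl0 H]] : chol f 0 by apply: (fh 0 _).1; rewrite cabs0.
apply: (@schwarz_pick_except _ f (f 0) (cabs d + 1)) => // [w w1 _|]; first exact: fh.
by exists dl => // w _ /H; rewrite add0r.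
Qed.

(** The closed disc is star-shaped, so each root comes directly from [sqrt_star]. *)
Lemma iterated_sqrt f (m : nat) : (forall z, cabs z <= 1 -> wcont [set z | cabs z <= 1] f z) ->
  (forall z, cabs z < 1 -> chol f z) -> (forall z, cabs z <= 1 -> f z != 0) ->
  exists v : C -> C, [/\ forall z, cabs z <= 1 -> wcont [set z | cabs z <= 1] v z,
    forall z, cabs z < 1 -> chol v z & forall z, cabs z <= 1 -> v z ^+ (2 ^ m) = f z].
Proof.
move=> fc fh f0; elim: m => [|m [v [vc vh vE]]]; first by exists f; split.
have v0 z : cabs z <= 1 -> v z != 0.
  by move=> z1; have := f0 z z1; rewrite -vE// expf_eq0 expn_gt0.
have [|||S [S1 S2 _]] := @sqrt_star _ [set z | cabs z <= 1] v 1 (sqrtc (v 0)) ltr01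
   (fun z hz => hz) _ _ _ vc v0 (sqr_sqrtc _).
- move=> z /negP; rewrite -ltNge => z1; exists (cabs z - 1); first lra.
  by move=> w wz /= w1; have := cabs_trile z w; rewrite (cabsC z); lra.
- move=> z t /= z1 ht; rewrite cabsM cabsR ger0_norm; last lra.
  by have := cabs_ge0 z; nra.
- by have : cabs (0 : C) <= 1 by rewrite cabs0.
- exists S; split=> // [z z1|z z1].
  + apply: (@chol_sqrt _ v S z (1 - cabs z)); [lra|by apply: v0; lra|exact: vh| |].
      move=> e e0; have [dl dl0 H] := S1 z ltac:(rewrite /=; lra) e e0.
      exists (Num.min dl (1 - cabs z)); first by rewrite lt_min dl0; lra.
      move=> w; rewrite lt_min => /andP[wd wz]; apply: H => //=.
      by have := cabs_trile w z; lra.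
    by move=> w wz; apply: S2; rewrite /=; have := cabs_trile w z; lra.
  + by rewrite expnS exprM S2// vE.
Qed.

(* Schwarz-Pick applied to the 2^m-th root; a substitute for Harnack's
   inequality for -log |f|. *)
Lemma root_lower_bound f (m : nat) (p : R) :
  (forall z, cabs z <= 1 -> wcont [set z | cabs z <= 1] f z) ->
  (forall z, cabs z < 1 -> chol f z) ->
  (forall z, cabs z <= 1 -> f z != 0 /\ cabs (f z) <= 1) ->
  0 <= p < 1 -> ((1 + p) / 2) ^+ (2 ^ m) <= cabs (f 0) ->
  forall w, cabs w <= p -> ((1 - p) / 4) ^+ (2 ^ m) <= cabs (f w).
Proof.
move=> fc fh f01 /andP[p0 p1] hf w wp.
have [v [vc vh vE]] := iterated_sqrt m fc fh (fun z hz => (f01 z hz).1).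
have N0 : (0 < 2 ^ m)%N by rewrite expn_gt0.
have v1 z : cabs z <= 1 -> cabs (v z) <= 1.
  move=> z1; have := (f01 z z1).2; rewrite -vE// cabsX.
  by rewrite expr_le1// cabs_ge0.
have w1 : cabs w <= 1 by lra.
rewrite -vE// cabsX; apply: lerXn2r; rewrite ?nnegrE ?cabs_ge0//; first lra.
have z01 : cabs (0 : C) <= 1 by rewrite cabs0.
rewrite -vE// cabsX in hf.
have hv : (1 + p) / 2 <= cabs (v 0).
  by move: hf; rewrite ler_pXn2r// nnegrE ?cabs_ge0//; lra.
have := @schwarz_pick v _ w ltac:(lra).
move=> /(_ (fun z hz => conj (vh z hz) (v1 z (ltW hz)))) A.
have B : cabs (1 - conjc (v 0) * v w) <= 1 + cabs (v w).
  apply: le_trans (cabsB _ _) _; rewrite cabs1 cabsM cabsJ lerD2l.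
  by rewrite ler_piMl ?cabs_ge0// v1.
have := cabs_trile (v 0) (v w); rewrite (cabsC (v 0)).
have D : cabs w * cabs (1 - conjc (v 0) * v w) <= p * (1 + cabs (v w)).
  by apply: ler_pM; rewrite ?cabs_ge0.
have := cabs_ge0 (v w); nra.
Qed.

(** Rescaling the variable by [1 - ta / 2] gives a function on the closed disc, to which
    [root_lower_bound] applies with [p = 1 - ta / 2]; the radius fits because
    [1 - ta <= (1 - ta / 2) ^ 2]. *)
Lemma avoid_lower_bound f M ta (m : nat) : 0 < ta < 1 ->
  (forall z, cabs z < 1 -> [/\ chol f z, f z != 0 & cabs (f z) <= M]) ->
  (1 - ta / 4) ^+ (2 ^ m) <= cabs (f 0) / M ->
  forall w, cabs w <= 1 - ta -> M * (ta / 8) ^+ (2 ^ m) <= cabs (f w).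
Proof.
move=> /andP[t0 t1] fh hf w wt.
have [_ f00 f0M] := fh 0 ltac:(by rewrite cabs0).
have M0 : 0 < M by apply: lt_le_trans f0M; rewrite cabs_gt0.
pose t := 1 - ta / 2; have tp : 0 < t by rewrite /t; lra.
have tn : cabs (t%:C : C) = t by rewrite cabsR gtr0_norm.
have tC : t%:C != 0 :> C by rewrite -cabs_gt0 tn.
have Mn : cabs (M%:C : C) = M by rewrite cabsR gtr0_norm.
have MC : M%:C != 0 :> C by rewrite -cabs_gt0 Mn.
have tz z : cabs z <= 1 -> cabs (t%:C * z) < 1.
  by move=> z1; rewrite cabsM tn; have := cabs_ge0 z; rewrite /t; nra.
pose g z := f (t%:C * z) / M%:C.
have gh z : cabs z <= 1 -> chol g z.
  move=> z1; apply: cholM; last exact: chol_cst.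
  apply: (@chol_comp _ (fun z => t%:C * z)); last by have [] := fh _ (tz z z1).
  by apply: cholM (chol_cst _ _) (chol_id _).
rewrite mulrC -ler_pdivlMr//.
have := @root_lower_bound g m (1 - ta / 2) _ _ _ _ _ (w / t%:C).
rewrite /g (_ : t%:C * (w / t%:C) = w); last by field.
rewrite mulr0 !cabsM !cabsV Mn tn.
rewrite (_ : (1 - (1 - ta / 2)) / 4 = ta / 8); last by field.
rewrite (_ : (1 + (1 - ta / 2)) / 2 = 1 - ta / 4); last by field.
apply=> //.
- by move=> z /gh/chol_cont/ccont_wcont.
- by move=> z z1; apply: gh; lra.
- move=> z z1; have [_ A1 A2] := fh _ (tz z z1).
  by rewrite mulf_neq0 ?invr_eq0// cabsM cabsV Mn ler_pdivrMr// mul1r.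
- lra.
- by rewrite ler_pdivrMr// /t; nra.
Qed.

End LowerBound.

(** * One step of the Koebe iteration *)

Section KoebeStep.
Context {R : realType}.
Local Notation C := R[i].
Implicit Types (u v z w a b c d h k : C) (f K : C -> C) (r M s t : R) (A Q : set C).

(** If [f] omits [b] in the disc, [mob b (f z)] is zero-free and has a root [S]; the new map is [S]
    moved back to 0 at [z0] and rotated. Undoing this gives [K], a squaring between two
    automorphisms, with derivative [k = 2 q / (1 + q ^ 2)] at 0, where [q ^ 2 = |b|]. Since
    [1 - k = (1 - q) ^ 2 / (1 + q ^ 2)], an omitted value far from the circle forces [k] away from
    1. If nothing is omitted, [f] is kept and [K] is the identity. *)
Lemma koebe_step A f z0 : domain A -> simply_connected A -> A z0 ->
  (forall z, A z -> chol f z /\ cabs (f z) < 1) -> f z0 = 0 ->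
  exists f', exists K, exists k : R,
  [/\ forall z, A z -> [/\ chol f' z, cabs (f' z) < 1 & f z = K (f' z)],
      f' z0 = 0 /\ K 0 = 0,
      forall w, cabs w < 1 -> chol K w /\ cabs (K w) < 1,
      cdiff K 0 k%:C /\ 0 < k <= 1
    & forall p : R, p < 1 -> (exists2 b, cabs b < p & forall z, A z -> f z != b) ->
        (1 - p) ^+ 2 <= 32 * (1 - k)].
Proof.
move=> dA scA Az0 fh f00; have oA : open A by case: dA.
pose H := [set x : R | exists b, [/\ x = cabs b, cabs b < 1 & forall z, A z -> f z != b]].
have [[x0 Hx0]|nH] := pselect (H !=set0); last first.
  exists f, id, 1; split=> //.
  - by move=> z /fh[].
  - by move=> w w1; split=> //; exact: chol_id.
  - by rewrite rmorph1; split; [exact: cdiff_id|lra].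
  - move=> p p1 [b bp nb]; exfalso; apply: nH; exists (cabs b), b; split=> //.
    exact: lt_trans bp p1.
have Hinf : has_inf H by split; [exists x0|exists 0 => _ [b [-> _ _]]; exact: cabs_ge0].
have i1 : inf H < 1.
  by have [b [xE b1 _]] := Hx0; apply: le_lt_trans b1; rewrite -xE; apply: ge_inf => //; case: Hinf.
(* With [|b|] less than halfway from the infimum to 1, any omitted [b'] satisfies
   [1 - |b'| <= 2 * (1 - |b|)]. The 32 in the last clause collects this 2, another 2 from
   [1 - q ^ 2 <= 2 * (1 - q)], both squared, and [1 + q ^ 2 <= 2]. *)
have i2 : 0 < (1 - inf H) / 2 by lra.
have [_ [b [-> b1 nb]] bi] := inf_adherent i2 Hinf.
have bP p : (exists2 b', cabs b' < p & forall z, A z -> f z != b') -> p < 1 ->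
    1 - p <= 2 * (1 - cabs b).
  move=> [b' b'p nb'] p1; have : inf H <= cabs b'.
    apply: ge_inf; first by case: Hinf.
    by exists b'; split=> //; exact: lt_trans b'p p1.
  lra.
have b0 : b != 0 by rewrite eq_sym -f00 nb.
have fA z : A z -> cabs (f z) <= 1 by move=> /fh[_ /ltW].
pose g z := mob b (f z).
have gh z : A z -> chol g z.
  move=> Az; apply: chol_comp (fh z Az).1 _; apply: chol_mob; apply: mob_den1 => //.
  exact: fA.
have g0 z : A z -> g z != 0.
  move=> Az; rewrite /g /mob mulf_neq0// ?invr_eq0 ?mob_den1 ?fA//.
  by rewrite subr_eq0 eq_sym nb.
have [S SP] := sqrt_simply_connected dA scA (fun z hz => chol_cont (gh z hz)) g0.
have Sh z : A z -> chol S z.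
  move=> Az; have [r r0 rA] := (open_cabsP A).1 oA z Az.
  apply: (@chol_sqrt _ g S z r) => //; [exact: g0|exact: gh|exact: (SP z Az).1|].
  by move=> w /rA /SP[].
have S1 z : A z -> cabs (S z) < 1.
  move=> Az; rewrite -(@expr_lt1 _ 2) ?cabs_ge0// -cabsX (SP z Az).2.
  by apply: cabs_mob_lt => //; exact: (fh z Az).2.
pose be := S z0; have be2 : be ^+ 2 = b by rewrite /be (SP z0 Az0).2 /g f00 mob_b0.
have be1 : cabs be < 1 := S1 z0 Az0.
have be0 : be != 0 by rewrite -sqrf_eq0 be2.
set q := cabs be in be1; have q0 : 0 < q by rewrite cabs_gt0.
have bq : cabs b = q ^+ 2 by rewrite -be2 cabsX.
have den (x : C) : 1 - conjc x * x = (1 - cabs x ^+ 2)%:C.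
  by rewrite cabs2; case: x => x1 x2; apply/eqP; rewrite eq_complex /=; apply/andP; split; apply/eqP; ring.
(* The derivative at 0 of [K] before the rotation [c = k / D0]. The rotation makes it real and
   positive, so derivatives of compositions multiply as positive reals. *)
pose D0 : C := (conjc b * b - 1) / (1 - conjc b * b) ^+ 2 * (2 * be * (conjc be * be - 1)).
have D0E : D0 = (2 * (1 - q ^+ 2) / (1 - q ^+ 4))%:C * be.
  have nz : (1 - q ^+ 4)%:C != 0 :> C.
    rewrite -cabs_gt0 cabsR normr_gt0 subr_eq0 eq_sym lt_eqF//.
    by rewrite exprn_ilt1 ?ltW.
  rewrite /D0 -[conjc b * b - 1]opprB -[conjc be * be - 1]opprB !den bq -/q.
  rewrite -exprM (_ : (2 * 2)%N = 4%N)// rmorphM fmorphV rmorphM rmorphMn rmorph1 /=.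
  by move: nz; move: ((1 - q ^+ 4)%:C) => x4 nz; field.
pose k : R := 2 * q / (1 + q ^+ 2).
have q2 : 0 < 1 + q ^+ 2 by rewrite ltr_wpDr ?sqr_ge0.
have D0k : cabs D0 = k.
  have q21 : 0 < 1 - q ^+ 2 by rewrite subr_gt0 expr_lt1 ?ltW.
  have q4 : 1 - q ^+ 4 = (1 - q ^+ 2) * (1 + q ^+ 2) by ring.
  rewrite D0E cabsM cabsR q4 ger0_norm -/q; first by rewrite /k; field; rewrite !lt0r_neq0.
  by rewrite divr_ge0 ?mulr_ge0 ?ltW.
have k0 : 0 < k by rewrite divr_gt0// mulr_gt0.
have D0n : D0 != 0 by rewrite -cabs_gt0 D0k.
pose c : C := k%:C / D0.
have c1 : cabs c = 1 by rewrite /c cabsM cabsV cabsR gtr0_norm// D0k divff// lt0r_neq0.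
have c0 : c != 0 by rewrite -cabs_gt0 c1.
have cw w : cabs (c * w) = cabs w by rewrite cabsM c1 mul1r.
have mbe w : cabs w < 1 -> cabs (mob be (c * w)) < 1.
  by move=> w1; apply: cabs_mob_lt; rewrite ?cw.
pose K w := mob b ((mob be (c * w)) ^+ 2).
have sq1 (x : C) : cabs x < 1 -> cabs (x ^+ 2) < 1.
  by move=> x1; rewrite cabsX expr_lt1 ?cabs_ge0.
exists (fun z => mob be (S z) / c), K, k; split.
- move=> z Az; split.
  + apply: cholM; last exact: chol_cst.
    apply: chol_comp (Sh z Az) _; apply: chol_mob; apply: mob_den1 => //.
    exact/ltW/S1.
  + by rewrite cabsM cabsV c1 divr1; apply: cabs_mob_lt => //; exact: S1.
  + rewrite /K (_ : c * _ = mob be (S z)); last by field.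
    rewrite mobK//; last exact/ltW/S1.
    by rewrite (SP z Az).2 /g mobK// fA.
- by rewrite /K !mulr0 mob_b0 be2 !mob_bb mul0r.
- move=> w w1; split; last by apply: cabs_mob_lt => //; apply/sq1/mbe.
  apply: (@chol_comp _ (fun w => mob be (c * w) ^+ 2)).
    apply/cholX/(@chol_comp _ (fun w => c * w)).
      by apply: cholM (chol_cst _ _) (chol_id _).
    by apply: chol_mob; apply: mob_den1; rewrite ?cw ?ltW.
  by apply: chol_mob; apply: mob_den1 => //; apply/ltW/sq1/mbe.
- split; last first.
    rewrite k0 ler_pdivrMr// mul1r; have := sqr_ge0 (1 - q); lra.
  have E1 : cdiff (fun w => c * w) 0 c.
    by apply: cdiff_eq (cdiff_affine 0 c 0); exists 1 => // x _; rewrite add0r.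
  have E2 : cdiff (fun w => mob be (c * w)) 0 ((conjc be * be - 1) * c).
    have := cdiff_comp E1 (@cdiff_mob _ be (c * 0) _).
    by rewrite !mulr0 subr0 expr1n divr1 oner_eq0; apply.
  have E3 : cdiff (fun w => mob be (c * w) ^+ 2) 0 (2 * be * ((conjc be * be - 1) * c)).
    have := cdiffM E2 E2; rewrite mulr0 mob_b0.
    rewrite (_ : _ + _ = 2 * be * ((conjc be * be - 1) * c)); last by ring.
    by apply: cdiff_eq; exists 1 => // x _; rewrite expr2.
  have nb' : 1 - conjc b * b != 0 by apply: mob_den1 => //; exact: ltW.
  have := cdiff_comp E3 (@cdiff_mob _ b (mob be (c * 0) ^+ 2) _).
  rewrite mulr0 mob_b0 be2 => /(_ nb').
  rewrite (_ : _ * _ = k%:C)//.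
  rewrite (_ : _ * _ = D0 * c); last by rewrite /D0; ring.
  by rewrite /c; field.
- move=> p p1 hb; have := bP p hb p1; rewrite bq => A1.
  have -> : 1 - k = (1 - q) ^+ 2 / (1 + q ^+ 2) by rewrite /k; field; rewrite lt0r_neq0.
  rewrite mulrA ler_pdivlMr//.
  have A2 : (1 - p) ^+ 2 <= (4 * (1 - q)) ^+ 2.
    by apply: lerXn2r; rewrite ?nnegrE; nra.
  have A3 : 1 + q ^+ 2 <= 2 by nra.
  have A4 : (1 - p) ^+ 2 * (1 + q ^+ 2) <= (4 * (1 - q)) ^+ 2 * 2.
    by apply: ler_pM => //; rewrite ?sqr_ge0// ltW.
  by apply: le_trans A4 _; rewrite le_eqVlt; apply/orP; left; apply/eqP; ring.
Qed.

End KoebeStep.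

(** * Quantitative Schwarz estimates *)

Section Estimates.
Context {R : realType}.
Local Notation C := R[i].
Implicit Types (z w a b c d h : C) (f K G : C -> C) (r M s t p k e : R) (A Q : set C).

(** A weak form of [(1 - x) ^ n <= exp (- n x)], sufficient to see how many roots bring the power
    below a threshold. *)
Lemma pow_one_sub (x : R) n : 0 <= x <= 1 -> (1 - x) ^+ n * (1 + n%:R * x) <= 1.
Proof.
move=> /andP[x0 x1]; elim: n => [|n IH]; first by rewrite expr0 mul0r addr0 mulr1.
have A : 0 <= (1 - x) ^+ n by rewrite exprn_ge0//; lra.
apply: le_trans IH; rewrite exprS [_ * (1 - x) ^+ n]mulrC -mulrA.
apply: ler_wpM2l => //; rewrite -natr1.
have : 0 <= n%:R :> R by []. by nra.
Qed.

Lemma pow_small (x e : R) : 0 < x < 1 -> 0 < e -> exists m, (1 - x) ^+ (2 ^ m) <= e.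
Proof.
move=> /andP[x0 x1] e0.
have [n hn] := exp2_small (x^-1) e0.
exists n; have := @pow_one_sub x (2 ^ n) ltac:(lra).
have p0 : 0 < (2 : R) ^+ n by rewrite exprn_gt0.
rewrite natrX => A; rewrite ltr_pdivrMr// in hn.
have q0 : 0 < 1 + 2 ^+ n * x by have := mulr_gt0 p0 x0; lra.
rewrite -ler_pdivlMr// in A; apply: le_trans A _.
rewrite mul1r -[_^-1]mul1r ler_pdivrMr//.
have : x^-1 * x <= e * 2 ^+ n * x by rewrite ler_wpM2r ?ltW.
by rewrite mulVf ?lt0r_neq0//; lra.
Qed.

(** Points closer than [1 - p] are compared by [schwarz_lip]; for points farther apart the trivial
    bound [2 * M] is already good enough. *)
Lemma lip_disc G c (M p : R) w w' : p < 1 ->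
  (forall w, cabs w < 1 -> chol G w /\ cabs (G w - c) <= M) ->
  cabs w <= p -> cabs w' <= p ->
  cabs (G w' - G w) <= 2 * M / (1 - p) * cabs (w' - w).
Proof.
move=> p1 Gh wp wp'.
have M0 : 0 <= M by apply: le_trans (Gh 0 _).2; rewrite ?cabs_ge0 ?cabs0.
have [h|h] := ltP (cabs (w' - w)) (1 - p).
  have := @schwarz_lip _ (fun x => G x - c) w (1 - p) M (w' - w) ltac:(lra) _ h.
  rewrite addBK (_ : G w' - c - (G w - c) = G w' - G w); last by ring.
  rewrite (_ : 2 * M * _ = 2 * M / (1 - p) * cabs (w' - w)); last by rewrite mulrA mulrAC.
  apply=> z zw; have z1 : cabs z < 1 by have := cabs_trile z w; lra.
  by split; [apply: cholB (Gh z z1).1 (chol_cst _ _)|exact: (Gh z z1).2].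
have A := (Gh w ltac:(lra)).2; have B := (Gh w' ltac:(lra)).2.
apply: (@le_trans _ _ (2 * M)).
  by have := cabs_tri c (G w') (G w); rewrite (cabsC c); lra.
by rewrite mulrAC ler_pdivlMr; [apply: ler_wpM2l => //; rewrite mulr_ge0|lra].
Qed.

(** Stability of the equality case in Schwarz's lemma. Schwarz-Pick for [q = K w / w], whose limit
    at 0 is [k], gives [|q - k| <= |w| |1 - k q|]; as [|1 - k q| <= 1 - k ^ 2 + |q - k|], the term
    [|q - k|] can be absorbed when [|w| <= p < 1]. *)
Lemma near_identity K k (p : R) w : p < 1 ->
  (forall w, cabs w < 1 -> chol K w /\ cabs (K w) < 1) -> K 0 = 0 ->
  cdiff K 0 k%:C -> 0 < k <= 1 -> cabs w <= p ->
  cabs (K w - w) <= 3 * (1 - k) / (1 - p).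
Proof.
move=> p1 Kh K0 Kd /andP[k0 k1] wp; have w1 : cabs w < 1 by lra.
have D0 : 0 < 1 - p by lra.
have [->|wn] := eqVneq w 0.
  by rewrite K0 subrr cabs0 divr_ge0 ?mulr_ge0//; lra.
have kn : cabs (k%:C : C) = k by rewrite cabsR gtr0_norm.
have := @schwarz_pick_except _ (fun w => K w / w) k%:C (8 * 1 / 1 ^+ 2) _ _ _ w w1 wn.
rewrite kn => /(_ k1).
set q := K w / w; have -> : conjc k%:C = k%:C :> C by rewrite /= oppr0.
move=> A; have {}A : cabs (q - k%:C) <= cabs w * cabs (1 - k%:C * q).
  apply: A => [z z1 z0|].
    split; first by apply: chol_div => //; [exact: (Kh z z1).1|exact: chol_id].
    rewrite cabsM cabsV ler_pdivrMr ?cabs_gt0//.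
    by apply: schwarz => // y y1; split; [exact: (Kh y y1).1|exact/ltW/(Kh y y1).2].
  exists 1 => // z z0 z1; rewrite (_ : K z / z - k%:C = (K z - k%:C * z) / z); last by field.
  rewrite cabsM cabsV ler_pdivrMr ?cabs_gt0//.
  rewrite (_ : _ * cabs z * cabs z = 8 * 1 / 1 ^+ 2 * cabs z ^+ 2); last by rewrite expr2 mulrA.
  have := @taylor2 _ K 0 k%:C 1 1 z ltr01 _ Kd z1; rewrite add0r K0 subr0; apply.
  by move=> y; rewrite subr0 => y1; split; [exact: (Kh y y1).1|exact/ltW/(Kh y y1).2].
have B : cabs (1 - k%:C * q) <= (1 - k ^+ 2) + cabs (q - k%:C).
  rewrite (_ : 1 - k%:C * q = (1 - k ^+ 2)%:C - k%:C * (q - k%:C)); last first.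
    by rewrite rmorphB rmorph1 rmorphXn /=; ring.
  apply: le_trans (cabsB _ _) _; rewrite cabsM cabsR kn ger0_norm; last by nra.
  by rewrite lerD2l ler_piMl ?cabs_ge0.
have E : cabs (q - k%:C) <= p * ((1 - k ^+ 2) + cabs (q - k%:C)).
  by apply: le_trans A _; apply: ler_pM; rewrite ?cabs_ge0.
have F : cabs (q - 1) <= (1 - k) + cabs (q - k%:C).
  have := cabs_tri k%:C q 1; have : cabs (k%:C - 1 : C) = 1 - k.
    by rewrite cabsC -(rmorph1 (real_complex R)) -rmorphB cabsR ger0_norm//; lra.
  by lra.
rewrite (_ : K w - w = w * (q - 1)); last by rewrite /q; field.
rewrite cabsM ler_pdivlMr//.
have G1 : cabs w * cabs (q - 1) <= cabs (q - 1).
  by rewrite ler_piMl ?cabs_ge0// ltW.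
have p0 : 0 <= p by apply: le_trans wp; exact: cabs_ge0.
have G2 : cabs (q - k%:C) * (1 - p) <= 2 * (1 - k).
  have h1 : 0 <= 1 - k ^+ 2 by nra.
  have h2 : p * (1 - k ^+ 2) <= 1 - k ^+ 2 by rewrite ler_piMl// ltW.
  have h3 : 1 - k ^+ 2 <= 2 * (1 - k) by nra.
  lra.
have G3 : cabs w * cabs (q - 1) * (1 - p) <= ((1 - k) + cabs (q - k%:C)) * (1 - p).
  by apply: ler_wpM2r; lra.
by apply: le_trans G3 _; nra.
Qed.

End Estimates.

Section KoebeSequence.
Context {R : realType}.
Local Notation C := R[i].
Implicit Types (z w a b c d h : C) (r M s t p e : R).

(* f n maps A into the unit disc and G n is a left inverse of it defined on the
   whole disc, with derivative P n at the origin. The last clause says that an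
   omitted value of f n near the origin keeps the derivative of K n away from 1;
   as P is bounded below, these derivatives tend to 1, so the f n eventually
   cover every compact subset of the disc. *)
Lemma koebe_sequence (A : set C) (z0 : C) (D : R) :
  domain A -> simply_connected A -> A z0 -> 0 < D ->
  (forall z, A z -> cabs (z - z0) < D) ->
  exists f, exists G, exists K : nat -> C -> C, exists P : nat -> R,
  [/\ forall n, f n z0 = 0 /\ (forall z, A z -> [/\ chol (f n) z, cabs (f n z) < 1 & G n (f n z) = z]),
      forall n, [/\ cdiff (G n) 0 (P n)%:C, 0 < P n &
        forall w, cabs w < 1 -> chol (G n) w /\ cabs (G n w - z0) <= D],
      forall n, [/\ K n 0 = 0, cdiff (K n) 0 (P n.+1 / P n)%:C, P n.+1 <= P n &
        forall w, cabs w < 1 -> chol (K n) w /\ cabs (K n w) < 1],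
      forall n, (forall z, A z -> f n z = K n (f n.+1 z)) /\ (forall w, G n.+1 w = G n (K n w))
    & forall n (p : R), p < 1 -> (exists2 b, cabs b < p & forall z, A z -> f n z != b) ->
        (1 - p) ^+ 2 <= 32 * (1 - P n.+1 / P n)].
Proof.
move=> dA scA Az0 D0 AD.
have DC : D%:C != 0 :> C by rewrite -cabs_gt0 cabsR normr_gt0 lt0r_neq0.
have Dn : cabs (D%:C : C) = D by rewrite cabsR gtr0_norm.
pose T := ((C -> C) * (C -> C) * R)%type.
pose Inv (x : T) := [/\ x.1.1 z0 = 0,
  forall z, A z -> [/\ chol x.1.1 z, cabs (x.1.1 z) < 1 & x.1.2 (x.1.1 z) = z],
  cdiff x.1.2 0 x.2%:C, 0 < x.2 &
  forall w, cabs w < 1 -> chol x.1.2 w /\ cabs (x.1.2 w - z0) <= D].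
pose Rel (x y : T) (K : C -> C) := [/\ K 0 = 0, cdiff K 0 (y.2 / x.2)%:C, y.2 <= x.2,
  forall w, cabs w < 1 -> chol K w /\ cabs (K w) < 1 &
  [/\ forall z, A z -> x.1.1 z = K (y.1.1 z), forall w, y.1.2 w = x.1.2 (K w) &
  forall p : R, p < 1 -> (exists2 b, cabs b < p & forall z, A z -> x.1.1 z != b) ->
        (1 - p) ^+ 2 <= 32 * (1 - y.2 / x.2)]].
have next x : exists yK : T * (C -> C), Inv x -> Inv yK.1 /\ Rel x yK.1 yK.2.
  have [Ix|] := pselect (Inv x); last by exists (x, id).
  case: x Ix => -[f G] P [/= I1 I2 I3 I4 I5].
  have fh z : A z -> chol f z /\ cabs (f z) < 1 by move=> /I2[].
  have [f' [K [k [J1 [J2 J3] J4 [J5 /andP[k0 k1]] J6]]]] := koebe_step dA scA Az0 fh I1.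
  have Pk : P * k / P = k by rewrite mulrAC divff ?mul1r// lt0r_neq0.
  exists ((f', fun w => G (K w), P * k), K) => _; split; split => //=.
  - by move=> z Az; have [a1 a2 a3] := J1 z Az; split => //; rewrite -a3; have [] := I2 z Az.
  - rewrite rmorphM; apply: (cdiff_comp J5); by rewrite J3.
  - by rewrite mulr_gt0.
  - move=> w w1; have [a1 a2] := J4 w w1; have [b1 b2] := I5 _ a2.
    by split => //; exact: (chol_comp a1 b1).
  - by rewrite Pk.
  - by rewrite ger_pMr.
  - split=> //; first by move=> z /J1[].
    by rewrite Pk.
have [nx nxP] := choice next.
pose x0 : T := ((fun z => (z - z0) / D%:C, fun w => z0 + D%:C * w), D).
pose u n := iter n (fun x => (nx x).1) x0.
have I0 : Inv x0.
  split=> //=.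
  - by rewrite subrr mul0r.
  - move=> z Az; split; [|by rewrite cabsM cabsV Dn ltr_pdivrMr// mul1r AD|by field].
    by apply: cholM (chol_cst _ _); apply: cholB (chol_id _) (chol_cst _ _).
  - exact: cdiff_affine.
  - move=> w w1; split; first exact: chol_affine.
    by rewrite addKB cabsM Dn ger_pMr// ltW.
have Iu n : Inv (u n) by elim: n => [//|n /nxP[]].
have Ru n : Rel (u n) (u n.+1) (nx (u n)).2 by have [_] := nxP _ (Iu n).
exists (fun n => (u n).1.1), (fun n => (u n).1.2), (fun n => (nx (u n)).2), (fun n => (u n).2).
split=> n.
- by have [] := Iu n.
- by have [] := Iu n.
- by have [] := Ru n.
- by have [_ _ _ _ []] := Ru n.
- by have [_ _ _ _ []] := Ru n.
Qed.

End KoebeSequence.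

Section PickGrowth.
Context {R : realType}.
Local Notation C := R[i].
Implicit Types (u v : C) (p : R).

(** The hypothesis is pseudohyperbolic distance at most 1/2. By [mob_id], with
    [m = |1 - conjc v * u| >= 1 - p], it gives [(1 - |v| ^ 2) (1 - |u| ^ 2) >= 3 / 4 * m ^ 2];
    passing from [1 - |u| ^ 2] to [1 - |u|] halves the constant. *)
Lemma pick_growth u v p : 0 <= p < 1 -> cabs v <= p -> cabs u < 1 ->
  cabs (u - v) <= 1 / 2 * cabs (1 - conjc v * u) -> cabs u <= 1 - 3 / 8 * (1 - p) ^+ 2.
Proof.
move=> /andP[p0 p1] vp u1 uv; have v0 := cabs_ge0 v; have u0 := cabs_ge0 u.
have d1 : 1 - p <= cabs (1 - conjc v * u).
  have := cabs_trile 1 (conjc v * u); rewrite cabs1 cabsM cabsJ.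
  have : cabs v * cabs u <= p * 1 by apply: ler_pM => //; exact: ltW.
  by lra.
have := mob_id v u; rewrite (cabsC v u).
have k0 := cabs_ge0 (u - v).
set m := cabs (1 - _) in uv d1 *; set k := cabs (u - v) in uv k0 *.
have m1 : (1 - p) ^+ 2 <= m ^+ 2 by apply: lerXn2r; rewrite ?nnegrE; lra.
have kk : k ^+ 2 <= (1 / 2 * m) ^+ 2 by apply: lerXn2r; rewrite ?nnegrE; lra.
move=> E; have E1 : 3 / 4 * (1 - p) ^+ 2 <= (1 - cabs v ^+ 2) * (1 - cabs u ^+ 2).
  by rewrite -E (_ : (1 / 2 * m) ^+ 2 = m ^+ 2 / 4) in kk *; [lra|field].
have E2 : (1 - cabs v ^+ 2) * (1 - cabs u ^+ 2) <= 1 - cabs u ^+ 2.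
  by rewrite ler_piMl//; nra.
nra.
Qed.

End PickGrowth.

(** * Convergence of the Koebe iteration *)

Section KoebeLimit.
Context {R : realType}.
Local Notation C := R[i].
Implicit Types (z w a b c h : C) (r M s t p e : R).
Variables (A : set C) (z0 : C) (D : R) (d0 : R).
Variables (f G K : nat -> C -> C) (P : nat -> R).
Hypothesis oA : open A.
Hypothesis cA : connected A.
Hypothesis D0 : 0 < D.
Hypothesis d00 : 0 < d0.
Hypothesis ball_A : forall z, cabs (z - z0) < d0 -> A z.
Hypothesis f0 : forall n, f n z0 = 0.
Hypothesis fP : forall n z, A z -> [/\ chol (f n) z, cabs (f n z) < 1 & G n (f n z) = z].
Hypothesis Gd : forall n, cdiff (G n) 0 (P n)%:C.
Hypothesis P0 : forall n, 0 < P n.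
Hypothesis GP : forall n w, cabs w < 1 -> chol (G n) w /\ cabs (G n w - z0) <= D.
Hypothesis K0 : forall n, K n 0 = 0.
Hypothesis Kd : forall n, cdiff (K n) 0 (P n.+1 / P n)%:C.
Hypothesis Pdecr : forall n, P n.+1 <= P n.
Hypothesis KP : forall n w, cabs w < 1 -> chol (K n) w /\ cabs (K n w) < 1.
Hypothesis fK : forall n z, A z -> f n z = K n (f n.+1 z).
Hypothesis GK : forall n w, G n.+1 w = G n (K n w).
Hypothesis hole : forall n (p : R), p < 1 ->
  (exists2 b, cabs b < p & forall z, A z -> f n z != b) -> (1 - p) ^+ 2 <= 32 * (1 - P n.+1 / P n).

Let Az0 : A z0. Proof. by apply: ball_A; rewrite subrr cabs0. Qed.

(** The derivative of [f n] at [z0] is at most [1 / d0] by Cauchy's estimate, and [P n] is its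
    inverse by the chain rule. *)
Let P_lower n : d0 <= P n.
Proof.
have [[d fd] _ _] := fP n Az0.
have fz : cabs d <= 1 / d0.
  apply: (@cdiff_bound _ (f n) z0 d d0 1) => // z /ball_A /(fP n)[a1 a2 _].
  by split=> //; rewrite f0 subr0 ltW.
have := cdiff_comp fd (_ : cdiff (G n) (f n z0) (P n)%:C); rewrite f0 => /(_ (Gd n)) H.
have : cdiff (G n \o f n) z0 1.
  apply: cdiff_eq (cdiff_id z0); exists d0 => // z /ball_A/(fP n)[_ _] /= -> //.
move=> /(cdiff_uniq H) /(congr1 (fun x => cabs x)); rewrite cabsM cabs1 cabsR gtr0_norm// => E.
have := ler_wpM2l (ltW (P0 n)) fz; rewrite E mul1r ler_pdivlMr// mul1r//.
Qed.

Fixpoint KK n j : C -> C := if j is i.+1 then KK n i \o K (n + i) else id.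

Let KKP n j : [/\ KK n j 0 = 0, cdiff (KK n j) 0 (P (n + j)%N / P n)%:C,
   forall w, cabs w < 1 -> chol (KK n j) w /\ cabs (KK n j w) < 1 &
   (forall z, A z -> f n z = KK n j (f (n + j)%N z)) /\ (forall w, G (n + j)%N w = G n (KK n j w))].
Proof.
elim: j => [|j [h1 h2 h3 [h4 h5]]].
  rewrite addn0 divff ?lt0r_neq0//; split=> //; first by rewrite rmorph1; exact: cdiff_id.
  by move=> w w1; split=> //; exact: chol_id.
rewrite addnS; split=> /=.
- by rewrite K0.
- have := cdiff_comp (Kd (n + j)) (_ : cdiff (KK n j) (K (n + j) 0) _).
  rewrite K0 => /(_ _ h2); rewrite -rmorphM /=.
  rewrite (_ : _ / P n * _ = P (n + j).+1 / P n)//.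
  by field; rewrite !lt0r_neq0.
- move=> w w1; have [a1 a2] := KP (n + j) w1; have [b1 b2] := h3 _ a2.
  by split=> //; exact: (chol_comp a1 b1).
- by split=> [z Az|w]; rewrite ?GK ?h5//= h4// (fK (n + j)).
Qed.

Let P_mono n j : P (n + j)%N <= P n.
Proof. by elim: j => [|j IH]; rewrite ?addn0// addnS; exact: le_trans (Pdecr _) IH. Qed.

Let ratio_bounds n j : 0 < P (n + j)%N / P n <= 1.
Proof. by rewrite divr_gt0// ler_pdivrMr// mul1r P_mono. Qed.

Let P_cauchy e : 0 < e -> exists N, forall n j, (N <= n)%N -> 1 - P (n + j)%N / P n <= e.
Proof.
move=> e0; have Pinf : has_inf (range P).
  by split; [exists (P 0); exists 0%N|exists 0 => _ [n _ <-]; exact: ltW].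
have i0 : d0 <= inf (range P) by apply: lb_le_inf; [case: Pinf|move=> _ [n _ <-]; exact: P_lower].
have e1 : 0 < d0 * e by rewrite mulr_gt0.
have [_ [N _ <-] hN] := inf_adherent e1 Pinf; exists N => n j Nn.
have A1 : P n <= P N by rewrite -(subnKC Nn); exact: P_mono.
have A2 : inf (range P) <= P (n + j)%N.
  by apply: ge_inf; [case: Pinf|exists (n + j)%N].
rewrite lerBlDl -lerBlDr ler_pdivlMr// mulrBl mul1r.
have := P_lower n; have : d0 * e <= P n * e by rewrite ler_pM2r// P_lower.
lra.
Qed.

Let KK_near p e : p < 1 -> 0 < e -> exists N, forall n j w, (N <= n)%N -> cabs w <= p ->
  cabs (KK n j w - w) <= e.
Proof.
move=> p1 e0; have q0 : 0 < 1 - p by lra.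
have e1 : 0 < e * (1 - p) / 3 by rewrite divr_gt0// mulr_gt0.
have [N HN] := P_cauchy e1; exists N => n j w Nn wp.
have [h1 h2 h3 _] := KKP n j.
apply: le_trans (near_identity p1 h3 h1 h2 (ratio_bounds n j) wp) _.
rewrite ler_pdivrMr//; have := HN n j Nn; lra.
Qed.

Let covers p : p < 1 -> exists N, forall n b, (N <= n)%N -> cabs b < p ->
  exists2 z, A z & f n z = b.
Proof.
move=> p1; have e1 : 0 < (1 - p) ^+ 2 / 64 by rewrite divr_gt0// exprn_gt0//; lra.
have [N HN] := P_cauchy e1; exists N => n b Nn bp.
apply: contrapT => nb; have := @hole n p p1 _; have := HN n 1%N Nn; rewrite addn1.
move=> h1 h2; have : (1 - p) ^+ 2 <= 32 * (1 - P n.+1 / P n).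
  apply: h2; exists b => // z Az; apply/eqP => E; apply: nb; by exists z.
lra.
Qed.

Let G_cauchy p e : p < 1 -> 0 < e -> exists N, forall n j w, (N <= n)%N -> cabs w <= p ->
  cabs (G (n + j)%N w - G n w) <= e.
Proof.
move=> p1 e0; have q0 : 0 < 1 - p by lra.
have L0 : 0 < 2 * D / (1 - p) by rewrite divr_gt0// mulr_gt0.
have e1 : 0 < e / (2 * D / (1 - p)) by rewrite divr_gt0.
have [N HN] := KK_near p1 e1; exists N => n j w Nn wp.
have [h1 h2 h3 [_ h5]] := KKP n j; rewrite h5.
have Kp : cabs (KK n j w) <= p.
  apply: le_trans (wp); rewrite -[leRHS]mul1r; apply: schwarz => //; last lra.
  by move=> z z1; split; [exact: (h3 z z1).1|exact/ltW/(h3 z z1).2].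
apply: le_trans (lip_disc p1 (GP n) wp Kp) _.
by rewrite mulrC -ler_pdivlMr//; exact: HN.
Qed.

Let Ginf_ex w : exists l, cabs w < 1 ->
  forall e, 0 < e -> exists N, forall n, (N <= n)%N -> cabs (G n w - l) <= e.
Proof.
have [w1|] := pselect (cabs w < 1); last by exists 0.
have [|l hl] := @complex_cauchy _ (fun n => G n w); last by exists l.
move=> e e0; have e2 : 0 < e / 2 by lra.
have [N HN] := G_cauchy w1 e2; exists N => n m Nn Nm.
have A1 := HN N (n - N)%N w (leqnn _) (lexx _); have A2 := HN N (m - N)%N w (leqnn _) (lexx _).
rewrite !subnKC// in A1 A2.
by have := cabs_tri (G N w) (G n w) (G m w); rewrite (cabsC (G N w)); lra.
Qed.

(** The limit of [G n] is [g]. Passing to the limit in [G n (f n z) = z] requires [f n z] to stay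
    away from the unit circle, which is not evident for a given [z]; so surjectivity is obtained by
    connectedness, [F] is chosen as an inverse of [g], and only then identified with the limit of
    [f n]. *)
Lemma riemann_limit : exists g, exists F : C -> C,
  [/\ g 0 = z0, forall w, cabs w < 1 -> chol g w /\ A (g w),
      forall z, A z -> ccont F z /\ cabs (F z) < 1,
      forall w, cabs w < 1 -> F (g w) = w & forall z, A z -> g (F z) = z].
Proof.
have [g gP] := choice Ginf_ex.
have gu p e : p < 1 -> 0 < e -> exists N, forall n w, (N <= n)%N -> cabs w <= p ->
    cabs (G n w - g w) <= e.
  move=> p1 e0; have e2 : 0 < e / 2 by lra.
  have [N HN] := G_cauchy p1 e2; exists N => n w Nn wp.
  have [M HM] := gP w ltac:(lra) _ e2.
  have := HM (n + M)%N (leq_addl _ _); have := HN n M w Nn wp.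
  by have := cabs_tri (G (n + M)%N w) (G n w) (g w); rewrite (cabsC (G n w) (G _ w)); lra.
have GA n p : (forall b, cabs b < p -> exists2 z, A z & f n z = b) ->
    forall w, cabs w < p -> A (G n w) /\ f n (G n w) = w.
  by move=> H w /H[z Az <-]; have [_ _ ->] := fP n Az.
(* In place of Hurwitz's theorem: if [a = g w] is outside [A], then for large [n] the function
   [G n - a] is zero-free on [|z| < p], since [G n] maps that disc into [A], and has modulus at
   least [d0] at 0. By [avoid_lower_bound] its modulus at [w] has a lower bound independent of [n],
   against [G n w] tending to [a]. *)
have gA w : cabs w < 1 -> A (g w).
  move=> w1; apply: contrapT => nA; set a := g w in nA.
  have wp0 := cabs_ge0 w; pose p := (1 + cabs w) / 2.
  have p1 : p < 1 by rewrite /p; lra.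
  have [N1 H1] := covers p1.
  pose ta := (1 - cabs w) / 4.
  have t4 : 0 < ta / 4 < 1 by rewrite /ta; lra.
  have D2 : 0 < 2 * D by rewrite mulr_gt0.
  have e1 : 0 < d0 / (2 * D) by rewrite divr_gt0.
  have [m hm] := pow_small t4 e1.
  pose e := 2 * D * (ta / 8) ^+ (2 ^ m) / 2.
  have e0 : 0 < e by rewrite divr_gt0// mulr_gt0// exprn_gt0//; lra.
  have [N2 H2] := gP w w1 _ e0.
  pose n := maxn N1 N2; have := H2 n (leq_maxr _ _); rewrite -/a => A1.
  have az : cabs (a - z0) <= D.
    apply/ler_addgt0Pr => e3 e30; have [N3 H3] := gP w w1 _ e30.
    have := H3 N3 (leqnn _); have := (GP N3 w1).2; rewrite -/a.
    by have := cabs_tri (G N3 w) a z0; rewrite (cabsC a (G _ _)); lra.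
  have ad : d0 <= cabs (a - z0) by rewrite leNgt; apply/negP => /ball_A.
  have p0 : 0 < p by rewrite /p; lra.
  have pn : cabs (p%:C : C) = p by rewrite cabsR gtr0_norm.
  have pC : p%:C != 0 :> C by rewrite -cabs_gt0 pn.
  have pz z : cabs z < 1 -> cabs (p%:C * z) < p.
    by move=> z1; rewrite cabsM pn gtr_pMr.
  have G0 : G n 0 = z0 by rewrite -(f0 n); have [_ _ ->] := fP n Az0.
  have := @avoid_lower_bound _ (fun z => G n (p%:C * z) - a) (2 * D) ta m _ _ _ (w / p%:C).
  rewrite (_ : p%:C * (w / p%:C) = w); last by field.
  rewrite mulr0 G0 cabsM cabsV pn => H.
  have : 2 * D * (ta / 8) ^+ (2 ^ m) <= cabs (G n w - a).
    apply: H.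
    - by rewrite /ta; lra.
    - move=> z z1; have zp := pz z z1; have zp1 : cabs (p%:C * z) < 1 by rewrite /p in zp *; lra.
      have [b1 b2] := GP n zp1; split.
      + apply: cholB (chol_cst _ _); apply: (@chol_comp _ (fun z => p%:C * z)) => //.
        by apply: cholM (chol_cst _ _) (chol_id _).
      + rewrite subr_eq0; apply/eqP => E; apply: nA; rewrite -E.
        by apply: (GA n p _ _ zp).1 => b bp; apply: H1 => //; exact: leq_maxl.
      + by have := cabs_tri z0 (G n (p%:C * z)) a; rewrite (cabsC z0); lra.
    - apply: le_trans hm _; rewrite ler_pM2r ?invr_gt0//.
      by rewrite cabsC.
    - by rewrite ler_pdivrMr// /p /ta; nra.
  by move: e0 A1; rewrite /e; lra.
have gh w : cabs w < 1 -> chol g w.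
  move=> w1; pose r := (1 - cabs w) / 2; have r0 : 0 < r by rewrite /r; lra.
  have in_disc z : cabs (z - w) < r -> cabs z <= (1 + cabs w) / 2.
    by move=> zw; have := cabs_trile z w; rewrite /r in zw; lra.
  have [||d gd _] := @weierstrass _ G g w r (D + cabs z0) r0; last by exists d.
    move=> n z /in_disc z1; have z1' : cabs z < 1 by lra.
    have [b1 b2] := GP n z1'.
    by split=> //; have := cabs_trile (G n z) z0; lra.
  move=> e e0; have [N HN] := gu ((1 + cabs w) / 2) e ltac:(lra) e0.
  by exists N => n Nn z /in_disc; exact: HN.
have f_lip n z r h : 0 < r -> (forall x, cabs (x - z) < r -> A x) -> cabs h < r ->
    cabs (f n (z + h) - f n z) <= 2 * (cabs h / r).
  move=> r0 rA hr; rewrite -[2]mulr1; apply: schwarz_lip => // x /rA /(fP n)[b1 b2 _].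
  by split=> //; exact: ltW.
(* For large [n], [w = f n (G n w)], and the [f n] share a Lipschitz bound near [g w]. *)
have fg w e : cabs w < 1 -> 0 < e -> exists N, forall n, (N <= n)%N -> cabs (f n (g w) - w) <= e.
  move=> w1 e0; have [r r0 rA] := (open_cabsP A).1 oA _ (gA w w1).
  have e1 : 0 < Num.min (r / 2) (e * r / 4) by rewrite lt_min !divr_gt0// mulr_gt0.
  have [N1 H1] := gP w w1 _ e1.
  have p1 : (1 + cabs w) / 2 < 1 by lra.
  have [N2 H2] := covers p1.
  exists (maxn N1 N2) => n; rewrite geq_max => /andP[/H1 h1 n2].
  move: h1; rewrite le_min => /andP[h1 h2].
  have [_ E] := GA n _ (fun b => H2 n b n2) w ltac:(lra).
  have := f_lip n (g w) r (G n w - g w) r0 rA ltac:(lra).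
  rewrite addBK E cabsC => A1; apply: le_trans A1 _.
  by rewrite mulrA ler_pdivrMr//; have := mulr_gt0 e0 r0; lra.
have gsur z : A z -> exists2 w, cabs w < 1 & g w = z.
  (* The image of [g] contains a disc of half the distance available in [A]. There [f n x] stays
     within pseudohyperbolic distance 1/2 of [f n z'], which converges, so by [pick_growth] it stays
     in [|u| <= q < 1]. On that disc the transition maps [KK] are close to the identity, so [f n x]
     is Cauchy, and [g] sends its limit to [x]. The explicit radius also makes the image relatively
     closed. *)
  have key z' r : (exists2 w, cabs w < 1 & g w = z') -> 0 < r ->
     (forall x, cabs (x - z') < r -> A x) -> forall x, cabs (x - z') < r / 2 ->
     exists2 w, cabs w < 1 & g w = x.
    move=> [w' w'1 gw'] r0 rA x xr; have Ax : A x by apply: rA; lra.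
    pose p0 := (1 + cabs w') / 2.
    have e0 : 0 < (1 - cabs w') / 2 by lra.
    have [N0 H0] := fg w' _ w'1 e0.
    have v_lt n : (N0 <= n)%N -> cabs (f n z') <= p0.
      move=> /H0; rewrite gw' => h; have := cabs_trile (f n z') w'.
      by rewrite /p0; lra.
    have p01 : 0 <= p0 < 1 by have := cabs_ge0 w'; rewrite /p0; lra.
    pose q := 1 - 3 / 8 * (1 - p0) ^+ 2.
    have q1 : q < 1 by rewrite /q gtrBl mulr_gt0// exprn_gt0//; lra.
    have u_le n : (N0 <= n)%N -> cabs (f n x) <= q.
      move=> /v_lt vn; set v := f n z' in vn; set uu := f n x.
      have rC : r%:C != 0 :> C by rewrite -cabs_gt0 cabsR gtr0_norm.
      have rn : cabs (r%:C : C) = r by rewrite cabsR gtr0_norm.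
      have := @schwarz_pick _ (fun y => f n (z' + r%:C * y)) _ ((x - z') / r%:C).
      rewrite mulr0 addr0 (_ : z' + r%:C * ((x - z') / r%:C) = x); last by field.
      rewrite -/v -/uu cabsM cabsV rn => H.
      have Az' y : cabs y < 1 -> A (z' + r%:C * y).
        by move=> y1; apply: rA; rewrite addKB cabsM rn gtr_pMr.
      have {}H : cabs (uu - v) <= cabs (x - z') / r * cabs (1 - conjc v * uu).
        apply: H => [y y1|]; last by rewrite ltr_pdivrMr//; lra.
        have [b1 b2 _] := fP n (Az' y y1); split; last exact: ltW.
        by apply: (@chol_comp _ (fun y => z' + r%:C * y) (f n)) b1; exact: chol_affine.
      have u1 : cabs uu < 1 by have [] := fP n Ax.
      have half : cabs (x - z') / r <= 1 / 2.
        rewrite ler_pdivrMr// mul1r mulrC; exact: ltW.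
      apply: (@pick_growth _ uu v p0) => //.
      by apply: le_trans H _; apply: ler_wpM2r => //; exact: cabs_ge0.
    have [|w hw] := @complex_cauchy _ (fun n => f n x).
      move=> e e0'; have e2 : 0 < e / 2 by lra.
      have [N1 H1] := KK_near q1 e2; pose N := maxn N0 N1.
      have near n : (N <= n)%N -> cabs (f N x - f n x) <= e / 2.
        move=> Nn; have [_ _ _ [h4 _]] := KKP N (n - N); rewrite subnKC// in h4.
        rewrite (h4 x Ax); apply: H1; first exact: leq_maxr.
        by apply: u_le; apply: leq_trans Nn; exact: leq_maxl.
      exists N => n m /near a1 /near a2.
      by have := cabs_tri (f N x) (f n x) (f m x); rewrite (cabsC (f n x) (f N x)); lra.
    have wq : cabs w <= q.
      apply/ler_addgt0Pr => e e0'; have [N HN] := hw e e0'.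
      have := HN _ (leq_maxl N N0); have := u_le _ (leq_maxr N N0).
      by have := cabs_trile w (f (maxn N N0) x); rewrite (cabsC w); lra.
    exists w; first lra.
    apply/eqP; rewrite -subr_eq0 -[_ == _]negbK -cabs_gt0 -leNgt.
    apply/ler_addgt0Pr => e e0'; rewrite add0r; have e2 : 0 < e / 2 by lra.
    have [N1 H1] := gu q _ q1 e2.
    have L0 : 0 < 2 * D / (1 - q) by rewrite divr_gt0 ?mulr_gt0//; lra.
    have e3 : 0 < e / 2 / (2 * D / (1 - q)) by rewrite divr_gt0.
    have [N2 H2] := hw _ e3; pose n := maxn N0 (maxn N1 N2).
    have a0 := u_le n (leq_maxl _ _).
    have a1 := H1 n w (leq_trans (leq_maxl _ _) (leq_maxr _ _)) wq.
    have a2 := H2 n (leq_trans (leq_maxr _ _) (leq_maxr _ _)).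
    have := lip_disc q1 (GP n) wq a0; have [_ _ ->] := fP n Ax.
    move=> a3; have a4 : 2 * D / (1 - q) * cabs (f n x - w) <= e / 2.
      by rewrite mulrC -ler_pdivlMr.
    by have := cabs_tri (G n w) (g w) x; rewrite (cabsC (g w) (G n w)) (cabsC (G n w) x); lra.
  apply: (@connected_clopen _ A [set z | exists2 w, cabs w < 1 & g w = z]) => //.
  - by move=> _ [w w1 <-]; exact: gA.
  - by exists (g 0), 0; rewrite ?cabs0.
  - move=> z' Tz'; have [w w1 E] := Tz'.
    have [r r0 rA] := (open_cabsP A).1 oA z' ltac:(by rewrite -E; exact: gA).
    by exists (r / 2) => [|x xr _]; [lra|exact: (key z' r)].
  - move=> z' Az' nT; have [r r0 rA] := (open_cabsP A).1 oA z' Az'.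
    exists (r / 4) => [|x xr Tx]; first lra.
    apply: nT; apply: (key x (3 * r / 4)) => //; [lra| |rewrite cabsC; lra].
    move=> y yx; apply: rA; have := cabs_tri x y z'; lra.
have inv z : exists w, A z -> cabs w < 1 /\ g w = z.
  have [/gsur[w w1 E]|] := pselect (A z); last by exists 0.
  by exists w.
have [F FP] := choice inv.
have fF z e : A z -> 0 < e -> exists N, forall n, (N <= n)%N -> cabs (f n z - F z) <= e.
  by move=> /FP[F1 FE] e0; have [N HN] := fg _ _ F1 e0; exists N; move: HN; rewrite FE.
exists g, F; split.
- apply/eqP; rewrite -subr_eq0 -[_ == _]negbK -cabs_gt0 -leNgt.
  apply/ler_addgt0Pr => e e0; rewrite add0r.
  have [N HN] := gP 0 ltac:(by rewrite cabs0) e e0.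
  have := HN N (leqnn _); rewrite -{1}(f0 N); have [_ _ ->] := fP N Az0.
  by rewrite cabsC.
- by move=> w w1; split; [exact: gh|exact: gA].
- move=> z Az; split; last exact: (FP z Az).1.
  have [r r0 rA] := (open_cabsP A).1 oA z Az.
  move=> e e0; exists (Num.min r (e * r / 4)); first by rewrite lt_min r0 divr_gt0// mulr_gt0.
  move=> w; rewrite lt_min => /andP[wr we].
  have e8 : 0 < e / 8 by lra.
  have [N1 H1] := fF z _ Az e8; have [N2 H2] := fF w _ (rA w wr) e8.
  have := H1 _ (leq_maxl N1 N2); have := H2 _ (leq_maxr N1 N2); set n := maxn N1 N2.
  have := f_lip n z r (w - z) r0 rA wr; rewrite addBK mulrA => a1.
  have a2 : cabs (f n w - f n z) <= e / 2 by apply: le_trans a1 _; rewrite ler_pdivrMr//; lra.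
  have := cabs_tri (f n w) (F w) (F z); have := cabs_tri (f n z) (f n w) (F z).
  by rewrite (cabsC (F w) (f n w)); lra.
- move=> w w1; apply/eqP; rewrite -subr_eq0 -[_ == _]negbK -cabs_gt0 -leNgt.
  apply/ler_addgt0Pr => e e0; rewrite add0r; have e2 : 0 < e / 2 by lra.
  have [N1 H1] := fF (g w) _ (gA w w1) e2; have [N2 H2] := fg w _ w1 e2.
  have := H1 _ (leq_maxl N1 N2); have := H2 _ (leq_maxr N1 N2).
  by have := cabs_tri (f (maxn N1 N2) (g w)) (F (g w)) w; rewrite (cabsC (F (g w)) (f _ (g w))); lra.
- by move=> z /FP[].
Qed.

End KoebeLimit.

Section Riemann.
Context {R : realType}.
Local Notation C := R[i].
Implicit Types (z w a b : C) (r M : R).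

(** The Riemann map is a homeomorphism, hence a covering whose only sheet is the disc, over the
    whole of [A]. *)
Lemma riemann_covering (A : set C) z0 M : domain A -> simply_connected A -> A z0 ->
  (forall z, A z -> cabs z <= M) ->
  exists p, [/\ holomorphic_on unit_disc p, covering_map unit_disc A p & p 0 = z0].
Proof.
move=> dA scA Az0 AM; have [_ oA cA] := dA.
have [r r0 rA] := (open_cabsP A).1 oA z0 Az0.
have M0 : 0 <= M by apply: le_trans (AM _ Az0); exact: cabs_ge0.
have D0 : 0 < 2 * M + 1 by lra.
have AD z : A z -> cabs (z - z0) < 2 * M + 1.
  by move=> Az; have := cabsB z z0; have := AM _ Az; have := AM _ Az0; lra.
have [f [G [K [P [h1 h2 h3 h4 h5]]]]] := koebe_sequence dA scA Az0 D0 AD.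
have [g [F [g0 gP FP Fg gF]]] := @riemann_limit _ A z0 (2 * M + 1) r f G K P oA cA D0 r0 rA
  (fun n => (h1 n).1) (fun n => (h1 n).2) (fun n => let: And3 x _ _ := h2 n in x)
  (fun n => let: And3 _ x _ := h2 n in x) (fun n => let: And3 _ _ x := h2 n in x)
  (fun n => let: And4 x _ _ _ := h3 n in x) (fun n => let: And4 _ x _ _ := h3 n in x)
  (fun n => let: And4 _ _ x _ := h3 n in x) (fun n => let: And4 _ _ _ x := h3 n in x)
  (fun n => (h4 n).1) (fun n => (h4 n).2) h5.
have oD : open (unit_disc : set C).
  apply/open_cabsP => z z1; exists (1 - cabs z); first by rewrite subr_gt0.
  by move=> w wz; rewrite /unit_disc /=; have := cabs_trile w z; lra.
have gD : g @` unit_disc = A.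
  rewrite eqEsubset; split=> [_ [w w1 <-]|z Az]; first exact: (gP w w1).2.
  by exists (F z); [exact: (FP z Az).2|exact: gF].
have gc : {within unit_disc, continuous g}.
  by apply/within_continuousC => // z /gP[/chol_cont].
exists g; split=> //.
  by move=> z /gP[gz _]; exact/derivable_cholP.
split=> // a Aa; exists A, [set unit_disc]; split=> //.
- by move=> i j -> ->.
- rewrite bigcup_set1 eqEsubset; split=> [w w1|w []//].
  by split=> //; exact: (gP w w1).2.
- move=> _ ->; split=> //; split=> //.
    split; [by move=> w /gP[]|by move=> v w; rewrite !inE => v1 w1 E; rewrite -(Fg v)// E Fg|].
    by move=> z Az; exists (F z); [exact: (FP z Az).2|exact: gF].
  exists F; split; last exact: Fg.
  by apply/within_continuousC => // z /FP[].
Qed.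

End Riemann.

(** * Lifting through coverings *)

Section Lifting.
Context {R : realType}.
Local Notation C := R[i].
Implicit Types (z w a b x y : C) (r M t s e : R) (V S : set C).

(** Since [d] is nonzero, [q] expands small increments by at least [|d| / 2], so the continuous [h]
    is Lipschitz at [z] with constant [L]; the linear approximations of [q] and [p] can then be
    compared. *)
Lemma lift_chol (q h p : C -> C) z d dp r : 0 < r -> cdiff q (h z) d -> d != 0 ->
  ccont h z -> (forall w, cabs (w - z) < r -> q (h w) = p w) ->
  cdiff p z dp -> cdiff h z (dp / d).
Proof.
move=> r0 qd d0 hc qh pd e e0.
have dp0 : 0 < cabs d by rewrite cabs_gt0.
pose L := 2 / cabs d * (cabs dp + 1).
have L0 : 0 < L by rewrite mulr_gt0 ?divr_gt0//; have := cabs_ge0 dp; lra.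
have e1 : 0 < cabs d / 2 by lra.
have e2 : 0 < e * cabs d / 2 / L by rewrite !divr_gt0// mulr_gt0.
have e3 : 0 < e * cabs d / 2 by rewrite !divr_gt0// mulr_gt0.
have [d1 d10 H1] := qd _ e1; have [d2 d20 H2] := qd _ e2; have [d3 d30 H3] := pd _ e3.
have [d4 d40 H4] := cdiff_lip pd.
have d12 : 0 < Num.min d1 d2 by rewrite lt_min d10.
have [d5 d50 H5] := hc _ d12.
exists (Num.min (Num.min r d3) (Num.min d4 d5)); first by rewrite !lt_min r0 d30 d40.
move=> k; rewrite !lt_min => /andP[/andP[kr /H3 A3] /andP[/H4 A4 k5]].
have := H5 (z + k); rewrite addKB lt_min => /(_ k5)/andP[/H1 A1 /H2 A2].
have qz : q (h z) = p z by apply: qh; rewrite subrr cabs0.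
have qk : q (h (z + k)) = p (z + k) by apply: qh; rewrite addKB.
rewrite addBK qz qk in A1 A2.
set et := h (z + k) - h z in A1 A2 *.
have B : cabs et <= L * cabs k.
  have := cabs_trile (d * et) (p (z + k) - p z); rewrite (cabsC (d * et)) cabsM => B1.
  have B2 : cabs d / 2 * cabs et <= (cabs dp + 1) * cabs k by lra.
  rewrite (_ : cabs et = 2 / cabs d * (cabs d / 2 * cabs et)); last first.
    by field; rewrite lt0r_neq0.
  by rewrite /L -[leRHS]mulrA; apply: ler_wpM2l => //; rewrite divr_ge0 ?ltW.
rewrite (_ : et - dp / d * k = ((p (z + k) - p z - dp * k) - (p (z + k) - p z - d * et)) / d); last by field.
rewrite cabsM cabsV ler_pdivrMr//; apply: le_trans (cabsB _ _) _.
have : e * cabs d / 2 / L * cabs et <= e * cabs d / 2 * cabs k.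
  apply: le_trans (ler_wpM2l (ltW e2) B) _.
  by rewrite mulrA divfK// lt0r_neq0.
lra.
Qed.

Variables (W : set C) (q : C -> C).
Hypothesis q_hol : forall z, cabs z < 1 -> chol q z.
Hypothesis q_cov : covering_map unit_disc W q.

(** Even covering reduced to what lifting uses: through each point over the disc of radius [l] about
    [a] passes a continuous section, inverse to [q] on both sides near that point. *)
Definition evenly a (l : R) := forall x, cabs x < 1 -> cabs (q x - a) < l ->
  exists sg : C -> C,
   (forall v, cabs (v - a) < l -> [/\ cabs (sg v) < 1, q (sg v) = v & ccont sg v]) /\
   (exists2 dl : R, 0 < dl & forall y, cabs (y - x) < dl -> sg (q y) = y).

Let evenlyP a : W a -> exists2 l : R, 0 < l & evenly a l.
Proof.
case: q_cov => _ _ /[apply] -[V [F [[oV Va] VW tF FE FP]]].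
have [l l0 lV] := (open_cabsP V).1 oV a Va.
exists l => // x x1 /lV xV.
have : (unit_disc `&` q @^-1` V) x by [].
rewrite -FE => -[S FS Sx].
have [oS [_ [S1 S2 S3] [sg [sgc sgq]]]] := FP S FS.
have SD y : S y -> cabs y < 1.
  move=> Sy; have : (unit_disc `&` q @^-1` V) y by rewrite -FE; exists S.
  by case.
have [dl dl0 dS] := (open_cabsP S).1 oS x Sx.
exists sg; split; last by exists dl => // y /dS /sgq.
move=> v /lV Vv; have [y Sy <-] := S3 v Vv; rewrite sgq//; split=> //; first exact: SD.
by move/(within_continuousC _ oV): sgc; apply; exact: S1.
Qed.

Let q_in z : cabs z < 1 -> W (q z).
Proof. by move=> z1; case: q_cov => _ <- _; exists z. Qed.

Let q_inj x : cabs x < 1 -> exists2 dl : R, 0 < dl &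
  forall y y', cabs (y - x) < dl -> cabs (y' - x) < dl -> q y = q y' -> y = y'.
Proof.
move=> x1; have [l l0 ev] := evenlyP (q_in x1).
have [|sg [_ [dl dl0 H]]] := ev x x1; first by rewrite subrr cabs0.
by exists dl => // y y' yx yx' E; rewrite -(H y)// E H.
Qed.

Let q_der x d : cabs x < 1 -> cdiff q x d -> d != 0.
Proof.
move=> x1 qd; have [dl dl0 H] := q_inj x1.
have m0 : 0 < Num.min dl (1 - cabs x) by rewrite lt_min dl0 subr_gt0.
apply: (injective_der_neq0 m0 _ _ qd) => [z|z w]; rewrite !lt_min => /andP[z1 z2].
  by apply: q_hol; have := cabs_trile z x; lra.
by move=> /andP[w1 _]; exact: H.
Qed.

(** The segment from [y0] to [y1] lies in both discs by convexity. Along it agreement is open by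
    local injectivity of [q] and closed by continuity. *)
Let sections_agree a l a' l' (sg sg' : C -> C) y0 y1 :
  (forall v, cabs (v - a) < l -> [/\ cabs (sg v) < 1, q (sg v) = v & ccont sg v]) ->
  (forall v, cabs (v - a') < l' -> [/\ cabs (sg' v) < 1, q (sg' v) = v & ccont sg' v]) ->
  cabs (y0 - a) < l -> cabs (y1 - a) < l -> cabs (y0 - a') < l' -> cabs (y1 - a') < l' ->
  sg y0 = sg' y0 -> sg y1 = sg' y1.
Proof.
move=> H H' y0l y1l y0l' y1l' E0; pose g t := y0 + t%:C * (y1 - y0).
have seg b r t : cabs (y0 - b) < r -> cabs (y1 - b) < r -> 0 <= t <= 1 -> cabs (g t - b) < r.
  move=> az bz ht; rewrite (_ : _ - b = (1 - t)%:C * (y0 - b) + t%:C * (y1 - b)).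
    apply: le_lt_trans (cabsD _ _) _; rewrite !cabsM !cabsR !ger0_norm; try lra.
    have [m [ma mb mr]] : exists m, [/\ cabs (y0 - b) <= m, cabs (y1 - b) <= m & m < r].
      by exists (Num.max (cabs (y0 - b)) (cabs (y1 - b))); rewrite !le_max !lexx orbT gt_max az bz.
    by have := cabs_ge0 (y0 - b); nra.
  by rewrite /g rmorphB rmorph1 /=; ring.
have g1 : g 1 = y1 by rewrite /g rmorph1 mul1r addBK.
rewrite -g1; apply: (@interval_clopen _ (fun t => sg (g t) = sg' (g t))); last lra.
  by rewrite /g rmorph0 mul0r addr0.
move=> t ht; have [s1 s2 s3] := H _ (seg a l t y0l y1l ht).
have [s1' s2' s3'] := H' _ (seg a' l' t y0l' y1l' ht).
have gc := pcont_seg y0 (y1 - y0) ht.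
have [E|/eqP E] := pselect (sg (g t) = sg' (g t)).
  have [dl dl0 inj] := q_inj s1.
  have [d1 d10 H1] := s3 _ dl0; have [d2 d20 H2] := s3' _ dl0.
  have d12 : 0 < Num.min d1 d2 by rewrite lt_min d10.
  have [d3 d30 H3] := gc _ d12; exists d3 => // t' ht' tt; split=> // _.
  have := H3 t' ht' tt; rewrite lt_min => /andP[/H1 A1 /H2 A2].
  have [_ e1 _] := H _ (seg a l t' y0l y1l ht').
  have [_ e2 _] := H' _ (seg a' l' t' y0l' y1l' ht').
  by apply: inj => //; [rewrite E|rewrite e1 e2].
have e0 : 0 < cabs (sg (g t) - sg' (g t)) / 2 by rewrite divr_gt0// cabs_gt0 subr_eq0.
have [d1 d10 H1] := s3 _ e0; have [d2 d20 H2] := s3' _ e0.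
have d12 : 0 < Num.min d1 d2 by rewrite lt_min d10.
have [d3 d30 H3] := gc _ d12; exists d3 => // t' ht' tt.
have := H3 t' ht' tt; rewrite lt_min => /andP[/H1 A1 /H2 A2].
split=> E'; exfalso; last by rewrite E' eqxx in E.
have := cabs_tri (sg (g t')) (sg (g t)) (sg' (g t)); rewrite (cabsC (sg (g t)) (sg (g t'))) -/(g _).
move: A1 A2; rewrite -/(g _) -/(g _) -E'; lra.
Qed.

(* The map z |-> p (t z) is lifted for t = 0, 1/n, ..., 1 successively, n being
   so large that consecutive values lie in a common evenly covered disc. *)
Lemma covering_lift (p : C -> C) r r' : 0 < r' < r ->
  (forall z, cabs z < r -> ccont p z /\ W (p z)) -> p 0 = q 0 ->
  exists h : C -> C, h 0 = 0 /\
    forall z, cabs z < r' -> [/\ cabs (h z) < 1, q (h z) = p z & ccont h z].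
Proof.
move=> /andP[r'0 r'r] pP p0.
pose good z e := exists a, exists l : R, evenly a l /\
  forall w, cabs w <= r' -> cabs (w - z) < e -> cabs (p w - a) < l.
have [||om om0 H] := @disc_uniform _ good 0 r' r'0.
- move=> z e e' e0 ee [a [l [ev hl]]]; exists a, l; split=> // w wr wz; apply: hl => //; lra.
- move=> z; rewrite subr0 => zr; have [pc pW] := pP z (le_lt_trans zr r'r).
  have [l l0 ev] := evenlyP pW; have [dl dl0 Hd] := pc _ l0.
  exists (dl / 2) => [|w _ wz]; first lra.
  exists (p z), l; split=> // v _ vw; apply: Hd.
  by have := cabs_tri w v z; lra.
have [n hn] : exists n : nat, r' / om < n%:R.
  by eexists; apply: archi_boundP; rewrite divr_ge0 ?ltW.
have n0 : 0 < n%:R :> R by apply: le_lt_trans hn; rewrite divr_ge0 ?ltW.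
pose T (k : nat) : R := k%:R / n%:R.
have T01 k : (k <= n)%N -> 0 <= T k <= 1.
  by move=> kn; rewrite divr_ge0//= ler_pdivrMr// mul1r ler_nat.
have Tr k z : (k <= n)%N -> cabs z < r' -> cabs ((T k)%:C * z) < r'.
  by move=> /T01 kn; apply: le_lt_trans; exact: cabs_shrink.
suff /(_ n (leqnn n))[h [h0 hP]] : forall k : nat, (k <= n)%N -> exists h : C -> C, h 0 = 0 /\
    forall z, cabs z < r' -> [/\ cabs (h z) < 1, q (h z) = p ((T k)%:C * z) & ccont h z].
  exists h; split=> // z /hP[h1 h2 h3]; split=> //.
  by rewrite h2 /T divff ?lt0r_neq0// rmorph1 mul1r.
elim=> [|k IH] kn.
  exists (fun=> 0); split=> // z zr; split; first by rewrite cabs0.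
    by rewrite /T mul0r rmorph0 mul0r p0.
  exact: cdiff_cont (cdiff_cst _ _).
have [h [h0 hP]] := IH (ltnW kn).
have near z : cabs z < r' -> cabs ((T k.+1)%:C * z - (T k)%:C * z) < om.
  move=> zr; rewrite (_ : _ - _ = (n%:R^-1 : R)%:C * z); last first.
    by rewrite /T -(natr1 k) mulrDl mul1r rmorphD /=; ring.
  rewrite cabsM cabsR ger0_norm; last by rewrite invr_ge0 ltW.
  rewrite mulrC ltr_pdivrMr//; apply: lt_trans zr _.
  by rewrite mulrC -ltr_pdivrMr.
have ex z : exists sal : (C -> C) * C * R, cabs z < r' ->
   [/\ forall w, cabs w <= r' -> cabs (w - (T k)%:C * z) < om -> cabs (p w - sal.1.2) < sal.2,
    forall v, cabs (v - sal.1.2) < sal.2 ->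
      [/\ cabs (sal.1.1 v) < 1, q (sal.1.1 v) = v & ccont sal.1.1 v] &
    exists2 dl : R, 0 < dl & forall y, cabs (y - h z) < dl -> sal.1.1 (q y) = y].
  have [zr|] := pselect (cabs z < r'); last by exists (id, 0, 0).
  have [h1 h2 _] := hP z zr; have kz := Tr k z (ltnW kn) zr.
  have [|a [l [ev hl]]] := H ((T k)%:C * z); first by rewrite subr0 ltW.
  have [|sg [s1 s2]] := ev (h z) h1.
    by rewrite h2; apply: hl; rewrite ?subrr ?cabs0// ltW.
  by exists (sg, a, l).
have [sal salP] := choice ex.
pose h' z := (sal z).1.1 (p ((T k.+1)%:C * z)).
exists h'; split.
  rewrite /h' mulr0 p0; have [|_ _ [dl dl0 E]] := salP 0; first by rewrite cabs0.
  by apply: E; rewrite h0 subrr cabs0.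
move=> z zr; have [a1 a2 [dl dl0 a3]] := salP z zr; have [h1 h2 h3] := hP z zr.
have kz := Tr k z (ltnW kn) zr; have kz1 := Tr k.+1 z kn zr.
have pin : cabs (p ((T k.+1)%:C * z) - (sal z).1.2) < (sal z).2.
  by apply: a1; [exact: ltW|exact: near].
have [b1 b2 b3] := a2 _ pin.
split=> //; move=> e e0.
have [e1 e10 E1] := b3 _ e0.
have pc : ccont p ((T k.+1)%:C * z) by apply: (pP _ _).1; exact: lt_trans r'r.
have [e2 e20 E2] := pc _ e10.
have [e3 e30 E3] := h3 _ dl0.
pose e4 := om - cabs ((T k.+1)%:C * z - (T k)%:C * z).
have e40 : 0 < e4 by rewrite subr_gt0; exact: near.
exists (Num.min (Num.min (r' - cabs z) e2) (Num.min e3 (Num.min e4 om))).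
  by rewrite !lt_min subr_gt0 zr e20 e30 e40.
move=> w; rewrite !lt_min => /andP[/andP[w1 w2] /andP[w3 /andP[w4 w5]]].
have wr : cabs w < r'.
  by apply: le_lt_trans (cabs_trile w z) _; rewrite addrC -ltrBrDr.
have kw := Tr k w (ltnW kn) wr; have kw1 := Tr k.+1 w kn wr.
have scale j : (j <= n)%N -> cabs ((T j)%:C * w - (T j)%:C * z) <= cabs (w - z).
  by move=> /T01 jn; rewrite -mulrBr; exact: cabs_shrink.
(* The sections chosen at [w] and at [z] both send [p (T k * w)] to [h w], hence agree at
   [p (T k.+1 * w)]. So near [z] the map [h'] is given by a single section, which is continuous. *)
have hwE : h' w = (sal z).1.1 (p ((T k.+1)%:C * w)).
  have [c1 c2 [dl' dl'0 c3]] := salP w wr; have [g1 g2 g3] := hP w wr.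
  apply: (sections_agree c2 a2 (y0 := p ((T k)%:C * w))).
  - by apply: c1; rewrite ?subrr ?cabs0// ltW.
  - by apply: c1; [exact: ltW|exact: near].
  - by apply: a1; [exact: ltW|exact: le_lt_trans (scale k (ltnW kn)) w5].
  - apply: a1; first exact: ltW.
    apply: le_lt_trans (cabs_tri ((T k.+1)%:C * z) _ _) _; rewrite -ltrBrDr.
    exact: le_lt_trans (scale _ kn) w4.
  - by rewrite -g2 c3 ?a3// ?subrr ?cabs0//; exact: E3.
by rewrite hwE; apply: E1; apply: E2; exact: le_lt_trans (scale _ kn) w2.
Qed.

Lemma covering_compare (p : C -> C) dp dq r : 0 < r ->
  (forall z, cabs z < r -> chol p z /\ W (p z)) -> p 0 = q 0 ->
  cdiff p 0 dp -> cdiff q 0 dq -> cabs dp * r <= cabs dq.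
Proof.
move=> r0 pP p0 pd qd.
have key r' : 0 < r' < r -> cabs dp * r' <= cabs dq.
  move=> rr; have [h [h0 hP]] := @covering_lift p r r' rr
    (fun z zr => conj (chol_cont (pP z zr).1) (pP z zr).2) p0.
  have /andP[r'0 r'r] := rr.
  have hd z : cabs z < r' -> chol h z.
    move=> zr; have [h1 h2 h3] := hP z zr.
    have [d1 qd1] := q_hol h1; have [d2 pd2] := (pP z (lt_trans zr r'r)).1.
    exists (d2 / d1); apply: (@lift_chol q h p z d1 d2 (r' - cabs z)) => //.
    - lra.
    - exact: q_der h1 qd1.
    - by move=> w wz; have [] := hP w ltac:(have := cabs_trile w z; lra).
  have [_ _ hc] := hP 0 ltac:(by rewrite cabs0).
  have qn : dq != 0 by apply: q_der qd; rewrite cabs0.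
  have hd0 : cdiff h 0 (dp / dq).
    apply: (@lift_chol q h p 0 dq dp r') => //; first by rewrite h0.
    by move=> w; rewrite subr0 => /hP[].
  have := @cdiff_bound _ h 0 (dp / dq) r' 1 r'0 _ hd0.
  rewrite h0 cabsM cabsV ler_pdivlMr// => A.
  have {}A : cabs dp / cabs dq * r' <= 1.
    apply: A => z; rewrite subr0 => zr; split; first exact: hd.
    by rewrite subr0 ltW//; have [] := hP z zr.
  by move: A; rewrite mulrAC ler_pdivrMr ?cabs_gt0// mul1r.
apply: (@le_of_scale _ _ _ 0) => // t /andP[t0 t1].
rewrite mulrCA; apply: key; rewrite mulr_gt0//= gtr_pMl//.
Qed.

End Lifting.

(** * Comparison of the densities *)

Section Asymptotics.
Context {R : realType}.
Implicit Types (x c k e l : R).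

Lemma pow2_between x : 1 <= x -> exists m, x <= 2 ^+ m /\ 2 ^+ m <= 2 * x.
Proof.
move=> x1; have ex : exists m, x <= 2 ^+ m.
  have [m hm] := exp2_small x ltr01; exists m; apply: ltW.
  by rewrite -[ltRHS]mul1r -ltr_pdivrMr// exprn_gt0.
case: (ex_minnP ex) => m hm mmin; exists m; split=> //.
case: m hm mmin => [|m] hm mmin; first by rewrite expr0; lra.
rewrite exprS ler_pM2l//; apply: ltW; rewrite ltNge; apply/negP => /mmin.
by rewrite ltnn.
Qed.

(** With [ta = c / l], [pow_one_sub] asks for [2 ^ m >= 4 / (ta * k)], and a power of two within a
    factor 2 of this is taken. Then [(ta / 8) ^ (2 ^ m)] is at least [exp (- B * l ^ 2)], while
    [e = exp (- exp l)]. *)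
Lemma loglog_scale c k : 0 < c -> 0 < k < 1 ->
  exists2 e0, 0 < e0 & forall e, 0 < e -> e < e0 ->
    let l := ln (ln (1 / e)) in
    [/\ 0 < l, 0 < c / l < 1 &
     exists m, (1 - c / l / 4) ^+ (2 ^ m) <= k /\ e <= (c / l / 8) ^+ (2 ^ m)].
Proof.
move=> c0 /andP[k0 k1]; pose B := 64 / (c ^+ 2 * k).
have B0 : 0 < B by rewrite divr_gt0// mulr_gt0// exprn_gt0.
(* The term [27 * B] ensures [B * l ^ 2 <= (l / 3) ^ 3 <= exp l], and [2 * c] ensures
   [c / l < 1]. *)
pose l0 := 27 * B + 2 * c + 1.
exists (expR (- expR l0)); first exact: expR_gt0.
move=> e e0 el l.
have E1 : expR l0 < ln (1 / e).
  by rewrite div1r lnV ?posrE// ltrNr -[ltRHS](expRK (- expR l0)) ltr_ln ?posrE ?expR_gt0.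
have ll : l0 < l.
  rewrite /l -[ltLHS](expRK l0) ltr_ln ?posrE ?expR_gt0//.
  exact: lt_trans (expR_gt0 _) E1.
have l1 : 0 < l by apply: lt_trans ll; rewrite /l0; lra.
have ee : e = expR (- expR l).
  rewrite /l lnK ?posrE; last exact: lt_trans (expR_gt0 _) E1.
  by rewrite div1r lnV ?posrE// opprK lnK ?posrE.
set ta := c / l.
have t0 : 0 < ta by rewrite divr_gt0.
have t1 : ta < 1 by rewrite ltr_pdivrMr// mul1r; apply: le_lt_trans ll; rewrite /l0; lra.
split=> //; first by rewrite t0.
have tk := mulr_gt0 t0 k0.
have x1 : 1 <= 4 / (ta * k).
  have : ta * k <= 1 * 1 by apply: ler_pM; rewrite ?ltW.
  by rewrite (ler_pdivlMr _ _ tk) mul1r; lra.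
have [m [m1 m2]] := pow2_between x1; exists m; split.
  have := @pow_one_sub R (ta / 4) (2 ^ m) ltac:(lra); rewrite natrX => A.
  have N0 : 0 < (2 : R) ^+ m by rewrite exprn_gt0.
  have q0 : 0 < 1 + 2 ^+ m * (ta / 4) by have := mulr_gt0 N0 t0; lra.
  rewrite -ler_pdivlMr// in A; apply: le_trans A _.
  rewrite ler_pdivrMr// mulrDr mulr1.
  have : 4 <= 2 ^+ m * (ta * k) by rewrite -(ler_pdivrMr _ _ tk).
  lra.
have A1 : expR (- (8 / ta)) <= ta / 8.
  have h8 : 0 < 8 / ta by rewrite divr_gt0.
  rewrite expRN -[leRHS]invrK lef_pV2 ?posrE ?expR_gt0 ?invr_gt0 ?divr_gt0//.
  by rewrite invf_div; apply: le_trans (expR_ge1Dx _); lra.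
apply: (@le_trans _ _ (expR (- (8 / ta)) ^+ (2 ^ m))); last first.
  by apply: lerXn2r; rewrite ?nnegrE ?expR_ge0//; lra.
rewrite -expRM_natl [leLHS]ee ler_expR mulrN lerN2 natrX.
have N8 : 2 ^+ m * (8 / ta) <= B * l ^+ 2.
  apply: (@le_trans _ _ (2 * (4 / (ta * k)) * (8 / ta))).
    by rewrite ler_pM2r ?divr_gt0.
  rewrite le_eqVlt; apply/orP; left; apply/eqP; rewrite /B /ta; field.
  by rewrite !lt0r_neq0.
apply: le_trans N8 _.
have E3 : (l / 3) ^+ 3 <= expR l.
  rewrite [X in expR X](_ : l = 3%:R * (l / 3)); last by field.
  rewrite expRM_natl; apply: lerXn2r; rewrite ?nnegrE ?expR_ge0 ?divr_ge0 ?(ltW l1)//.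
  by apply: le_trans (expR_ge1Dx _); lra.
apply: le_trans E3; rewrite (_ : (l / 3) ^+ 3 = l / 27 * l ^+ 2); last by field.
apply: ler_wpM2r; first exact: sqr_ge0.
by rewrite /l0 in ll; lra.
Qed.

End Asymptotics.

(** * Boundaries, Hausdorff distance and boundedness *)

Section Boundary.
Context {R : realType}.
Local Notation C := R[i].
Implicit Types (z w a b : C) (r M t e d : R) (A U W K : set C).

Lemma boundary_open_notin A a : open A -> boundary A a -> ~ A a.
Proof. by move=> oA [_]; rewrite (_ : interior A = A)//; exact/interior_id. Qed.

Lemma boundary_near A a : boundary A a -> forall e, 0 < e -> exists2 w, A w & cabs (w - a) < e.
Proof.
move=> [cAa _] e e0; have [|w [Aw wa]] := cAa [set w | cabs (w - a) < e].
  by apply/nbhs_cabsP; exists e.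
by exists w.
Qed.

Lemma boundary_bound A M a : (forall z, A z -> cabs z <= M) -> boundary A a -> cabs a <= M.
Proof.
move=> AM /boundary_near H; apply/ler_addgt0Pr => e /H[w /AM wM wa].
by have := cabs_trile a w; rewrite (cabsC a); lra.
Qed.

(** Off the boundary a point is interior or exterior, both open conditions, so membership is locally
    constant along the path. This is how points are shown to lie in [W], where only the position of
    the boundary is known. *)
Lemma path_stays A (g : R -> C) : open A -> pcont g -> A (g 0) ->
  (forall t, 0 <= t <= 1 -> ~ boundary A (g t)) -> forall t, 0 <= t <= 1 -> A (g t).
Proof.
move=> oA gc A0 gb; apply: (@interval_clopen _ (fun t => A (g t))) => // t ht.
have [Ag|nA] := pselect (A (g t)).
  have [r r0 rA] := (open_cabsP A).1 oA _ Ag.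
  by have [dl dl0 H] := gc t ht r r0; exists dl => // t' ht' /(H t' ht') /rA.
have : ~ closure A (g t).
  by move=> cl; apply: (gb t ht); split=> // /interior_subset.
move=> /existsNP[B /not_implyP[/nbhs_cabsP[r r0 rB] nB]].
have [dl dl0 H] := gc t ht r r0; exists dl => // t' ht' /(H t' ht') /rB Bg.
by split=> // Ag; exfalso; apply: nB; exists (g t').
Qed.

(** The factor 2 leaves room for an admissible radius strictly above the infimum. *)
Lemma hausdorff_close A B e : (hausdorff_dist A B <= e%:E)%E -> 0 < e ->
  (forall a, A a -> exists2 b, B b & cabs (a - b) < 2 * e) /\
  (forall b, B b -> exists2 a, A a & cabs (b - a) < 2 * e).
Proof.
move=> H e0; have : (hausdorff_dist A B < (2 * e)%:E)%E.
  by apply: le_lt_trans H _; rewrite lte_fin; lra.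
move=> /ereal_inf_lt[_ [r [r0 AB BA] <-]]; rewrite lte_fin => re.
have th (S : set C) x : thickening r S x -> exists2 b, S b & cabs (x - b) < 2 * e.
  move=> /ereal_inf_lt[_ [_ -> [b Sb <-]]]; rewrite lte_fin => xb.
  by exists b => //; exact: lt_trans xb re.
by split=> x; [move/AB|move/BA]; exact: th.
Qed.

Lemma bounded_set_cabs A : bounded_set A -> exists2 M, 0 <= M & forall z, A z -> cabs z <= M.
Proof.
move=> [M [Mr HM]]; have ME : M = (Re M)%:C by rewrite RRe_real.
exists (`|Re M| + 1); first by rewrite addr_ge0.
move=> z Az; have Mlt : M < (`|Re M| + 1)%:C by rewrite ME ltcR ltr_pwDr// ler_norm.
have := HM _ Mlt z Az; rewrite /= => H.
have : `|z| <= (`|Re M| + 1)%:C by exact: H.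
by rewrite normc_def lecR; case: (z).
Qed.

Lemma compact_margin K U : compact K -> open U -> K `<=` U ->
  exists2 d, 0 < d & forall z w, K z -> cabs (w - z) < d -> U w.
Proof.
move=> cK oU KU.
have := (compact_near_coveringP K).1 cK R (0^'+) (fun d z => forall w, cabs (w - z) < d -> U w) _.
case=> [z Kz|].
  have [r r0 rU] := (open_cabsP U).1 oU z (KU z Kz).
  exists ([set x | cabs (x - z) < r / 2], [set d : R | d < r / 2]).
    split=> /=; first by apply/nbhs_cabsP; exists (r / 2) => //; lra.
    by apply: nbhs_right_lt; lra.
  move=> [x d] /= [xz dr] w wx; apply: rU.
  by have := cabs_tri x w z; lra.
move=> e /= e0 H; exists (e / 2); first lra.
move=> z w Kz wz; apply: (H (e / 2)) (wz) => //=; last lra.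
by rewrite sub0r normrN gtr0_norm; lra.
Qed.

Lemma cexp_pcont (c k : C) : pcont (fun t : R => c * cexp (k * t%:C)).
Proof.
apply: (@pcont_comp _ setT (fun z => c * cexp (k * z)) (fun t => t%:C)) => //.
  move=> t ht e e0; have [dl dl0 H] := pcont_seg 0 (1 : C) ht e0.
  by exists dl => // t' ht' /(H t' ht'); rewrite !add0r !mulr1.
move=> z _; apply/ccont_wcont/chol_cont.
apply: cholM (chol_cst _ _) _; apply: (@chol_comp _ (fun z => k * z) cexp).
  by apply: cholM (chol_cst _ _) (chol_id _).
by eexists; exact: cdiff_cexp.
Qed.

(* An unbounded W with bounded boundary contains a large circle around a
   boundary point a, on which z - a has no continuous square root. *)
Lemma simply_connected_bounded W a M : domain W -> simply_connected W ->
  boundary W a -> (forall b, boundary W b -> cabs b < M) ->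
  forall w, W w -> cabs w <= M.
Proof.
move=> dW scW ba bM w Ww; rewrite leNgt; apply/negP => wM.
have [_ oW cW] := dW; have aM := bM a ba.
have M0 : 0 < M by apply: le_lt_trans aM; exact: cabs_ge0.
(* Moving outwards along the ray through [w] increases the modulus, so the boundary is not met. At
   [w' = (1 + s) w] the modulus exceeds [3 * M], hence the circle about [a] through [w'] stays
   outside [|z| <= M]. *)
pose s := 2 * (M + M) / cabs w.
have w0 : 0 < cabs w by lra.
have s0 : 0 < s by rewrite divr_gt0//; lra.
have ray t : 0 <= t <= 1 -> W (w + t%:C * (s%:C * w)).
  apply: (@path_stays W (fun t => w + t%:C * (s%:C * w))) => //; first exact: pcont_seg.
    by rewrite rmorph0 mul0r addr0.
  move=> t' ht /bM; apply/negP; rewrite -leNgt.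
  rewrite (_ : w + t'%:C * (s%:C * w) = (1 + t' * s)%:C * w); last first.
    have -> : (1 + t' * s)%:C = 1 + t'%:C * s%:C :> C by rewrite -rmorphM -(rmorph1 (real_complex R)) -rmorphD.
    by rewrite mulrDl mul1r mulrA.
  rewrite cabsM cabsR ger0_norm; last by rewrite addr_ge0// mulr_ge0//; lra.
  have : 0 <= t' * s by rewrite mulr_ge0//; lra.
  by move=> ts; have := mulr_ge0 ts (ltW w0); lra.
pose w' := w + s%:C * w; have Ww' : W w' by rewrite /w' -[s%:C * w]mul1r -(rmorph1 (real_complex R)); apply: ray; lra.
have w'M : 3 * M < cabs w'.
  rewrite /w' -{1}[w]mul1r -mulrDl cabsM -(rmorph1 (real_complex R)) -rmorphD cabsR ger0_norm; last lra.
  have sw : s * cabs w = 2 * (M + M) by rewrite /s divfK// lt0r_neq0.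
  lra.
have wa : 2 * M < cabs (w' - a) by have := cabs_trile w' a; lra.
pose k : C := 0 +i* (pi *+ 2).
pose g t := a + (w' - a) * cexp (k * t%:C).
have kE t : k * t%:C = 0 +i* (pi *+ 2 * t).
  by rewrite /k; apply/eqP; rewrite eq_complex /=; apply/andP; split; apply/eqP; ring.
have gn t : cabs (g t - a) = cabs (w' - a).
  by rewrite /g addKB cabsM kE cabs_cexp /= expR0 mulr1.
have gc : pcont g.
  move=> t ht e e0; have [dl dl0 H] := cexp_pcont (w' - a) k ht e0.
  exists dl => // t' ht' /(H t' ht').
  by rewrite /g (_ : a + _ - (a + _) = (w' - a) * cexp (k * t'%:C) - (w' - a) * cexp (k * t%:C))//; ring.
have g0 : g 0 = w' by rewrite /g rmorph0 mulr0 cexp0 mulr1 addBK.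
have g1 : g 1 = w'.
  by rewrite /g rmorph1 mulr1 [cexp k]cexp_2pi mulr1 addBK.
have gW t : 0 <= t <= 1 -> W (g t).
  apply: path_stays => //; first by rewrite g0.
  move=> t' _ /bM; apply/negP; rewrite -leNgt.
  by have := gn t'; have := cabsB (g t') a; lra.
have nWa : ~ W a := boundary_open_notin oW ba.
have [||S SP] := @sqrt_simply_connected _ W (fun z => z - a) dW scW.
- by move=> z _; apply/chol_cont/cholB; [exact: chol_id|exact: chol_cst].
- by move=> z Wz; rewrite subr_eq0; apply: contra_notN nWa => /eqP <-.
have Sw : S w' != 0.
  by rewrite -sqrf_eq0 (SP w' Ww').2 -cabs_gt0; lra.
pose k2 : C := 0 +i* pi.
have k2E t : cexp (k2 * t%:C) ^+ 2 = cexp (k * t%:C).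
  rewrite expr2 -cexpD; congr cexp; rewrite /k /k2.
  by apply/eqP; rewrite eq_complex /=; apply/andP; split; apply/eqP; ring.
(* The root continued along the circle turns at half speed and returns with the opposite sign. *)
pose T t := S w' * cexp (k2 * t%:C).
have := @path_sqrt_uniq _ (S \o g) T _ _ _ _ _ 1 ltac:(lra).
rewrite /= g1 /T rmorph1 mulr1 => H.
have : S w' = S w' * cexp k2.
  apply: H.
  - by apply: (@pcont_comp _ W S g) => // z /SP[Sc _]; exact: ccont_wcont.
  - exact: cexp_pcont.
  - move=> t ht; rewrite (SP _ (gW t ht)).2 exprMn k2E (SP w' Ww').2 /g addKB//.
  - move=> t _; rewrite mulf_neq0// -cabs_gt0 cabs_cexp; exact: expR_gt0.
  - by rewrite g0 rmorph0 mulr0 cexp0 mulr1.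
have -> : cexp k2 = -1.
  by rewrite /cexp /k2 /= expR0 cospi sinpi; apply/eqP; rewrite eq_complex /=; apply/andP; split; apply/eqP; ring.
rewrite mulrN1 => /eqP; rewrite -subr_eq0 opprK -mulr2n -mulr_natl mulf_eq0 (negbTE Sw) orbF.
by rewrite pnatr_eq0.
Qed.

(** A segment of length [2 * M + 1] must leave [U], by [path_stays] through the boundary. The point
    found supplies, via the Hausdorff distance, the boundary point of [W] required by
    [simply_connected_bounded]. *)
Lemma boundary_nonempty U M : domain U -> (forall z, U z -> cabs z <= M) ->
  exists a, boundary U a.
Proof.
move=> [[z Uz] oU _] UM; apply: contrapT => /forallNP nb.
have z0 := cabs_ge0 z; have zM := UM z Uz.
have := @path_stays U (fun t => z + t%:C * (2 * M + 1)%:C) oU _ _ _ 1 ltac:(lra).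
rewrite rmorph1 mul1r rmorph0 mul0r addr0 => /(_ _ Uz (fun t _ => nb _)) H.
have := UM _ (H (pcont_seg _ _)).
have := cabs_trile (2 * M + 1)%:C (z + (2 * M + 1)%:C).
rewrite (_ : _%:C - (z + _) = - z); last by ring.
rewrite cabsN cabsR ger0_norm; lra.
Qed.

(** The image of the radius to [w] starts in [W] and could leave it only through a boundary point of
    [W], which is within [e] of a boundary point [a] of [U]. As [p - a] is zero-free and bounded by
    [2 * M], [avoid_lower_bound] forbids this. *)
Lemma disc_image_subset U W (p : C -> C) M d e ta m :
  open U -> open W -> (forall z, U z -> cabs z <= M) ->
  (forall z, cabs z < 1 -> chol p z /\ U (p z)) -> W (p 0) -> 0 < d ->
  (forall w, cabs (w - p 0) < d -> U w) ->
  (forall b, boundary W b -> exists2 a, boundary U a & cabs (b - a) < e) ->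
  0 < ta < 1 -> (1 - ta / 4) ^+ (2 ^ m) <= d / (2 * M) ->
  e <= 2 * M * (ta / 8) ^+ (2 ^ m) ->
  forall w, cabs w < 1 - ta -> W (p w).
Proof.
move=> oU oW UM pP Wp d0 dU bW ta01 hm he w wt.
have M0 : 0 <= M by apply: le_trans (UM (p 0) _); [exact: cabs_ge0|apply: dU; rewrite subrr cabs0].
have tw t : 0 <= t <= 1 -> cabs (t%:C * w) <= cabs w.
  by move=> ht; rewrite cabsM cabsR ger0_norm; [have := cabs_ge0 w; nra|lra].
have ta0 : 0 < ta by lra.
have := @path_stays W (fun t => p (0 + t%:C * w)) oW _ _ _ 1 ltac:(lra).
rewrite rmorph1 mul1r rmorph0 mul0r !add0r; apply => //.
  apply: (@pcont_comp _ [set z | cabs z < 1] p (fun t => 0 + t%:C * w)) => //.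
  - by move=> t ht; rewrite /mkset add0r; have := tw t ht; lra.
  - exact: pcont_seg.
  - by move=> z z1; apply/ccont_wcont/chol_cont/(pP z z1).1.
move=> t ht; rewrite add0r => /bW[a ba pa].
have nUa := boundary_open_notin oU ba; have aM := boundary_bound UM ba.
have : 2 * M * (ta / 8) ^+ (2 ^ m) <= cabs (p (t%:C * w) - a).
  apply: (@avoid_lower_bound _ (fun z => p z - a) (2 * M) ta) => //.
  - move=> z z1; have [pz Uz] := pP z z1; split.
    + exact: cholB pz (chol_cst _ _).
    + by rewrite subr_eq0; apply: contra_notN nUa => /eqP <-.
    + by have := cabsB (p z) a; have := UM _ Uz; lra.
  - apply: le_trans hm _; apply: ler_wpM2r; first by rewrite invr_ge0 mulr_ge0.
    by rewrite cabsC leNgt; apply/negP => /dU.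
  - by have := tw t ht; lra.
lra.
Qed.

End Boundary.

Section Density.
Context {R : realType}.
Local Notation C := R[i].
Implicit Types (z w a b : C) (r M t e d : R) (A U W K : set C).

(** [xget] returns the value given by some covering, and the later estimates hold for whichever it
    is; the Riemann map excludes the default 0. *)
Lemma hyperbolic_densityP A z M : domain A -> simply_connected A -> A z ->
  (forall w, A w -> cabs w <= M) ->
  exists p : C -> C, exists d : C,
    [/\ forall w, cabs w < 1 -> chol p w, covering_map unit_disc A p, p 0 = z,
      cdiff p 0 d & hyperbolic_density A z = (cabs d)^-1].
Proof.
move=> dA scA Az AM; rewrite /hyperbolic_density; case: xgetP => [r -> [p [ph pc p0 rE]]|nx].
  have hp w : cabs w < 1 -> chol p w by move=> /ph/derivable_cholP.
  have [d pd] := hp 0 ltac:(by rewrite cabs0).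
  by exists p, d; split=> //; rewrite rE (derive1_eq pd).
have [p [ph pc p0]] := riemann_covering dA scA Az AM.
by exfalso; apply: (nx (cabs (derive1 p 0))^-1); exists p; split.
Qed.

Lemma covering_in A (p : C -> C) : covering_map unit_disc A p ->
  forall w, cabs w < 1 -> A (p w).
Proof. by move=> [_ <- _] w w1; exists w. Qed.

(** Comparison of [q] with the translation that carries the disc of radius [d] about 0 into [A]. *)
Lemma covering_der_lower A (q : C -> C) dq d : (forall w, cabs w < 1 -> chol q w) ->
  covering_map unit_disc A q -> cdiff q 0 dq -> 0 < d ->
  (forall w, cabs (w - q 0) < d -> A w) -> d <= cabs dq.
Proof.
move=> qh qc qd d0 dA.
rewrite -[leLHS]mul1r -(@cabs1 R); apply: (covering_compare qh qc (p := fun w => q 0 + 1 * w)) => //.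
- by move=> w wd; split; [exact: chol_affine|apply: dA; rewrite mul1r addKB].
- by rewrite mulr0 addr0.
- exact: cdiff_affine.
Qed.

Lemma inverse_distance (x y ta d : R) : 0 < d -> d <= x -> d <= y -> 0 < ta ->
  x * (1 - ta) <= y -> y * (1 - ta) <= x -> `|x^-1 - y^-1| <= ta / d.
Proof.
move=> d0 dx dy t0 xy yx; have x0 : 0 < x by lra.
have y0 : 0 < y by lra.
have -> : x^-1 - y^-1 = (y - x) / (x * y) by field; rewrite !lt0r_neq0.
have xyp : 0 < x * y by rewrite mulr_gt0.
rewrite normrM normfV (gtr0_norm xyp) ler_pdivrMr// mulrAC ler_pdivlMr//.
have [h|h] := leP x y.
  rewrite ger0_norm ?subr_ge0//; apply: (@le_trans _ _ (ta * y * d)).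
    by rewrite ler_pM2r//; lra.
  by rewrite -[leLHS]mulrA ler_pM2l// (mulrC x) ler_pM2l.
rewrite ltr0_norm ?subr_lt0// opprB; apply: (@le_trans _ _ (ta * x * d)).
  by rewrite ler_pM2r//; lra.
by rewrite -[leLHS]mulrA ler_pM2l// ler_pM2l.
Qed.

End Density.

Theorem corollary1 (R : realType) :
  exists C : \bar R -> \bar R -> R,
  forall U K : set R[i],
    domain U -> simply_connected U -> bounded_set U ->
    compact K -> K `<=` U ->
  exists2 eps0 : R, 0 < eps0 &
  forall (eps : R) (W : set R[i]),
    0 < eps -> eps < eps0 ->
    domain W -> simply_connected W ->
    (hausdorff_dist (boundary U) (boundary W) <= eps%:E)%E ->
  forall z : R[i], K z -> W z ->
    `|hyperbolic_density U z - hyperbolic_density W z|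
      <= C (set_dist K (boundary U)) (diameter U) * (ln (ln (1 / eps)))^-1.
Proof.
exists (fun _ _ => 1) => U K dU scU /bounded_set_cabs[M M0 UM] cK KU.
have [_ oU cU] := dU.
have [d d0 dK] := compact_margin cK oU KU.
pose N := M + 1; have N1 : 1 <= N by rewrite /N; lra.
have c0 : 0 < d / 4 by lra.
(* Discs of radius [d / 2] about points of [K] that lie in [W] will be contained in both domains,
   and [2 * N] bounds the distance from a value of either covering to a boundary point of its image.
   The minimum with 1/2 keeps [k] below 1. *)
pose k := Num.min (d / 2 / (2 * N)) (1 / 2).
have k01 : 0 < k < 1.
  rewrite lt_min !divr_gt0//=; last lra.
  by rewrite gt_min; apply/orP; right; lra.
have [e1 e10 H] := loglog_scale c0 k01.
(* The bound [d / 8] keeps the boundary of [W] at distance at least [d / 2] from [z], and [1 / 4]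
   keeps it inside [|b| < M + 1 = N]. *)
exists (Num.min e1 (Num.min (d / 8) (1 / 4))); first by rewrite !lt_min e10 !divr_gt0.
move=> e W e0; rewrite !lt_min => /andP[ee1 /andP[ed e4]] dW scW Hd z Kz Wz.
have [_ oW cW] := dW.
have [UW WU] := hausdorff_close Hd e0.
have [l0 t01 [m [hm he]]] := H e e0 ee1.
set l := ln (ln (1 / e)) in l0 t01 hm he *; set ta := d / 4 / l in t01 hm he.
have Uz : U z := KU z Kz.
have bWN b : boundary W b -> cabs b < N.
  move=> /WU[a /(boundary_bound UM) aM ba].
  by have := cabs_trile b a; rewrite /N; lra.
have [a0 ba0] := boundary_nonempty dU UM.
have [b0 bb0 _] := UW _ ba0.
have WN := simply_connected_bounded dW scW bb0 bWN.
have UN w : U w -> cabs w <= N by move=> /UM; rewrite /N; lra.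
have dW2 w : cabs (w - z) < d / 2 -> W w.
  move=> wz; have := @path_stays _ W (fun t => z + t%:C * (w - z)) oW _ _ _ 1 ltac:(lra).
  rewrite rmorph1 mul1r addBK rmorph0 mul0r addr0; apply => //; first exact: pcont_seg.
  move=> t ht /WU[a ba ta_a]; apply: (boundary_open_notin oU ba).
  apply: (dK z) => //; have := cabs_tri (z + t%:C * (w - z)) a z.
  rewrite addKB cabsM cabsR ger0_norm; last lra.
  have : t * cabs (w - z) <= cabs (w - z) by have := cabs_ge0 (w - z); nra.
  by rewrite (cabsC a (z + _)); lra.
have dU2 w : cabs (w - z) < d / 2 -> U w by move=> wz; apply: (dK z) => //; lra.
have [p [dp [ph pc p0 pd ->]]] := hyperbolic_densityP dU scU Uz UM.
have [q [dq [qh qc q0 qd ->]]] := hyperbolic_densityP dW scW Wz WN.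
have d2 : 0 < d / 2 by lra.
have N2 : 0 < 2 * N by lra.
have hm' : (1 - ta / 4) ^+ (2 ^ m) <= d / 2 / (2 * N).
  by apply: le_trans hm _; rewrite ge_min lexx.
(* The factor 2 lost in [hausdorff_close] is covered by the factor [2 * N], as [1 <= N]. *)
have he' : 2 * e <= 2 * N * (ta / 8) ^+ (2 ^ m).
  by rewrite -mulrA ler_pM2l//; apply: le_trans he _; rewrite ler_peMl// exprn_ge0//; lra.
have pW w : cabs w < 1 - ta -> chol p w /\ W (p w).
  move=> wt; split; first by apply: ph; lra.
  apply: (@disc_image_subset _ U W p N (d / 2) (2 * e) ta m) => //; rewrite ?p0//.
  by move=> x x1; split; [exact: ph|exact: (covering_in pc)].
have qU w : cabs w < 1 - ta -> chol q w /\ U (q w).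
  move=> wt; split; first by apply: qh; lra.
  apply: (@disc_image_subset _ W U q N (d / 2) (2 * e) ta m) => //; rewrite ?q0//.
  by move=> x x1; split; [exact: qh|exact: (covering_in qc)].
have t1 : 0 < 1 - ta by lra.
have pq : cabs dp * (1 - ta) <= cabs dq.
  by apply: (covering_compare qh qc t1 pW) => //; rewrite p0 q0.
have qp : cabs dq * (1 - ta) <= cabs dp.
  by apply: (covering_compare ph pc t1 qU) => //; rewrite p0 q0.
have pl : d / 2 <= cabs dp by apply: (covering_der_lower ph pc pd) => //; rewrite p0.
have ql : d / 2 <= cabs dq by apply: (covering_der_lower qh qc qd) => //; rewrite q0.
apply: le_trans (inverse_distance d2 pl ql _ pq qp) _; first lra.
rewrite mul1r (_ : ta / (d / 2) = l^-1 / 2); last first.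
  by rewrite /ta; field; rewrite !lt0r_neq0.
by rewrite ler_piMr ?invr_ge0 ?ltW//; lra.
Qed.
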